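(* Let $p\ge 3$ be an integer with $\gcd(p-2,p)=1$ and let $K=K(p,p-1,1)$ be the Legendrian grid number one knot in $L(p,p-1)$. Let $(\mathcal{A}(K),\partial)$ be its differential graded algebra over $\mathbb{Z}_2$. Then the homology of $(\mathcal{A}(K),\partial)$ is a tensor algebra with two generators. Furthermore, the map sending both generators of $\mathcal{A}(K)$ to $0$ is an augmentation.
   Context: **Lens space and projections.** Let $1<q<p$ be coprime with $\gcd(q-1,p)=1$ (here $q=p-1$). View $S^3=\{(r_1,\theta_1,r_2,\theta_2): r_1^2+r_2^2=1\}\subset\mathbb{C}^2$ (polar coordinates) with contact form $r_1^2d\theta_1+r_2^2d\theta_2$, and let $F_{p,q}(r_1,\theta_1,r_2,\theta_2)=(r_1,\theta_1+\frac{2\pi q}{p},r_2,\theta_2+\frac{2\pi}{p})$. Then $L(p,q)=S^3/\langle F_{p,q}\rangle$ with the induced contact form; for $0<r_1<1$ the Reeb field is $\partial_{\theta_1}+\partial_{\theta_2}$. The Heegaard torus $\Sigma$ is the image of $r_1=r_2=1/\sqrt2$; it is parametrized by $0\le\theta_1<2\pi$ (mod $2\pi$), $0\le\theta_2\le\frac{2\pi}{p}$, with $(\theta_1,0)\sim(\theta_1+\frac{2\pi q}{p},\frac{2\pi}{p})$, and is divided into boxes: Box $c$ is $\frac{2\pi c}{p}\le\theta_1\le\frac{2\pi(c+1)}{p}$, $c=0,\dots,p-1$. Knots lie in the complement of the core curves $r_1=0$ and $r_2=0$. The front projection is the projection to $\Sigma$ along $r_1$; a Legendrian knot is recovered from its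 front by $\frac{d\theta_2}{d\theta_1}=\frac{-r_1^2}{1-r_1^2}$. The Lagrangian projection is the map to the space of Reeb orbits, a sphere $S^2$ with coordinates $r_1\in[0,1]$ (latitude) and $\phi=p(\theta_1-\theta_2)$ mod $2\pi$ (azimuth), drawn with $\phi$ increasing to the right, the pole $r_1=0$ at the top (north) and the pole $r_1=1$ at the bottom (south), and oriented by $d(r_1^2)\wedge d\phi$. **The knot $K(p,q,h)$.** A grid number one diagram is the row of $p$ boxes with a basepoint in two of them. If the basepoints are $s$ boxes apart, $v(s)$ is the integer with $s+v(s)q\equiv 0\bmod p$, $1\le v(s)\le p-1$; put $h=s$ if $s+v(s)<p$, $h=p-s$ if $s+v(s)>p$, and $v=v(h)$ (so $h+v<p$). Assume $\gcd(h,p)=1$, i.e. the knot generates $H_1(L(p,q))$ (is primitive). $K(p,q,h)$ is the Legendrian isotopy class of the following special knot $K_0$. Place basepoints at the centers of Box $0$ and Box $h$; connect them by a horizontal line running right from Box $0$ with length $h$ boxes, then by a vertical line running down from Box $h$ with length $v$ boxes back to Box $0$. Add a basepoint at every box center the curve passes through, so that the curve consists of $h+v$ segments of equal length. Slide each basepoint slightly along the anti-diagonal of its box (the slope $1$ diagonal, on which $\theta_1-\theta_2$ is constant) so that the slopes of the $h+v$ straight segments are negative and strictly decrease as one moves along the curve starting rightward from Box $0$. Finally replace a small neighborhood of each basepoint by a curve interpolating smoothly and strictly monotonically between the two adjacent slopes. All perturbations are sufficiently small. $K_0$ is the Legendrian knot with this (special) front, and $\Gamma\subset S^2$ is its Lagrangian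 projection. **The algebra.** Each crossing of $\Gamma$ corresponds to two complementary Reeb chords with endpoints on $K_0$. The length $\mathit{l}(x)\in(0,1)$ of a chord $x$ is its length as a fraction of the orbital period. A chord $x$, oriented by the Reeb flow, runs from a source strand to a sink strand; a quadrant at the crossing is labeled $x^+$ if traveling along the source strand to the crossing and then along the sink strand orients the quadrant they bound positively, and $x^-$ if it orients it negatively. Number the crossings from top to bottom; each has north, east, south and west quadrants. $a_i$ is the chord at crossing $i$ whose $+$ labels are on the north and south quadrants, $b_i$ the one whose $+$ labels are on the east and west quadrants. The chord $a_i$ is called preferred. $\mathcal{A}(K)$ is the tensor algebra $T(a_1,b_1,\dots,a_m,b_m)$ over $\mathbb{Z}_2$, $m$ the number of crossings. (Its equivalence type, stable tame isomorphism, is an invariant of the Legendrian isotopy class; $\mathcal{A}(K)$ is taken here to be computed from this special diagram.) **Defect.** Give $S^2$ the area form proportional to $d(r_1^2)\wedge d\phi$ with total area $\frac1p$. For a component $R$ of $S^2-\Gamma$ with area $a(R)$, the defect is $n(R)=-a(R)+\sum\epsilon\,\mathit{l}(x)$, summed over corners of $R$, where $x$ is the preferred generator at the corner and $\epsilon=1$ if $R$ fills an $x^+$ quadrant, $\epsilon=-1$ if it fills an $x^-$ quadrant. The defect of the image of a disc is the sum of the defects of its regions with multiplicity. **Differential.** An admissible disc is a map $f:(D^2,\partial D^2)\to(S^2,\Gamma)$ with marked boundary points such that $f$ is smooth on the interior and an immersion except possibly at points mapping to the poles, near each of which $f$ looks like $z\mapsto z^{p}$; each marked point maps to a crossing; $f$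 extends smoothly to $\partial D^2$ away from marked points; and at each marked point $f(D^2)$ fills exactly one quadrant. Discs are taken up to reparametrization of $D^2$. If $f$ fills a quadrant labeled $x^+$, let $y_1,\dots,y_{r}$ be the generators such that $y_i^-$ labels the $i$th further corner, counterclockwise from $x^+$; put $w(f,x)=y_1\cdots y_r$. The $x$-defect $n_x(f)$ is the defect of $f(D^2)$, minus the number of $y_i$ that are not preferred, plus $1$ if $x$ is not preferred. Then $\partial x=\sum_{f:\,n_x(f)=0}w(f,x)$, extended by the Leibniz rule. **Grading.** A capping path for $x$ is a path in $\Gamma$ (possibly traversing $\Gamma$ repeatedly), smooth away from the crossing of $x$, turning a corner there around an $x^+$ quadrant. For each $a_j$ let $\eta$ be a capping path positively bounding a disc $D_\eta$ in the complement of the south pole, which is admissible: its winding number $w_N(\eta)$ about the north pole is $\equiv0\bmod p$. With $r(\eta)\in\mathbb{Z}-\frac14$ the number of counterclockwise rotations of $\eta'$ in $S^2-\{\text{south pole}\}$ (strands orthogonal at crossings), $|a_j|=2\lceil r(\eta)\rceil-2\frac{p-1}{p}w_N(\eta)-1+4n(D_\eta)$ and $|b_j|=3-|a_j|$. The grading is by a cyclic group of order $2|h-v|$ (by $\mathbb{Z}$ if $h=v$), and is extended by $|xy|=|x|+|y|$. **Augmentation.** A graded algebra homomorphism $\epsilon:\mathcal{A}\to\mathbb{Z}_2$ with $\epsilon(1)=1$, $\epsilon\circ\partial=0$, and $\epsilon(x)=0$ if $|x|\ne0$. *)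

(* Defs.v *)
From HB Require Import structures.
From mathcomp Require Import all_boot all_order all_algebra finmap.
From mathcomp Require Import all_classical all_reals all_analysis.
From mathcomp Require Import complex.
(* The notations of monalg clash with those of mathcomp-analysis. *)
From mathcomp Require Import -(notations) monalg.

Set Implicit Arguments.
Unset Strict Implicit.
Unset Printing Implicit Defensive.

Import Order.TTheory GRing.Theory Num.Theory.
Import numFieldNormedType.Exports.

Local Open Scope classical_set_scope.
Local Open Scope ring_scope.

Definition tensor_algebra (G : choiceType) := malg (fmonom G) 'F_2.

HB.instance Definition _ (G : choiceType) :=
  GRing.Lalgebra.on (tensor_algebra G).

Definition monomial (G : choiceType) (w : seq G) : tensor_algebra G :=
  mkmalgU (FMonom w) 1.

Definition leibniz (G : choiceType) (d : G -> tensor_algebra G)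
    (a : tensor_algebra G) : tensor_algebra G :=
  \sum_(w <- msupp a) mcoeff w a *:
    \sum_(i < size w)
      monomial (take i w) * d (tnth (in_tuple w) i) * monomial (drop i.+1 w).

Definition algebra_extension (G : choiceType) (phi : G -> 'F_2) :
    tensor_algebra G -> 'F_2 :=
  mmap idfun (fun w : fmonom G => \prod_(x <- fmonom_val w) phi x).

(* [pi] induces a ring isomorphism from ker D / im D to [H]; over Z_2 it is
   automatically an isomorphism of algebras. *)
Definition homology_isomorphic (A : nzRingType) (D : A -> A)
    (H : nzRingType) : Prop :=
  (forall a, D (D a) = 0) /\
  exists pi : A -> H,
    [/\ D 1 = 0 /\ pi 1 = 1,
        forall a b, D a = 0 -> D b = 0 ->
          [/\ D (a + b) = 0, pi (a + b) = pi a + pi b,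
              D (a * b) = 0 & pi (a * b) = pi a * pi b],
        forall c, exists2 a, D a = 0 & pi a = c
      & forall a, D a = 0 -> (pi a = 0 <-> exists b, a = D b)].

Definition is_augmentation (G : choiceType)
    (D : tensor_algebra G -> tensor_algebra G) (deg0 : seq G -> Prop)
    (eps : tensor_algebra G -> 'F_2) : Prop :=
  [/\ eps 1 = 1,
      forall a b, eps (a + b) = eps a + eps b,
      forall a b, eps (a * b) = eps a * eps b,
      forall a, eps (D a) = 0
    & forall w, ~ deg0 w -> eps (monomial w) = 0].

Section Geometry.
Context {R : realType}.

Fixpoint Ck (V W : normedModType R) (n : nat) (U : set V) (f : V -> W) : Prop :=
  if n is n'.+1 then
    (forall z, U z -> differentiable f z) /\ (forall v, Ck n' U ('D_v f))
  else forall z, U z -> {for z, continuous f}.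

Definition smooth_at (V W : normedModType R) (f : V -> W) (z : V) : Prop :=
  exists2 U : set V, open_nbhs z U & forall n, Ck n U f.

Local Notation plane := (R * R)%type.
Local Notation space := (R * R * R)%type.

Definition det2 (a b : plane) : R := a.1 * b.2 - a.2 * b.1.

Definition det3 (a b c : space) : R :=
  a.1.1 * (b.1.2 * c.2 - b.2 * c.1.2)
  - a.1.2 * (b.1.1 * c.2 - b.2 * c.1.1)
  + a.2 * (b.1.1 * c.1.2 - b.1.2 * c.1.1).

Definition e1 : plane := (1, 0).
Definition e2 : plane := (0, 1).

Definition sphere : set space :=
  [set P | P.1.1 ^+ 2 + P.1.2 ^+ 2 + P.2 ^+ 2 = 1].

Definition pole (north : bool) : space := (0, 0, (-1) ^+ (~~ north)).

(* The point of latitude [u = r_1 ^ 2] and azimuth [phi]: the Hopf map, with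
   the azimuth multiplied by p.  The third coordinate is affine in [u], so
   that du /\ dphi is a multiple of the round area form, oriented by the
   outward normal. *)
Definition sphere_pt (u phi : R) : space :=
  (2 * Num.sqrt (u * (1 - u)) * cos phi,
   2 * Num.sqrt (u * (1 - u)) * sin phi,
   1 - 2 * u).

(* Stereographic projection from the south pole. *)
Definition stereo (P : space) : plane :=
  (P.1.1 / (1 + P.2), P.1.2 / (1 + P.2)).

(* For [f] with values in the sphere: an orientation-preserving immersion. *)
Definition immersed_at (f : plane -> space) (z : plane) : Prop :=
  0 < det3 (f z) ('D_e1 f z) ('D_e2 f z).

Definition coordinate_at (chi : plane -> plane) (z : plane) : Prop :=
  [/\ smooth_at chi z, chi z = 0 & 0 < det2 ('D_e1 chi z) ('D_e2 chi z)].

Definition cpow (n : nat) (z : plane) : plane :=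
  let w := (Complex z.1 z.2 : R[i]) ^+ n in (complex.Re w, complex.Im w).

(* Positively oriented coordinate of the sphere at a pole. *)
Definition pole_coordinate (north : bool) (P : space) : plane :=
  (P.1.1, (-1) ^+ (~~ north) * P.1.2).

Definition looks_like_power (n : nat) (f : plane -> space) (north : bool)
    (z : plane) : Prop :=
  exists chi tau : plane -> plane,
    [/\ coordinate_at chi z, coordinate_at tau 0
      & \forall z' \near z,
          tau (pole_coordinate north (f z')) = cpow n (chi z')].

Definition disc : set plane := [set z | z.1 ^+ 2 + z.2 ^+ 2 <= 1].
Definition open_disc : set plane := [set z | z.1 ^+ 2 + z.2 ^+ 2 < 1].
Definition circ (t : R) : plane := (cos t, sin t).

Definition has_angle_change (c : R -> plane) (delta : R) : Prop :=
  exists rho alpha : R -> R,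
    [/\ {within `[0, 1], continuous alpha},
        forall s, 0 <= s <= 1 ->
          0 < rho s /\ c s = (rho s * cos (alpha s), rho s * sin (alpha s))
      & alpha 1 - alpha 0 = delta].

Definition winding_number (c : R -> plane) (y : plane) : int :=
  xget 0 [set n : int | has_angle_change (fun s => c s - y) (2 * pi * n%:~R)].

Definition total_turning (c : R -> plane) : R :=
  xget 0 [set delta | has_angle_change
    (fun s => (derive1 (fun s => (c s).1) s, derive1 (fun s => (c s).2) s))
    delta].

End Geometry.

Section Front.
Context {R : realType}.
Variables (p q h : nat).

Definition vertical_length (s : nat) : nat :=
  head 0%N [seq n <- iota 1 p.-1 | (p %| s + n * q)%N].

Local Notation v := (vertical_length h).

(* The torus is unrolled to the plane (theta_1, theta_2), and the path starts
   at the center of Box 0.  The i-th basepoint is slid by [d i] in both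
   coordinates.  Basepoint h + v is basepoint 0 translated by
   2 pi / p (h, - v), which is a deck transformation. *)
Definition basepoint (d : nat -> R) (i : nat) : R * R :=
  (pi / p%:R * (1 + 2 * (minn i h)%:R) + d i,
   pi / p%:R * (1 - 2 * (i - h)%:R) + d i).

Definition segment_slope (d : nat -> R) (i : nat) : R :=
  ((basepoint d i.+1).2 - (basepoint d i).2) /
  ((basepoint d i.+1).1 - (basepoint d i).1).

Definition small_slides (eps : R) (d : nat -> R) : Prop :=
  [/\ d (h + v)%N = d 0%N,
      forall i, `|d i| < eps,
      forall i, (i < h + v)%N -> segment_slope d i < 0
    & forall i, (i.+1 < h + v)%N -> segment_slope d i.+1 < segment_slope d i].

Definition period : R := 2 * pi * h%:R / p%:R.

(* As dtheta_2 / dtheta_1 < 0, the unrolled front is a graph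
   theta_2 = g theta_1.  It is straight outside the neighborhoods of the
   basepoints lying over the intervals ]lo i, hi i[; in these the slope is
   strictly monotone, with nonzero derivative. *)
Definition special_front (d : nat -> R) (delta : R) (g : R -> R) : Prop :=
  exists lo hi : nat -> R,
    [/\ [/\ forall i, (i <= h + v)%N ->
              (basepoint d i).1 - delta < lo i < (basepoint d i).1 /\
              (basepoint d i).1 < hi i < (basepoint d i).1 + delta,
            forall i, (i < h + v)%N -> hi i < lo i.+1,
            lo (h + v)%N = lo 0%N + period
          & hi (h + v)%N = hi 0%N + period],
        (forall t, smooth_at g t) /\
        (forall t, g (t + period) = g t - 2 * pi * v%:R / p%:R),
        forall i t, (i < h + v)%N -> hi i <= t <= lo i.+1 ->
          g t = (basepoint d i).2
                + segment_slope d i * (t - (basepoint d i).1),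
        forall t, lo 0%N < t < hi 0%N -> 0 < derive1n 2 g t
      & forall i t, (0 < i < h + v)%N -> lo i < t < hi i ->
          derive1n 2 g t < 0].

(* The slides are chosen first, then the smoothing. *)
Definition sufficiently_small_fronts (P : (R -> R) -> Prop) : Prop :=
  exists2 eps : R, 0 < eps & forall d, small_slides eps d ->
  exists2 delta : R, 0 < delta & forall g, special_front d delta g -> P g.

End Front.

Inductive quadrant := North | East | South | West.
Definition quadrants := [:: North; East; South; West].

Section DGA.
Context {R : realType}.
Variables (p q h : nat) (g : R -> R).

Local Notation plane := (R * R)%type.
Local Notation space := (R * R * R)%type.

Local Notation T := (period p h : R).

(* The Legendrian knot: theta_1 = t, theta_2 = g t, and r_1 is recovered from
   g' = - r_1 ^ 2 / (1 - r_1 ^ 2). *)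
Definition r1sq (t : R) : R := - derive1 g t / (1 - derive1 g t).
Definition azimuth (t : R) : R := p%:R * (t - g t).
Definition gamma (t : R) : space := sphere_pt (r1sq t) (azimuth t).
Definition Gamma : set space := range gamma.

(* Equality of the images on the tori r_1 = constant of the lens space. *)
Definition same_angles (a b : R * R) : Prop :=
  exists k m n : int,
    b = (a.1 + 2 * pi * (k%:~R * q%:R / p%:R + m%:~R),
         a.2 + 2 * pi * (k%:~R / p%:R + n%:~R)).

(* A Reeb chord, as the pair (source, sink) of its endpoints. *)
Definition chords : set (R * R) :=
  [set x | [/\ 0 <= x.1 < T, 0 <= x.2 < T, x.1 <> x.2 & gamma x.1 = gamma x.2]].

Definition generator := set_type chords.

(* The Reeb orbits in the complement of the cores have period 2 pi. *)
Definition chord_length (x : R * R) : R :=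
  xget 0 [set l | 0 < l < 1 /\
    same_angles (x.1 + 2 * pi * l, g x.1 + 2 * pi * l) (x.2, g x.2)].

Definition complement (x : R * R) : R * R := (x.2, x.1).

(* The four rays of Gamma at a crossing, as tangent vectors in the oriented
   coordinates (u, phi); the azimuth increases with the parameter, so each
   strand has an east and a west ray. *)
Definition ray (t : R) (east : bool) : R * R :=
  ((-1) ^+ (~~ east) * derive1 r1sq t, (-1) ^+ (~~ east) * derive1 azimuth t).

Definition incline (t : R) : R := derive1 r1sq t / derive1 azimuth t.

(* Which ray of the source strand and which ray of the sink strand bound the
   quadrant; a strand with larger incline runs from northwest to southeast. *)
Definition bounding_rays (x : R * R) (Q : quadrant) : bool * bool :=
  let source_down := incline x.2 < incline x.1 in
  match Q with
  | North => (~~ source_down, source_down)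
  | East => (true, true)
  | South => (source_down, ~~ source_down)
  | West => (false, false)
  end.

(* Positive when the quadrant lies to the left of the path arriving along the
   source ray and leaving along the sink ray. *)
Definition turn (x : R * R) (Q : quadrant) : R :=
  let b := bounding_rays x Q in det2 (ray x.2 b.2) (ray x.1 b.1).

Definition label_pos (x : R * R) (Q : quadrant) : bool := 0 < turn x Q.
Definition label_neg (x : R * R) (Q : quadrant) : bool := turn x Q < 0.

Definition preferred (x : R * R) : bool :=
  label_pos x North && label_pos x South.

(* The part of a quadrant near the crossing; [r1sq s1] and [r1sq s2] are the
   latitudes of the two strands on a common meridian. *)
Definition quadrant_germ (delta : R) (x : R * R) (Q : quadrant) : set space :=
  [set P | exists s1 s2 u : R,
    [/\ [/\ `|s1 - x.1| < delta, `|s2 - x.2| < delta,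
            `|u - r1sq x.1| < delta & 0 <= u <= 1],
        azimuth s1 - azimuth x.1 = azimuth s2 - azimuth x.2,
        P = sphere_pt u (azimuth s1)
      & let top := Num.min (r1sq s1) (r1sq s2) in
        let bottom := Num.max (r1sq s1) (r1sq s2) in
        match Q with
        | North => u < top
        | East => x.1 < s1 /\ top < u < bottom
        | South => bottom < u
        | West => s1 < x.1 /\ top < u < bottom
        end]].

Definition regions : set (set space) :=
  [set C | exists2 P, (sphere `\` Gamma) P
                    & C = connected_component (sphere `\` Gamma) P].

Definition area (C : set space) : R :=
  (2 * pi * p%:R)^-1 *
  fine ((lebesgue_measure \x lebesgue_measure)%E
    [set z : R * R | [/\ 0 <= z.1 <= 1, 0 <= z.2 < 2 * pi
                       & C (sphere_pt z.1 z.2)]]).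

Definition has_corner (C : set space) (x : R * R) (Q : quadrant) : Prop :=
  exists2 delta : R, 0 < delta & quadrant_germ delta x Q `<=` C.

Definition region_defect (C : set space) : R :=
  - area C +
  \sum_(x \in [set x | chords x /\ preferred x])
    \sum_(Q <- quadrants | `[< has_corner C x Q >])
      (if label_pos x Q then chord_length x else - chord_length x).

(* The defect of a combination of regions whose multiplicity is read off at a
   point, other than a pole, of each region. *)
Definition chain_defect (mult : space -> R) : R :=
  \sum_(C \in regions)
    mult (xget 0 (C `\ pole true `\ pole false)) * region_defect C.

(* A map of the disc with its word: the marked points are the
   [circ t], with [t] in [corner0 :: corners], counterclockwise. *)
Record labelled_disc := LabelledDisc {
  dmap : plane -> space;
  corner0 : R;
  corners : seq R;
  word : seq generator
}.

Definition fills (f : plane -> space) (z : plane) (x : R * R) (Q : quadrant) :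
    Prop :=
  [/\ f z = gamma x.1,
      forall delta : R, 0 < delta -> \forall z' \near z,
        open_disc z' -> quadrant_germ delta x Q (f z')
    & forall B : set plane, nbhs z B -> exists2 delta : R, 0 < delta
        & quadrant_germ delta x Q `<=` f @` (B `&` open_disc)].

(* The extension is immersed on the boundary too; otherwise the boundary could
   fold back along Gamma. *)
Definition smooth_immersed_disc (f : plane -> space) (marks : seq R) : Prop :=
  [/\ [/\ forall z, disc z -> sphere (f z),
          {within disc, continuous f}
        & forall t, Gamma (f (circ t))],
      forall z, open_disc z -> smooth_at f z,
      forall z, open_disc z -> (forall north, f z <> pole north) ->
        immersed_at f z,
      forall z north, open_disc z -> f z = pole north ->
        looks_like_power p f north z
    & forall t, (forall t', t' \in marks -> circ t <> circ t') ->
        exists e : plane -> space,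
          [/\ smooth_at e (circ t), immersed_at e (circ t)
            & \forall z \near circ t, disc z -> e z = f z]].

Definition admissible_disc (x : generator) (D : labelled_disc) : Prop :=
  let marks := corner0 D :: corners D in
  [/\ path <%R (corner0 D) (corners D),
      last (corner0 D) (corners D) < corner0 D + 2 * pi,
      smooth_immersed_disc (dmap D) marks,
      exists2 Q, label_pos (val x) Q
               & fills (dmap D) (circ (corner0 D)) (val x) Q
    & size (word D) = size (corners D) /\
      forall i y t, onth (word D) i = Some y -> onth (corners D) i = Some t ->
        exists2 Q, label_neg (val y) Q & fills (dmap D) (circ t) (val y) Q].

(* Equality up to reparametrization of the disc; where the maps are immersions, such a homeomorphism is
   automatically an orientation-preserving diffeomorphism. *)
Definition same_disc (D D' : labelled_disc) : Prop :=
  exists psi psi' : plane -> plane,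
    [/\ [/\ {within disc, continuous psi}, {within disc, continuous psi'},
            forall z, disc z -> disc (psi z) /\ psi' (psi z) = z
          & forall z, disc z -> disc (psi' z) /\ psi (psi' z) = z],
        forall z, disc z -> dmap D' (psi z) = dmap D z,
        psi (circ (corner0 D)) = circ (corner0 D'),
        [seq psi (circ t) | t <- corners D] = [seq circ t | t <- corners D']
      & word D = word D'].

Definition disc_defect (D : labelled_disc) : R :=
  chain_defect (fun P =>
    #|` fset_set [set z : plane | disc z /\ dmap D z = P]|%:R).

Definition x_defect (x : generator) (D : labelled_disc) : R :=
  disc_defect D - (count (fun y : generator => ~~ preferred (val y)) (word D))%:R
  + (~~ preferred (val x))%:R.

(* A disc with several x^+ corners is counted once for each choice of the
   corner from which its word is read. *)
Definition disc_classes (x : generator) :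
    set (seq generator * set labelled_disc) :=
  [set c | exists D, [/\ admissible_disc x D, x_defect x D = 0
    & c = (word D, [set D' | admissible_disc x D' /\ same_disc D D'])]].

Definition differential :
    tensor_algebra generator -> tensor_algebra generator :=
  leibniz (fun x => \sum_(c \in disc_classes x) monomial c.1).

(* The path in Gamma leaving the crossing of [x] along the sink strand and
   returning along the source strand, in the plane that is the complement of
   the south pole. *)
Definition capping_param (x : R * R) (k : int) (s : R) : R :=
  x.2 + s * (x.1 + k%:~R * T - x.2).

Definition capping_path (x : R * R) (k : int) (s : R) : plane :=
  stereo (gamma (capping_param x k s)).

Definition is_capping (x : R * R) (k : int) : Prop :=
  let eastward := x.2 < x.1 + k%:~R * T in
  exists2 Q, label_pos x Q & bounding_rays x Q = (~~ eastward, eastward).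

(* The actual turning is an integer minus a number in ]0, 1/2[, the left turn
   at the corner; that turn is 1/4 once the strands are made orthogonal. *)
Definition rotation (x : R * R) (k : int) : R :=
  (Num.ceil (total_turning (capping_path x k) / (2 * pi)))%:~R - 4^-1.

(* The chain D_eta has the winding numbers of the capping path as its
   multiplicities; it is positively bounded when they are nonnegative. *)
Definition capping_degree (x : R * R) (d : int) : Prop :=
  exists k : int,
    let w P := winding_number (capping_path x k) (stereo P) in
    let wN := w (pole true) in
    [/\ is_capping x k,
        forall P, (sphere `\` Gamma) P -> P <> pole false -> 0 <= w P,
        (p %| wN)%Z
      & d%:~R = 2 * (Num.ceil (rotation x k))%:~R
                - 2 * ((p%:R - 1) / p%:R) * wN%:~R - 1
                + 4 * chain_defect (fun P => (w P)%:~R)].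

Definition degree (x : R * R) : int :=
  if preferred x then xget 0 (capping_degree x)
  else 3 - xget 0 (capping_degree (complement x)).

(* The grading group is Z / 2 |h - v|, which is Z when h = v. *)
Definition zero_degree (w : seq generator) : Prop :=
  (2 * (h%:Z - (vertical_length p q h)%:Z) %| \sum_(x <- w) degree (val x))%Z.

End DGA.

Arguments generator {R} p h g.
Arguments differential {R} p q h g a.
Arguments zero_degree {R} p q h g w.

(* Main.v *)
Require Import Defs.
From HB Require Import structures.
From mathcomp Require Import all_boot all_order all_algebra finmap.
From mathcomp Require Import all_classical all_reals all_analysis.
From mathcomp Require Import complex ring lra measurable_realfun.
From mathcomp Require Import -(notations) monalg.

(** The differential vanishes, because the discs that it counts cancel in pairs
    over [Z / 2].

    The front of [K(p, p - 1, 1)] consists of one horizontal and one vertical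
    segment, and the Lagrangian projection is a closed curve that turns twice
    around the sphere and crosses itself once ([special_front_one_crossing]).
    It is a graph over the azimuth, counted over two turns.  Its two Reeb chords
    lie over the crossing ([chordsP]), and its complement has three components:
    two polar regions and a region between the strands ([regionsE]).

    The cancellation comes from a symmetry.  There is a smooth injective map of
    the sphere, preserving the orientation and the curve, that reflects the
    azimuth about the crossing and exchanges the poles ([flip_exists],
    [flip_map_smooth_at], [flip_map_immersed], [flip_map_inj]).  On each
    meridian it is affine near the curve and a reflection near the poles; the
    two are joined by a cutoff so slow that monotonicity survives
    ([slow_cutoff]).  The map exchanges the polar regions, and at the crossing
    it takes each quadrant to the opposite one, which has the same labels
    ([flip_quadrant], [label_pos_opposite]).

    Composing an admissible disc with this map gives an admissible disc with
    the same word ([admissible_disc_flip]).  The defect is the same as well.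
    The polar regions have equal areas, because the mean latitude of the knot
    is 1/2 ([area_north_south]), and hence equal defects
    ([region_defect_north_south]); the multiplicities are permuted like the
    regions, since they are constant on each region off the poles
    ([multiplicity_constant], which rests on the local inverse theorem
    [immersed_local_inverse]).  The positive corner at which the word starts
    moves to the opposite quadrant, so that the discs whose corner is north or
    east inject into those whose corner is south or west, and conversely
    ([disc_classes_flip]).  The classes of discs with a given word are
    therefore paired off ([differential0]); neither the discs, nor the lengths
    and degrees of the chords, have to be computed.

    With a zero differential the homology is the algebra itself, on the two
    chords ([homology_isomorphic0]), and sending both chords to 0 is an
    augmentation ([zero_augmentation]). *)

Set Implicit Arguments.
Unset Strict Implicit.
Unset Printing Implicit Defensive.

Import Order.TTheory GRing.Theory Num.Theory.
Import numFieldNormedType.Exports.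

Local Open Scope classical_set_scope.
Local Open Scope ring_scope.

(** * Smooth functions *)

Section Smoothness.
Context {R : realType}.
Implicit Types V W : normedModType R.

Lemma Ck_sub V W n (U U' : set V) (f : V -> W) :
  U' `<=` U -> Ck n U f -> Ck n U' f.
Proof.
elim: n f => [|n IH] f sU /= H; first by move=> z /sU; exact: H.
by case: H => H1 H2; split=> [z /sU|v]; [exact: H1|exact: IH].
Qed.

Lemma Ck_continuous V W n (U : set V) (f : V -> W) :
  Ck n U f -> forall z, U z -> {for z, continuous f}.
Proof.
case: n => [//|n] /= [H _] z Uz; exact/differentiable_continuous/H.
Qed.

Lemma CkW V W n (U : set V) (f : V -> W) : Ck n.+1 U f -> Ck n U f.
Proof.
elim: n f => [|n IH] f H; first exact: Ck_continuous H.
by case: H => H1 H2; split=> // v; apply: IH; exact: H2.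
Qed.

Lemma near_eq_differentiable V W (f g : V -> W) (z : V) :
  (\forall y \near z, f y = g y) -> differentiable f z -> differentiable g z.
Proof.
move=> fg /diff_locallyP [cdf /eqaddoP df].
have fgz : f z = g z := nbhs_singleton fg.
have E : g \o shift z = cst (g z) + 'd f z +o_ 0 id.
  apply/eqaddoP => e e0; have := df e e0.
  have : \forall y \near (0 : V), f (y + z) = g (y + z).
    move: fg; rewrite (near_shift 0 z).
    by apply: filterS => y /=; rewrite subr0.
  by apply: filterS2 => y /= Ey; rewrite !fctE /= Ey fgz.
have dE := diff_unique cdf E.
by apply/diff_locallyP; rewrite dE.
Qed.

Lemma Ck_eq V W n (U : set V) (f g : V -> W) :
  open U -> (forall z, U z -> f z = g z) -> Ck n U f -> Ck n U g.
Proof.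
move=> oU; elim: n f g => [|n IH] f g fg /=.
  move=> H z Uz; have fz := H z Uz; rewrite /prop_for /continuous_at -fg //.
  apply: cvg_trans fz; apply: near_eq_cvg.
  by near=> y; apply: fg; near: y; exact: open_nbhs_nbhs.
have nfg z : U z -> \forall y \near z, f y = g y.
  by move=> Uz; near=> y; apply: fg; near: y; exact: open_nbhs_nbhs.
case=> H1 H2; split=> [z Uz|v].
  exact: near_eq_differentiable (nfg z Uz) (H1 z Uz).
apply: (IH ('D_v f)) (H2 v) => z Uz; exact: near_eq_derive (nfg z Uz).
Unshelve. all: by end_near. Qed.

Lemma Ck_cst V W n (U : set V) (a : W) : Ck n U (fun _ => a).
Proof.
elim: n a => [|n IH] a /=; first by move=> z _; exact: cst_continuous.
split=> [z _|v]; first exact: differentiable_cst.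
rewrite (_ : 'D_v _ = fun=> 0); first exact: IH.
by apply/funext => z; exact: derive_cst.
Qed.

Lemma Ck_lin V W n (U : set V) (f : {linear V -> W}) :
  continuous f -> Ck n U f.
Proof.
case: n => [|n] cf /=; first by move=> z _; exact: cf.
split=> [z _|v]; first exact: linear_differentiable.
rewrite (_ : 'D_v _ = fun=> f v); first exact: Ck_cst.
apply/funext => z; rewrite deriveE; last exact: linear_differentiable.
by rewrite diff_lin.
Qed.

Lemma Ck_add V W n (U : set V) (f g : V -> W) : open U ->
  Ck n U f -> Ck n U g -> Ck n U (fun z => f z + g z).
Proof.
move=> oU; elim: n f g => [|n IH] f g /=.
  by move=> Hf Hg z Uz; apply: continuousD; [exact: Hf|exact: Hg].
move=> [Hf Hf'] [Hg Hg']; split=> [z Uz|v].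
  by apply: differentiableD; [exact: Hf|exact: Hg].
apply: (@Ck_eq _ _ _ _ (fun z => 'D_v f z + 'D_v g z)) => [//|z Uz|].
  by rewrite deriveD //; apply: diff_derivable; [exact: Hf|exact: Hg].
exact: IH.
Qed.

Lemma Ck_mul V n (U : set V) (f g : V -> R) : open U ->
  Ck n U f -> Ck n U g -> Ck n U (fun z => f z * g z).
Proof.
move=> oU; elim: n f g => [|n IH] f g /=.
  by move=> Hf Hg z Uz; apply: continuousM; [exact: Hf|exact: Hg].
move=> Hf Hg; have [[Hf1 Hf2] [Hg1 Hg2]] := (Hf, Hg); split=> [z Uz|v].
  by apply: differentiableM; [exact: Hf1|exact: Hg1].
apply: (@Ck_eq _ _ _ _ (fun z => f z * 'D_v g z + g z * 'D_v f z)) => [//|z Uz|].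
  by rewrite deriveM //; apply: diff_derivable; [exact: Hf1|exact: Hg1].
by apply: Ck_add => //; apply: IH => //; exact: CkW.
Qed.

(** The chain rule stays within products and composites of lower order. *)
Lemma Ck_comp V n (U : set V) (U' : set R) (f : V -> R) (phi : R -> R) :
  open U -> (forall z, U z -> U' (f z)) ->
  Ck n U f -> Ck n U' phi -> Ck n U (fun z => phi (f z)).
Proof.
move=> oU fU; elim: n f phi fU => [|n IH] f phi fU /=.
  move=> Hf Hg z Uz; apply: continuous_comp; first exact: Hf.
  exact: Hg (fU z Uz).
move=> Hf Hg; have [[Hf1 Hf2] [Hg1 Hg2]] := (Hf, Hg); split=> [z Uz|v].
  by apply: differentiable_comp; [exact: Hf1|exact/Hg1/fU].
apply: (@Ck_eq _ _ _ _ (fun z => 'D_v f z * 'D_1 phi (f z))) => [//|z Uz|].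
  have df := Hf1 z Uz; have dg := Hg1 _ (fU z Uz).
  rewrite [RHS]deriveE; last exact: differentiable_comp.
  have -> : 'd (fun y => phi (f y)) z = 'd phi (f z) \o 'd f z :> (_ -> _).
    exact: diff_comp.
  rewrite /= !deriveE //.
  by rewrite -[in RHS](mulr1 ('d f z v)) -[_ * 1]/(_ *: 1) linearZ.
apply: Ck_mul => //; apply: (IH f ('D_1 phi)) => //; exact: CkW.
Qed.

Lemma Ck_pair V W W' n (U : set V) (f : V -> W) (g : V -> W') : open U ->
  Ck n U f -> Ck n U g -> Ck n U (fun z => (f z, g z)).
Proof.
move=> oU; elim: n f g => [|n IH] f g /=.
  by move=> Hf Hg z Uz; apply: cvg_pair; [exact: Hf|exact: Hg].
move=> [Hf Hf'] [Hg Hg']; split=> [z Uz|v].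
  by apply: differentiable_pair; [exact: Hf|exact: Hg].
apply: (@Ck_eq _ _ _ _ (fun z => ('D_v f z, 'D_v g z))) => [//|z Uz|].
  have df := Hf z Uz; have dg := Hg z Uz.
  rewrite [RHS]deriveE; last exact: differentiable_pair.
  by rewrite diff_pair // !deriveE.
exact: IH.
Qed.

Lemma derive_lin_comp V W W' (f : V -> W) (l : {linear W -> W'}) z v :
  continuous l -> differentiable f z ->
  'D_v (fun y => l (f y)) z = l ('D_v f z).
Proof.
move=> cl df; have dl : differentiable l (f z) by exact: linear_differentiable.
rewrite deriveE; last exact: differentiable_comp.
have -> : 'd (fun y => l (f y)) z = 'd l (f z) \o 'd f z :> (_ -> _).
  exact: diff_comp.
by rewrite /= diff_lin // deriveE.
Qed.

Lemma Ck_lin_comp V W W' n (U : set V) (f : V -> W) (l : {linear W -> W'}) :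
  open U -> continuous l -> Ck n U f -> Ck n U (fun z => l (f z)).
Proof.
move=> oU cl; elim: n f => [|n IH] f /=.
  by move=> Hf z Uz; apply: continuous_comp; [exact: Hf|exact: cl].
move=> [Hf Hf']; split=> [z Uz|v].
  by apply: differentiable_comp; [exact: Hf|exact: linear_differentiable].
apply: (@Ck_eq _ _ _ _ (fun z => l ('D_v f z))) => [//|z Uz|].
  by rewrite derive_lin_comp //; exact: Hf.
exact: IH.
Qed.

(** In one variable, smoothness may be checked on the ordinary derivative,
    because the directional derivatives are its multiples. *)
Lemma Ck_is_derive n (U : set R) (f df : R -> R) : open U ->
  (forall t, U t -> is_derive t 1 f (df t)) -> Ck n U df -> Ck n.+1 U f.
Proof.
move=> oU fdf Hdf; split=> [t /fdf Ht|v].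
  by apply/derivable1_diffP; exact: ex_derive.
apply: (@Ck_eq _ _ _ _ (fun t => v * df t)) => [//|t Ut|].
  have Ht := fdf t Ut.
  rewrite deriveE; last by apply/derivable1_diffP; exact: ex_derive.
  rewrite deriv1E; last exact: ex_derive.
  by rewrite derive1E derive_val.
by apply: Ck_mul => //; exact: Ck_cst.
Qed.

Definition smooth V W (U : set V) (f : V -> W) := forall n, Ck n U f.

Lemma smooth_is_derive (U : set R) (f df : R -> R) : open U ->
  (forall t, U t -> is_derive t 1 f (df t)) -> smooth U df -> smooth U f.
Proof.
by move=> oU fdf Hdf [|n]; [apply: CkW|]; apply: Ck_is_derive (Hdf _).
Qed.

Lemma smooth_atP V W (U : set V) (f : V -> W) : open U -> smooth U f ->
  forall z, U z -> smooth_at f z.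
Proof. by move=> oU Hf z Uz; exists U. Qed.

Lemma smooth_at_continuous V W (f : V -> W) z :
  smooth_at f z -> {for z, continuous f}.
Proof. by move=> [U [_ Uz] Hf]; exact: (Ck_continuous (Hf 0%N)). Qed.

Lemma smooth_at_diff V W (f : V -> W) z :
  smooth_at f z -> differentiable f z.
Proof. by move=> [U [_ Uz] Hf]; have [H _] := Hf 1%N; exact: H. Qed.

Lemma smooth_at_near V W (f : V -> W) z :
  smooth_at f z -> \forall y \near z, smooth_at f y.
Proof.
move=> [U [oU Uz] Hf]; near=> y; exists U => //; split => //.
by near: y; exact: open_nbhs_nbhs.
Unshelve. all: by end_near. Qed.

Lemma smooth_at_derive V W (f : V -> W) z v :
  smooth_at f z -> smooth_at ('D_v f) z.
Proof.
by move=> [U Uz Hf]; exists U => // n; have [_ H] := Hf n.+1; exact: H.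
Qed.

Lemma smooth_at_eq V W (f g : V -> W) z :
  (\forall y \near z, f y = g y) -> smooth_at f z -> smooth_at g z.
Proof.
rewrite {1}/prop_near1 nbhsE => -[U' [oU' U'z] fg] [U [oU Uz] Hf].
exists (U `&` U') => [|n]; first by split; [exact: openI|].
apply: (@Ck_eq _ _ _ _ f) => [|y [_ /fg]//|]; first exact: openI.
apply: Ck_sub (Hf n); exact: subIsetl.
Qed.

Lemma smooth_at_cst V W (a : W) (z : V) : smooth_at (fun _ => a) z.
Proof. by exists setT => [|n]; [split=> //; exact: openT|exact: Ck_cst]. Qed.

Lemma smooth_at_lin V W (f : {linear V -> W}) z :
  continuous f -> smooth_at f z.
Proof.
by move=> cf; exists setT => [|n]; [split=> //; exact: openT|exact: Ck_lin].
Qed.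

(** The two neighborhoods on which the arguments are smooth are intersected. *)
Lemma smooth_at_op2 V W1 W2 W3 (op : (V -> W1) -> (V -> W2) -> V -> W3) :
  (forall n (U : set V) f g, open U -> Ck n U f -> Ck n U g ->
     Ck n U (op f g)) ->
  forall f g z, smooth_at f z -> smooth_at g z -> smooth_at (op f g) z.
Proof.
move=> Hop f g z [U [oU Uz] Hf] [U' [oU' U'z] Hg].
exists (U `&` U') => [|n]; first by split; [exact: openI|].
apply: Hop; first exact: openI.
  by apply: Ck_sub (Hf n); exact: subIsetl.
by apply: Ck_sub (Hg n); exact: subIsetr.
Qed.

Lemma smooth_atD V W (f g : V -> W) z : smooth_at f z -> smooth_at g z ->
  smooth_at (fun y => f y + g y) z.
Proof.
apply: (smooth_at_op2 (op := fun f g y => f y + g y)) => n U {}f {}g.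
exact: Ck_add.
Qed.

Lemma smooth_atM V (f g : V -> R) z : smooth_at f z -> smooth_at g z ->
  smooth_at (fun y => f y * g y) z.
Proof.
apply: (@smooth_at_op2 V R R R (fun f g y => f y * g y)) => n U {}f {}g.
exact: Ck_mul.
Qed.

Lemma smooth_at_pair V W W' (f : V -> W) (g : V -> W') z :
  smooth_at f z -> smooth_at g z -> smooth_at (fun y => (f y, g y)) z.
Proof.
apply: (smooth_at_op2 (op := fun f g y => (f y, g y))) => n U {}f {}g.
exact: Ck_pair.
Qed.

Lemma smooth_at_lin_comp V W W' (f : V -> W) (l : {linear W -> W'}) z :
  continuous l -> smooth_at f z -> smooth_at (fun y => l (f y)) z.
Proof.
by move=> cl [U Uz Hf]; exists U => // n; case: Uz => oU _; exact: Ck_lin_comp.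
Qed.

Lemma smooth_at_comp V (f : V -> R) (phi : R -> R) z :
  smooth_at phi (f z) -> smooth_at f z -> smooth_at (fun y => phi (f y)) z.
Proof.
move=> [U' [oU' U'z] Hphi] [U [oU Uz] Hf].
have oUU : open (U `&` f @^-1` U').
  rewrite openE => y [Uy U'y]; apply: filterI; first exact: open_nbhs_nbhs.
  apply: (Ck_continuous (Hf 0%N) Uy); exact: open_nbhs_nbhs.
exists (U `&` f @^-1` U') => [//|n].
apply: (@Ck_comp _ _ _ U') => [//|y []//||//].
by apply: Ck_sub (Hf n); exact: subIsetl.
Qed.

Lemma smooth_atN V (f : V -> R) z :
  smooth_at f z -> smooth_at (fun y => - f y) z.
Proof.
move=> Hf; have := smooth_atM (smooth_at_cst (-1 : R) z) Hf.
by apply: smooth_at_eq; near=> y; rewrite mulN1r.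
Unshelve. all: by end_near. Qed.

Lemma smooth_atB V (f g : V -> R) z : smooth_at f z -> smooth_at g z ->
  smooth_at (fun y => f y - g y) z.
Proof. by move=> Hf Hg; apply: smooth_atD => //; exact: smooth_atN. Qed.

Lemma continuous_fst_pair V W : continuous (fst : V * W -> V).
Proof. by move=> z; exact: cvg_fst. Qed.

Lemma continuous_snd_pair V W : continuous (snd : V * W -> W).
Proof. by move=> z; exact: cvg_snd. Qed.

Lemma smooth_at_fst V W W' (f : V -> W * W') z :
  smooth_at f z -> smooth_at (fun y => (f y).1) z.
Proof. exact/(smooth_at_lin_comp (l := fst))/continuous_fst_pair. Qed.

Lemma smooth_at_snd V W W' (f : V -> W * W') z :
  smooth_at f z -> smooth_at (fun y => (f y).2) z.
Proof. exact/(smooth_at_lin_comp (l := snd))/continuous_snd_pair. Qed.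

Lemma smooth_at_id V (z : V) : smooth_at id z.
Proof. by apply: (@smooth_at_lin V V idfun) => y; exact: cvg_id. Qed.

Lemma smooth_inv : smooth [set t : R | t != 0] GRing.inv.
Proof.
have oU : open [set t : R | t != 0] by exact: open_neq.
elim=> [|n IH]; first by move=> t /= t0; exact: inv_continuous.
apply: (@Ck_is_derive _ _ _ (fun t => - 1 * (t^-1 * t^-1))) => // [t /= t0|].
  have dt : derivable (id : R -> R) t 1 by [].
  have H := derivableP (@derivableV _ _ id t 1 t0 dt).
  apply: (is_derive_eq H); rewrite deriveV // derive_id /GRing.scale /=.
  by field.
apply: Ck_mul => //; first exact: Ck_cst.
exact: Ck_mul.
Qed.

Lemma smooth_atV V (f : V -> R) z : f z != 0 ->
  smooth_at f z -> smooth_at (fun y => (f y)^-1) z.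
Proof.
move=> fz; apply: smooth_at_comp.
by apply: (smooth_atP _ smooth_inv) => //; exact: open_neq.
Qed.

Lemma smooth_exp : smooth setT (@expR R).
Proof.
elim=> [|n IH]; first by move=> t _; exact: continuous_expR.
by apply: (@Ck_is_derive _ _ _ expR) => //; exact: openT.
Qed.

Lemma smooth_sincos : smooth setT (@sin R) /\ smooth setT (@cos R).
Proof.
suff H n : Ck n setT (@sin R) /\ Ck n setT (@cos R) by split=> n; have [] := H n.
elim: n => [|n [IHs IHc]].
  by split=> t _; [exact: continuous_sin|exact: continuous_cos].
split.
  by apply: (@Ck_is_derive _ _ _ cos) => //; exact: openT.
apply: (@Ck_is_derive _ _ _ (fun t => (-1) * sin t)); first exact: openT.
  by move=> t _; rewrite mulN1r; exact: is_derive_cos.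
by apply: Ck_mul => //; [exact: openT|exact: Ck_cst].
Qed.

Lemma smooth_at_exp (t : R) : smooth_at (@expR R) t.
Proof. exact: (smooth_atP openT smooth_exp). Qed.

Lemma smooth_at_sin (t : R) : smooth_at (@sin R) t.
Proof. exact: (smooth_atP openT smooth_sincos.1). Qed.

Lemma smooth_at_cos (t : R) : smooth_at (@cos R) t.
Proof. exact: (smooth_atP openT smooth_sincos.2). Qed.

Lemma smooth_at_ln (t : R) : 0 < t -> smooth_at (@ln R) t.
Proof.
move=> t0; have oU : open [set x : R | 0 < x] by exact: open_gt.
suff H : smooth [set x : R | 0 < x] (@ln R) by exact: (smooth_atP oU H).
apply: (@smooth_is_derive _ _ GRing.inv oU) => n.
by apply: Ck_sub (smooth_inv n) => x /= x0; exact: lt0r_neq0.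
Qed.

Lemma smooth_at_sqrt (t : R) : 0 < t -> smooth_at (@Num.sqrt R) t.
Proof.
move=> t0; have : smooth_at (fun x : R => expR (ln x * 2^-1)) t.
  apply: (@smooth_at_comp _ _ (@expR R)); first exact: smooth_at_exp.
  by apply: smooth_atM; [exact: smooth_at_ln|exact: smooth_at_cst].
apply: smooth_at_eq; near=> x.
have x0 : 0 < x by near: x; exact: lt_nbhsr.
apply/eqP; rewrite -(@eqrXn2 _ 2) ?expR_ge0 ?sqrtr_ge0 // sqr_sqrtr ?ltW //.
by rewrite -expRM_natl mulrCA divff // mulr1 lnK.
Unshelve. all: by end_near. Qed.

Lemma smooth_at_atan (t : R) : smooth_at (@atan R) t.
Proof.
suff H : smooth setT (@atan R) by exact: (smooth_atP openT H).
apply: (@smooth_is_derive _ _ (fun x => (1 + x ^+ 2)^-1) openT) => n.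
have -> : Ck n setT (fun x : R => (1 + x ^+ 2)^-1) = Ck n setT (fun x : R => (1 + x * x)^-1).
  by congr Ck; apply/funext => x; rewrite expr2.
apply: (@Ck_comp _ _ _ [set t : R | t != 0]); first exact: openT.
- by move=> x _ /=; rewrite -expr2 gt_eqF // ltr_pwDl // sqr_ge0.
- apply: Ck_add; [exact: openT|exact: Ck_cst|].
  have Cid : Ck n setT (id : R -> R).
    by apply: (@Ck_lin R R _ _ idfun) => x; exact: cvg_id.
  by apply: Ck_mul; [exact: openT| |].
exact: smooth_inv.
Qed.

End Smoothness.

Section OneVariable.
Context {R : realType}.
Implicit Types f h : R -> R.

Lemma is_deriveXn (m : nat) (t : R) :
  is_derive t 1 (fun x : R => x ^+ m.+1) (m.+1%:R * t ^+ m).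
Proof.
have H : derivable (fun x : R => x ^+ m.+1) t 1 by exact: exprn_derivable.
apply: (is_derive_eq (derivableP H)).
by rewrite [LHS]exp_derive /GRing.scale /= mulr1 mulr_natl.
Qed.

(** The continuous extension of [f t / t ^+ m.+1] to 0, when [f 0 = 0] and
    [f' t = t ^+ m * h t]. *)
Definition power_quotient (m : nat) h f (t : R) : R :=
  if t == 0 then h 0 / m.+1%:R else f t / t ^+ m.+1.

Lemma power_quotient_continuous0 (m : nat) f h :
  f 0 = 0 -> (forall t : R, is_derive t 1 f (t ^+ m * h t)) ->
  {for 0, continuous h} -> {for 0, continuous (power_quotient m h f)}.
Proof.
move=> f0 Df ch; rewrite /prop_for /continuous_at {2}/power_quotient eqxx.
have cf : {for 0, continuous f}.
  apply: differentiable_continuous; apply/derivable1_diffP.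
  by have := Df 0; move=> H; exact: ex_derive.
(* The continuous value at 0 of the quotient of derivatives, for l'Hopital's
   rule. *)
pose df t := if t == 0 then h 0 / m.+1%:R else t ^+ m * h t.
pose dg t : R := if t == 0 then 1 else m.+1%:R * t ^+ m.
have H : f x / x ^+ m.+1 @[x --> (0 : R)^'] --> h 0 / m.+1%:R.
  apply: (@lhopital R f df _ dg (-1) 1 0).
  - by rewrite in_itv /=; lra.
  - move=> x; rewrite in_setD => /andP[_]; rewrite in_set1 => /negPf x0.
    by rewrite /df x0.
  - move=> x; rewrite in_setD => /andP[_]; rewrite in_set1 => /negPf x0.
    by rewrite /dg x0; exact: is_deriveXn.
  - by rewrite -[X in _ --> X]f0.
  - have := @exprn_continuous R m.+1 0; rewrite /continuous_at expr0n; exact.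
  - move=> x; rewrite in_setD => /andP[_]; rewrite in_set1 => x0.
    by rewrite /dg (negPf x0) mulf_neq0 // ?expf_neq0 // pnatr_eq0.
  - have : h x / m.+1%:R @[x --> (0 : R)] --> h 0 / m.+1%:R.
      by apply: cvgM => //; exact: cvg_cst.
    apply: cvg_trans; apply: near_eq_cvg; near=> x.
    rewrite /df /dg; case: (eqVneq x 0) => [->|x0]; first by rewrite divr1.
    by field; rewrite ?expf_neq0 //=.
suff : {for 0, continuous (power_quotient m h f)}.
  by rewrite /prop_for /continuous_at {2}/power_quotient eqxx; exact.
apply/continuous_withinNx; rewrite {2} /power_quotient eqxx.
apply: cvg_trans H; apply: near_eq_cvg; near=> x.
by rewrite /power_quotient ifF //; apply/negbTE; near: x; exact: nbhs_dnbhs_neq.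
Unshelve. all: by end_near. Qed.

(** The derivative is again a quotient of this kind, of order one more; this
    is what makes the induction of the next lemma work. *)
Lemma power_quotient_derive (m : nat) f h (t : R) :
  differentiable h 0 -> f 0 = 0 ->
  (forall t : R, is_derive t 1 f (t ^+ m * h t)) ->
  is_derive t 1 (power_quotient m h f)
    (power_quotient m.+1 ('D_1 h)
      (fun x => x * (x ^+ m * h x) - m.+1%:R * f x) t).
Proof.
move=> dh f0 Df; rewrite {2}/power_quotient; case: eqVneq => [->|t0].
  have /derivable1_diffP/derivableP/is_derive1_caratheodory [g [hg cg g0]] := dh.
  pose f2 x := f x - h 0 / m.+1%:R * x ^+ m.+1.
  have Df2 (x : R) : is_derive x 1 f2 (x ^+ m.+1 * g x).
    have H := is_deriveZ (h 0 / m.+1%:R) (is_deriveXn m x).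
    have H2 := is_deriveB (Df x) H.
    apply: (is_derive_eq H2); rewrite /GRing.scale /=.
    have := hg x; rewrite subr0 => Hx.
    rewrite exprS mulrA -(mulrA (h 0)) mulVf ?pnatr_eq0 // mulr1 [x * _]mulrC -mulrA.
    by rewrite [x * g x]mulrC -Hx mulrBr [h 0 * _]mulrC.
  have f20 : f2 0 = 0 by rewrite /f2 f0 expr0n /= mulr0 subr0.
  apply/is_derive1_caratheodory; exists (power_quotient m.+1 g f2); split.
  - move=> z; rewrite /power_quotient eqxx subr0.
    case: eqVneq => [->|z0]; first by rewrite subrr mulr0.
    rewrite /f2 !exprS; field.
    by rewrite z0 ?expf_neq0 //=.
  - exact: power_quotient_continuous0.
  - by rewrite /power_quotient eqxx g0.
have tm : t ^+ m.+1 != 0 by rewrite expf_neq0.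
have HV := @is_deriveV R (fun x => x ^+ m.+1) t _ _ tm (is_deriveXn m t).
have H := is_deriveM (Df t) HV.
have nt0 : \forall x \near t, x != 0.
  apply: open_nbhs_nbhs; split=> //; exact: open_neq.
apply: (near_eq_is_derive _ (is_derive_eq H _)).
  near=> x; rewrite /power_quotient ifF //.
  by apply/negbTE; near: x; exact: nt0.
rewrite /GRing.scale /= !exprS; field.
by rewrite t0 expf_neq0.
Unshelve. all: by end_near. Qed.

Lemma power_quotient_Ck (n m : nat) f h : smooth setT h -> f 0 = 0 ->
  (forall t : R, is_derive t 1 f (t ^+ m * h t)) ->
  Ck n setT (power_quotient m h f).
Proof.
elim: n m f h => [|n IH] m f h sh f0 Df.
  have dh : differentiable h 0 by have [H _] := sh 1%N; exact: H.
  move=> t _; apply: differentiable_continuous; apply/derivable1_diffP.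
  have := power_quotient_derive t dh f0 Df; move=> H; exact: ex_derive.
have dh x : differentiable h x by have [H _] := sh 1%N; exact: H.
apply: (Ck_is_derive openT (fun t _ => power_quotient_derive t (dh 0) f0 Df)).
apply: IH => [k||t].
- by have [_ H] := sh k.+1; exact: H.
- by rewrite f0 mul0r mulr0 subr0.
have /derivable1_diffP/derivableP dht := dh t.
(* The terms in [t ^+ m * h t] cancel. *)
have -> : (fun x => x * (x ^+ m * h x) - m.+1%:R * f x)
  = (fun x => x ^+ m.+1 * h x - m.+1%:R *: f x).
  by apply/funext => x; rewrite exprS mulrA.
have H1 := is_deriveM (is_deriveXn m t) dht.
have H2 := is_deriveB H1 (is_deriveZ m.+1%:R (Df t)).
apply: (is_derive_eq H2); rewrite /GRing.scale /=; ring.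
Qed.

(** Hadamard's lemma, without integrals: the quotient is a [power_quotient] of
    order 0, all of whose derivatives are continuous. *)
Lemma smooth_divX f : smooth setT f -> f 0 = 0 ->
  exists h, [/\ smooth setT h, forall t, f t = t * h t & h 0 = 'D_1 f 0].
Proof.
move=> sf f0; exists (power_quotient 0 ('D_1 f) f); split=> [n|t|].
- apply: power_quotient_Ck => // [k|t]; first by have [_ H] := sf k.+1; exact: H.
  rewrite expr0 mul1r; apply: derivableP; apply/derivable1_diffP.
  by have [H _] := sf 1%N; exact: H.
- rewrite /power_quotient expr1; case: eqVneq => [->|t0]; last by field.
  by rewrite f0 mul0r.
- by rewrite /power_quotient eqxx divr1.
Qed.

(** The derivative [1 / f' (g t)] of the inverse is as smooth as the inverse
    itself, which gains one order of smoothness at each step. *)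
Lemma smooth_inverse (f g : R -> R) :
  smooth setT f -> (forall t, derive1 f t != 0) ->
  cancel f g -> cancel g f -> continuous g -> smooth setT g.
Proof.
move=> sf f'0 fK gK cg.
have cf : continuous f by move=> t; exact: (Ck_continuous (sf 0%N)).
have Dg (y : R) : is_derive y 1 g ('D_1 f (g y))^-1.
  rewrite -{1}(gK y); apply: is_derive_inverse.
  - by near=> x; exact: fK.
  - by near=> x; exact: cf.
  - by apply/derivableP/derivable1_diffP; have [H _] := sf 1%N; exact: H.
  - by rewrite -derive1E.
elim=> [|n IH]; first by move=> t _; exact: cg.
apply: (Ck_is_derive openT (fun y _ => Dg y)).
apply: (@Ck_comp _ _ n setT [set t : R | t != 0] (fun y => 'D_1 f (g y))).
- exact: openT.
- by move=> y _ /=; rewrite -derive1E.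
- apply: (@Ck_comp _ _ n setT setT g ('D_1 f)) => //; first exact: openT.
  by have [_ H] := sf n.+1; exact: H.
- exact: smooth_inv.
Unshelve. all: by end_near. Qed.

End OneVariable.

Section Periodicity.
Context {R : realType}.

Lemma shift_ind (T a : R) (P : R -> Prop) : 0 < T ->
  (forall x, P x <-> P (x + T)) -> (forall x, a <= x < a + T -> P x) ->
  forall x, P x.
Proof.
move=> T0 PT Pa x.
have Pn (n : nat) y : P y <-> P (y + n%:R * T).
  elim: n => [|n IH]; first by rewrite mul0r addr0.
  by rewrite -natr1 mulrDl mul1r addrA; apply: iff_trans IH _; exact: PT.
have Pz (n : int) y : P y <-> P (y + n%:~R * T).
  case: n => n; first exact: Pn.
  rewrite NegzE rmorphN /= mulNr; apply: iff_sym.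
  by have := Pn n.+1 (y - n.+1%:R * T); rewrite subrK.
pose n := Num.floor ((x - a) / T); apply/(Pz (- n)).
apply: Pa; have /andP[] := floor_itv ((x - a) / T); rewrite -/n.
rewrite ler_pdivlMr // ltr_pdivrMr // rmorphD /= rmorphN /=.
set z := n%:~R : R; rewrite mulrDl mul1r mulNr => H1 H2.
by apply/andP; split; lra.
Qed.

Lemma periodic_bounded (T : R) (f : R -> R) : 0 < T -> periodic f T ->
  continuous f -> exists2 M, 0 < M & forall x, `|f x| <= M.
Proof.
move=> T0 fT cf.
have cn : {within `[0, T], continuous (fun x => `|f x|)}.
  apply: continuous_subspaceT => x.
  by apply: continuous_comp; [exact: cf|exact: norm_continuous].
have [c _ Hc] := EVT_max (ltW T0) cn.
exists (`|f c| + 1); first by rewrite ltr_wpDl.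
apply: (@shift_ind T 0) => // [x|x]; first by rewrite fT.
move=> /andP[x0 xT]; rewrite add0r in xT.
by apply: le_trans (Hc x _) _; rewrite ?lerDl // in_itv /= x0 ltW.
Qed.

Lemma smooth_of_at (V W : normedModType R) (f : V -> W) :
  (forall z, smooth_at f z) -> smooth setT f.
Proof.
move=> Hf n; elim: n f Hf => [|n IH] f Hf /=.
  by move=> z _; exact: smooth_at_continuous.
by split=> [z _|v]; [exact: smooth_at_diff|apply: IH => z; exact: smooth_at_derive].
Qed.

Lemma smooth_at_of (V W : normedModType R) (f : V -> W) z :
  smooth setT f -> smooth_at f z.
Proof. by move=> H; exact: (smooth_atP openT H). Qed.

Lemma smooth_at_affine (f : R -> R) (a b z : R) :
  smooth_at f (a * z + b) -> smooth_at (fun x => f (a * x + b)) z.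
Proof.
move=> H; apply: (smooth_at_comp (f := fun x => a * x + b)) => //.
apply: smooth_atD; last exact: smooth_at_cst.
by apply: smooth_atM; [exact: smooth_at_cst|exact: smooth_at_id].
Qed.

Lemma is_derive_affine (a b x : R) : is_derive x 1 (fun t : R => a * t + b) a.
Proof.
have H := is_deriveD (is_deriveZ a (is_derive_id x (1 : R))) (is_derive_cst b x 1).
by apply: (is_derive_eq H); rewrite addr0 /GRing.scale /= mulr1.
Qed.

End Periodicity.

(** * A flip of the cylinder *)

(** The front of a knot with one crossing, on the cylinder of the Reeb orbits
    other than the poles: [k phi] is the height of the strand at azimuth
    [phi], which closes up after two turns; [ps] is the azimuth of the
    crossing.  The strand stays at heights [sg] and [- sg] for most of the
    time. *)
Record profile {R : realType} (k : R -> R) (sg ps : R) : Prop := Profile {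
  profile_smooth : smooth setT k;
  profile_per : periodic k (4 * pi);
  profile_gt0 : 0 < sg;
  profile_bound : forall phi, - sg <= k phi <= sg;
  profile_hi : forall phi, 1 <= phi <= 2 * pi - 1 -> k phi = sg;
  profile_lo : forall phi, 2 * pi + 1 <= phi <= 4 * pi - 1 -> k phi = - sg;
  profile_ps : -1 < ps < 1;
  profile_cross : k (ps + 2 * pi) = k ps;
  profile_above : forall phi, ps < phi < ps + 2 * pi -> k (phi + 2 * pi) < k phi;
  profile_slope : 0 < 'D_1 (fun phi => k phi - k (phi + 2 * pi)) ps
}.

Section Flip.
Context {R : realType} (k : R -> R) (sg ps : R) (Hk : profile k sg ps).

Let gap (phi : R) := k phi - k (phi + 2 * pi).

Lemma profile_smooth_at phi : smooth_at k phi.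
Proof. exact/smooth_at_of/(profile_smooth Hk). Qed.

Lemma gap_alt phi : gap (phi + 2 * pi) = - gap phi.
Proof.
rewrite /gap opprB; congr (_ - _).
by rewrite -[RHS](profile_per Hk); congr k; ring.
Qed.

Lemma gap_smooth_at phi : smooth_at gap phi.
Proof.
apply: smooth_atB; first exact: profile_smooth_at.
apply: (smooth_at_comp (f := fun x => x + 2 * pi)); first exact: profile_smooth_at.
by apply: smooth_atD; [exact: smooth_at_id|exact: smooth_at_cst].
Qed.

Lemma sin_half_alt (phi : R) :
  sin ((phi + 2 * pi - ps) / 2) = - sin ((phi - ps) / 2).
Proof. by rewrite -sinDpi; congr sin; field. Qed.

(** Both factors change sign under a turn, and vanish to first order at the
    crossing only; the quotient is smooth there by Hadamard's lemma. *)
Lemma gap_factor : exists hh : R -> R,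
  [/\ smooth setT hh, periodic hh (2 * pi), forall phi, 0 < hh phi
    & forall phi, gap phi = hh phi * sin ((phi - ps) / 2)].
Proof.
have p0 := pi_gt0 R.
have gs : smooth setT (fun t : R => gap (1 * t + ps)).
  by apply: smooth_of_at => t; apply: smooth_at_affine; exact: gap_smooth_at.
have ss : smooth setT (fun t : R => sin (2^-1 * t + 0)).
  by apply: smooth_of_at => t; apply: smooth_at_affine; exact: smooth_at_sin.
have gap_ps : gap ps = 0 by rewrite /gap (profile_cross Hk) subrr.
have [|h1 [sh1 gE h10]] := smooth_divX gs; first by rewrite mulr0 add0r.
have [|h2 [sh2 sE h20]] := smooth_divX ss; first by rewrite mulr0 add0r sin0.
have h1_gt0 : 0 < h1 0.
  rewrite h10; have := profile_slope Hk; rewrite -/gap.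
  suff -> : 'D_1 (fun t : R => gap (1 * t + ps)) 0 = 'D_1 gap ps by [].
  have Dg : derivable gap ps 1.
    exact/derivable1_diffP/smooth_at_diff/gap_smooth_at.
  have Dl : is_derive (0 : R) 1 (fun t : R => 1 * t + ps) 1.
    exact: is_derive_affine.
  have := @is_derive1_comp R gap (fun t : R => 1 * t + ps) 0 ('D_1 gap ps) 1.
  rewrite mulr0 add0r mulr1 => H.
  by have [_ ->] := H (derivableP Dg) Dl.
have h2_gt0 : 0 < h2 0.
  rewrite h20.
  have Dl : is_derive (0 : R) 1 (fun t : R => 2^-1 * t + 0) 2^-1.
    exact: is_derive_affine.
  have := @is_derive1_comp R sin (fun t : R => 2^-1 * t + 0) 0 (cos 0) 2^-1.
  rewrite mulr0 add0r => H.
  by have [_ ->] := H (is_derive_sin 0) Dl; rewrite cos0 mul1r invr_gt0.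
(* At the crossing, the quotient of the two derivatives. *)
pose hh phi := if sin ((phi - ps) / 2) == 0 then h1 0 / h2 0
               else gap phi / sin ((phi - ps) / 2).
have hhT : periodic hh (2 * pi).
  move=> phi; rewrite /hh sin_half_alt oppr_eq0; case: eqP => // _.
  by rewrite gap_alt invrN mulrNN.
have sin_gt0 phi : ps < phi < ps + 2 * pi -> 0 < sin ((phi - ps) / 2).
  by move=> /andP[H1 H2]; apply: sin_gt0_pi; apply/andP; split; lra.
have hhE phi : `|phi - ps| < 2 * pi -> h2 (phi - ps) != 0 /\
    hh phi = h1 (phi - ps) / h2 (phi - ps).
  rewrite ltr_norml => /andP[H1 H2]; rewrite /hh.
  have [->|pn] := eqVneq phi ps.
    by rewrite subrr mul0r sin0 eqxx gt_eqF.
  have sn : sin ((phi - ps) / 2) != 0.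
    have [lt|lt|eq] := ltgtP phi ps; last by rewrite eq eqxx in pn.
      rewrite -oppr_eq0 -sin_half_alt gt_eqF // sin_gt0 //; apply/andP; split; lra.
    by rewrite gt_eqF // sin_gt0 //; apply/andP; split; lra.
  have := sE (phi - ps); rewrite addr0 mulrC => E2.
  have := gE (phi - ps); rewrite mul1r subrK => E1.
  have pps0 : phi - ps != 0 by rewrite subr_eq0.
  have h2n : h2 (phi - ps) != 0.
    by apply: contraNneq sn => h2e; rewrite E2 h2e mulr0.
  rewrite (negPf sn) E1 E2; split=> //; field.
  by rewrite h2n pps0.
exists hh; split=> //.
- apply: smooth_of_at; apply: (@shift_ind R (2 * pi) ps) => [|x|x]; first by lra.
    split=> Hx.
      have H : smooth_at hh (1 * (x + 2 * pi) + (- (2 * pi))).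
        by rewrite mul1r addrK.
      have := smooth_at_affine H; apply: smooth_at_eq; near=> y.
      by rewrite -hhT mul1r subrK.
    have H : smooth_at hh (1 * x + 2 * pi) by rewrite mul1r.
    have := smooth_at_affine H; apply: smooth_at_eq; near=> y.
    by rewrite mul1r hhT.
  move=> /andP[x1 x2].
  have nx : \forall y \near x, `|y - ps| < 2 * pi.
    have xb : ps - 2 * pi < x < ps + 2 * pi by apply/andP; split; lra.
    have : \forall y \near x, y \in `](ps - 2 * pi), (ps + 2 * pi)[.
      exact: near_in_itvoo.
    apply: filterS => y; rewrite in_itv /= ltr_norml => /andP[H1 H2].
    by apply/andP; split; lra.
  have [h2x _] := hhE x (nbhs_singleton nx).
  have S1 : smooth_at (fun y : R => h1 (1 * y + - ps)) x.
    by apply: smooth_at_affine; exact: smooth_at_of.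
  have S2 : smooth_at (fun y : R => h2 (1 * y + - ps)) x.
    by apply: smooth_at_affine; exact: smooth_at_of.
  have h2x' : h2 (1 * x + - ps) != 0 by rewrite mul1r.
  have := smooth_atM S1 (smooth_atV h2x' S2); apply: smooth_at_eq.
  by apply: filterS nx => y /hhE [_ ->]; rewrite mul1r.
- apply: (@shift_ind R (2 * pi) ps) => [|x|x]; [by lra|by rewrite hhT|].
  move=> /andP[]; rewrite le_eqVlt => /predU1P[<- _|x1 x2]; rewrite /hh.
    by rewrite subrr mul0r sin0 eqxx divr_gt0.
  have s0 : 0 < sin ((x - ps) / 2) by apply: sin_gt0; rewrite x1.
  rewrite gt_eqF // divr_gt0 // /gap subr_gt0; apply: (profile_above Hk).
  by rewrite x1.
- apply: (@shift_ind R (2 * pi) ps) => [|x|x]; first by lra.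
    by rewrite hhT gap_alt sin_half_alt mulrN; split=> [->//|/oppr_inj].
  move=> /andP[]; rewrite le_eqVlt => /predU1P[<- _|x1 x2].
    by rewrite gap_ps subrr mul0r sin0 mulr0.
  have s0 : 0 < sin ((x - ps) / 2) by apply: sin_gt0; rewrite x1.
  by rewrite /hh gt_eqF // divfK // gt_eqF.
Unshelve. all: by end_near. Qed.

End Flip.

Section Flip.
Context {R : realType} (k : R -> R) (sg ps : R) (Hk : profile k sg ps).
Let gap (phi : R) := k phi - k (phi + 2 * pi).

(** An affine map [s |-> - (lam phi * s + A phi)] is determined by its effect on
    the two strands, except at the crossing.  Its slope is a quotient of gaps,
    which extends smoothly and positively by [gap_factor]. *)
Lemma flip_coefficients : exists A lam : R -> R,
  [/\ smooth setT A, smooth setT lam, periodic A (2 * pi), periodic lam (2 * pi)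
    & (forall phi, 0 < lam phi) /\
      forall phi, lam phi * k phi + A phi = - k (2 * ps - phi)].
Proof.
have p0 := pi_gt0 R.
have [hh [shh hhT hh0 gapE0]] := gap_factor Hk.
have gapE phi : gap phi = hh phi * sin ((phi - ps) / 2) by exact: gapE0.
have hhN phi : hh (2 * ps - (phi + 2 * pi)) = hh (2 * ps - phi).
  by rewrite -[LHS]hhT; congr hh; ring.
pose lam phi := hh (2 * ps - phi) / hh phi.
pose A phi := - k (2 * ps - phi) - lam phi * k phi.
have refl (f : R -> R) : smooth setT f -> smooth setT (fun phi => f (2 * ps - phi)).
  move=> sf; apply: smooth_of_at => phi.
  have H : smooth_at f (-1 * phi + 2 * ps) by exact: smooth_at_of.
  by have := smooth_at_affine H; apply: smooth_at_eq; near=> y; congr f; ring.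
have slam : smooth setT lam.
  apply: smooth_of_at => phi; apply: smooth_atM; first exact/smooth_at_of/refl.
  by apply: smooth_atV; [rewrite gt_eqF|exact: smooth_at_of].
exists A, lam; split=> //.
- apply: smooth_of_at => phi; apply: smooth_atB.
    by apply: smooth_atN; apply/smooth_at_of/refl/(profile_smooth Hk).
  by apply: smooth_atM; [exact: smooth_at_of|exact: (profile_smooth_at Hk)].
- move=> phi; rewrite /A /lam hhN hhT -/(lam phi).
  have E : lam phi * gap phi = - gap (2 * ps - phi).
    rewrite !gapE (_ : (2 * ps - phi - ps) / 2 = - ((phi - ps) / 2)); last by field.
    by rewrite sinN /lam; field; rewrite gt_eqF.
  have -> : k (2 * ps - (phi + 2 * pi)) = k (2 * ps - phi + 2 * pi).
    by rewrite -[LHS](profile_per Hk); congr k; ring.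
  by move: E; rewrite /gap => E; lra.
- by move=> phi; rewrite /lam hhN hhT.
- by split=> phi; [rewrite divr_gt0|rewrite /A; lra].
Unshelve. all: by end_near. Qed.

(** A smooth step is at hand in the strand itself, between its two heights. *)
Let step (x : R) := (k (x + pi) + sg) / (2 * sg).

Lemma smooth_step : smooth setT step.
Proof.
apply: smooth_of_at => x; apply: smooth_atM; last exact: smooth_at_cst.
apply: smooth_atD; last exact: smooth_at_cst.
apply: (smooth_at_comp (f := fun x => x + pi)); first exact: (profile_smooth_at Hk).
by apply: smooth_atD; [exact: smooth_at_id|exact: smooth_at_cst].
Qed.

Lemma step01 x : 0 <= step x <= 1.
Proof.
have sg0 := profile_gt0 Hk; have /andP[H1 H2] := profile_bound Hk (x + pi).
rewrite /step ler_pdivrMr ?mulr_gt0 // divr_ge0 //=; lra.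
Qed.

Lemma step1 x : 0 <= x <= pi / 2 -> step x = 1.
Proof.
have p2 := pi_ge2 R; have sg0 := profile_gt0 Hk.
move=> /andP[x0 xp]; rewrite /step (profile_hi Hk); last by apply/andP; split; lra.
by field; rewrite gt_eqF.
Qed.

Lemma step0 x : 3 / 2 * pi <= x <= 2 * pi -> step x = 0.
Proof.
have p2 := pi_ge2 R.
move=> /andP[x0 xp]; rewrite /step (profile_lo Hk); last by apply/andP; split; lra.
by rewrite addNr mul0r.
Qed.

(** The argument of the step moves so slowly that [s * chi' s] is as small as
    desired: it is a slowly varying function of [ln (1 + s ^+ 2)]. *)
Lemma slow_cutoff (L eps : R) : 0 < L -> 0 < eps -> exists chi chi' : R -> R,
  [/\ smooth setT chi, forall s : R, is_derive s 1 chi (chi' s),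
      forall s, 0 <= chi s <= 1,
      forall s, `|chi' s| <= eps /\ `|chi' s * s| <= eps
    & (forall s, `|s| <= L -> chi s = 1) /\
      exists N : R, forall s, N < `|s| -> chi s = 0].
Proof.
move=> L0 eps0; have p0 := pi_gt0 R.
have Tstep : periodic step (4 * pi).
  move=> x; rewrite /step -[in RHS](profile_per Hk); congr ((k _ + _) / _).
  by ring.
have cstep' : continuous ('D_1 step).
  move=> x; apply: smooth_at_continuous; apply: smooth_at_derive.
  exact/smooth_at_of/smooth_step.
have Tstep' : periodic ('D_1 step) (4 * pi).
  move=> x; have Ds y : is_derive (y : R) 1 step ('D_1 step y).
    by apply/derivableP/derivable1_diffP/smooth_at_diff/smooth_at_of/smooth_step.
  have Ef : step \o (fun y : R => 1 * y + 4 * pi) = step.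
    by apply/funext => y; rewrite /= mul1r; exact: Tstep.
  have [_] := is_derive1_comp (Ds _) (is_derive_affine 1 (4 * pi) x).
  by rewrite Ef mul1r mulr1 => ->.
have [C C0 HC] := periodic_bounded (T := 4 * pi) ltac:(lra) Tstep' cstep'.
have l43 : 0 < ln (4 / 3 : R) by apply: ln_gt0; lra.
have lL : 0 <= ln (1 + L ^+ 2) by apply: ln_ge0; rewrite lerDl sqr_ge0.
(* The first bound keeps the argument of the step below pi / 2 for
   [`|s| <= L]; the second one makes the derivative small, the step having
   derivative at most [C]. *)
pose eta := Num.min (ln (4 / 3) / (1 + ln (1 + L ^+ 2))) (eps / (4 * pi * C)).
have eta0 : 0 < eta.
  rewrite lt_min; apply/andP; split; apply: divr_gt0 => //; first by lra.
  by rewrite !mulr_gt0.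
have eta1 : eta * ln (1 + L ^+ 2) <= ln (4 / 3).
  have H : eta <= ln (4 / 3) / (1 + ln (1 + L ^+ 2)) by rewrite ge_min lexx.
  have : eta * (1 + ln (1 + L ^+ 2)) <= ln (4 / 3) by rewrite -ler_pdivlMr //; lra.
  by lra.
have eta2 : 4 * pi * C * eta <= eps.
  have H : eta <= eps / (4 * pi * C) by rewrite ge_min lexx orbT.
  by rewrite mulrC -ler_pdivlMr // !mulr_gt0.
pose E s := expR (- eta * ln (1 + s ^+ 2)).
have s1 (s : R) : 0 < 1 + s ^+ 2 by rewrite ltr_pwDl // sqr_ge0.
have DE (s : R) : is_derive s 1 E (E s * (- eta * (2 * s / (1 + s ^+ 2)))).
  have D1 : is_derive s 1 (fun s : R => 1 + s ^+ 2) (2 * s).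
    have H := is_deriveD (is_derive_cst (1 : R) s 1) (is_deriveXn 1 s).
    by apply: (is_derive_eq H); rewrite add0r expr1.
  have D2 := @is_derive1_comp R (@ln R) (fun s => 1 + s ^+ 2) s _ _
    (is_derive1_ln (s1 s)) D1.
  have D3 := is_deriveZ (- eta) D2.
  have D4 := @is_derive1_comp R (@expR R) (fun s => - eta * ln (1 + s ^+ 2)) s _ _
    (is_derive_expR _) D3.
  apply: (is_derive_eq D4); rewrite /GRing.scale /=; congr (_ * (_ * _)).
  by rewrite mulrC.
have E01 s : 0 < E s <= 1.
  rewrite expR_gt0 -[leRHS]expR0 ler_expR mulNr oppr_le0 mulr_ge0 //; first exact: ltW.
  by apply: ln_ge0; rewrite lerDl sqr_ge0.
pose tau s := 2 * pi * (1 - E s).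
have Dtau (s : R) : is_derive s 1 tau (4 * pi * eta * E s * (s / (1 + s ^+ 2))).
  have H := is_deriveZ (2 * pi) (is_deriveB (is_derive_cst (1 : R) s 1) (DE s)).
  apply: (is_derive_eq H); rewrite /GRing.scale /= sub0r; field.
  by rewrite gt_eqF.
pose chi' s := 'D_1 step (tau s) * (4 * pi * eta * E s * (s / (1 + s ^+ 2))).
have chi'_le s r : `|s * r| <= 1 + s ^+ 2 -> `|chi' s * r| <= eps.
  move=> Hr; rewrite /chi' -mulrA normrM; apply: le_trans eta2.
  have -> : 4 * pi * C * eta = C * (4 * pi * eta) by ring.
  apply: ler_pM => //.
  have -> : 4 * pi * eta * E s * (s / (1 + s ^+ 2)) * r
      = 4 * pi * eta * (E s * (s * r / (1 + s ^+ 2))) by field; rewrite gt_eqF.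
  have P4 : 0 <= 4 * pi * eta by rewrite !mulr_ge0 // ltW.
  rewrite normrM (ger0_norm P4) ler_piMr // normrM mulr_ile1 //.
    by have /andP[H1 H2] := E01 s; rewrite ger0_norm // ltW.
  by rewrite normrM normfV (gtr0_norm (s1 s)) ler_pdivrMr // mul1r.
exists (step \o tau), chi'; split.
- apply: smooth_of_at => s; apply: smooth_at_comp.
    exact/smooth_at_of/smooth_step.
  apply: smooth_atM; first exact: smooth_at_cst.
  apply: smooth_atB; first exact: smooth_at_cst.
  apply: (smooth_at_comp (phi := expR)); first exact: smooth_at_exp.
  apply: smooth_atM; first exact: smooth_at_cst.
  apply: (smooth_at_comp (phi := @ln R)); first exact: smooth_at_ln.
  apply: smooth_atD; first exact: smooth_at_cst.
  have := smooth_atM (smooth_at_id s) (smooth_at_id s).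
  by apply: smooth_at_eq; near=> y; rewrite expr2.
- move=> s; apply: (@is_derive1_comp R step tau s _ _ _ (Dtau s)).
  by apply/derivableP/derivable1_diffP/smooth_at_diff/smooth_at_of/smooth_step.
- by move=> s; exact: step01.
- move=> s; split.
    rewrite -[chi' s]mulr1; apply: chi'_le; rewrite mulr1.
    by rewrite ler_norml; apply/andP; split; nra.
  by apply: chi'_le; rewrite -expr2 ger0_norm ?sqr_ge0 // lerDr.
- split.
    move=> s sL; apply: step1; rewrite /tau.
    have /andP[_ E1] := E01 s.
    suff E34 : 3 / 4 <= E s by apply/andP; split; nra.
    have -> : 3 / 4 = expR (- ln (4 / 3)) :> R.
      by rewrite expRN lnK ?invf_div // posrE; lra.
    rewrite ler_expR mulNr lerN2; apply: le_trans eta1.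
    rewrite ler_pM2l // ler_ln ?posrE // lerD2l -[s ^+ 2]real_normK ?num_real //.
    by rewrite ler_sqr // nnegrE // ltW.
  exists (Num.sqrt (expR (ln 4 / eta))) => s Ns; apply: step0; rewrite /tau.
  have /andP[E0 _] := E01 s.
  suff E14 : E s <= 4^-1 by apply/andP; split; nra.
  have -> : 4^-1 = expR (- ln 4) :> R by rewrite expRN lnK // posrE.
  rewrite ler_expR mulNr lerN2 mulrC -ler_pdivrMr //.
  rewrite -ler_expR lnK ?posrE // -[s ^+ 2]real_normK ?num_real //.
  have H : expR (ln 4 / eta) < `|s| ^+ 2.
    rewrite -[ltLHS]sqr_sqrtr ?expR_ge0 // ltr_sqr ?nnegrE ?sqrtr_ge0 //.
  by rewrite ltW // (lt_trans H) // ltrDr.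
Unshelve. all: by end_near. Qed.

(** Heights [s] at azimuth [phi] go to [- flip_height s phi]: affine in [s]
    around the knot, the identity near the poles. *)
Definition flip_height (A lam chi : R -> R) (s phi : R) : R :=
  s + chi s * (A phi + (lam phi - 1) * s).

(** The quantity bounded in [flip_slope] is the derivative of [flip_height] in
    [s]: the flip is a diffeomorphism from each meridian to its image. *)
Record flip (A lam chi : R -> R) (N : R) : Prop := IsFlip {
  flipA_smooth : smooth setT A;
  flipl_smooth : smooth setT lam;
  flipc_smooth : smooth setT chi;
  flipA_per : periodic A (2 * pi);
  flipl_per : periodic lam (2 * pi);
  flipl_gt0 : forall phi, 0 < lam phi;
  flip_strand : forall phi, lam phi * k phi + A phi = - k (2 * ps - phi);
  flipc1 : forall s, `|s| <= sg + 1 -> chi s = 1;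
  flipc0 : forall s, N < `|s| -> chi s = 0;
  flip_slope : forall s phi, 0 < 1 + chi s * (lam phi - 1)
                             + 'D_1 chi s * (A phi + (lam phi - 1) * s)
}.

(** The slope in [s] of the affine map at full strength is [lam], which is
    bounded below; cutting it off slowly perturbs this by at most half of the
    bound. *)
Lemma flip_exists : exists A lam chi N, flip A lam chi N.
Proof.
have p0 := pi_gt0 R; have sg0 := profile_gt0 Hk.
have [A [lam [sA sl TA Tl [l0 strand]]]] := flip_coefficients.
have cont (f : R -> R) : smooth setT f -> continuous f.
  by move=> sf x; exact: (Ck_continuous (sf 0%N)).
have pi2 : 0 < 2 * pi :> R by lra.
have [MA MA0 HA] := periodic_bounded pi2 TA (cont _ sA).
have [ML ML0 HL] := periodic_bounded pi2 Tl (cont _ sl).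
have Tv : periodic (fun phi => (lam phi)^-1) (2 * pi) by move=> x; rewrite Tl.
have cv : continuous (fun phi => (lam phi)^-1).
  move=> x; apply: smooth_at_continuous; apply: smooth_atV; last exact: smooth_at_of.
  by rewrite gt_eqF.
have [Mv Mv0 Hv] := periodic_bounded pi2 Tv cv.
(* A lower bound of [1 + chi s * (lam phi - 1)], a convex combination of 1 and
   [lam phi]. *)
pose m := Num.min 1 Mv^-1.
have m0 : 0 < m by rewrite lt_min ltr01 invr_gt0.
have lm phi : m <= lam phi.
  apply: (@le_trans _ _ Mv^-1); first by rewrite ge_min lexx orbT.
  rewrite -[leRHS]invrK lef_pV2 ?posrE ?invr_gt0 //.
  by apply: le_trans (Hv phi); rewrite ler_norm.
pose eps := m / (2 * (MA + ML + 1)).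
have D0 : 0 < 2 * (MA + ML + 1) by lra.
have eps0 : 0 < eps by rewrite divr_gt0.
have epsE : eps * (MA + ML + 1) = m / 2 by rewrite /eps; field; lra.
have [|chi [chi' [sc Dc c01 small [c1 [N c0]]]]] := @slow_cutoff (sg + 1) eps _ eps0.
  by lra.
exists A, lam, chi, N; split=> // s phi.
have -> : 'D_1 chi s = chi' s by have [_] := Dc s.
have /andP[chi0 chi1] := c01 s; have [sm1 sm2] := small s.
have m1 : m <= 1 by rewrite ge_min lexx.
have H1 : m <= 1 + chi s * (lam phi - 1).
  have := lm phi; move=> Hl; have : 0 <= chi s * (lam phi - m) by rewrite mulr_ge0 // subr_ge0.
  have : 0 <= (1 - chi s) * (1 - m) by rewrite mulr_ge0 // subr_ge0.
  by move=> ? ?; lra.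
have H2 : `|chi' s * (A phi + (lam phi - 1) * s)| <= eps * (MA + ML + 1).
  have -> : chi' s * (A phi + (lam phi - 1) * s)
    = chi' s * A phi + chi' s * s * (lam phi - 1) by ring.
  have -> : eps * (MA + ML + 1) = eps * MA + eps * (ML + 1) by ring.
  apply: le_trans (ler_normD _ _) _; rewrite lerD // normrM ler_pM //.
  by apply: le_trans (ler_normB _ _) _; rewrite normr1 lerD.
rewrite epsE in H2.
have : - (m / 2) <= chi' s * (A phi + (lam phi - 1) * s).
  by move: H2; rewrite ler_norml => /andP[].
by move=> ?; lra.
Qed.

End Flip.

(** * Cylindrical coordinates on the sphere *)

Section Cylinder.
Context {R : realType}.
Local Notation space := (R * R * R)%type.

Lemma cos1_turns (x : R) : cos x = 1 -> exists n : int, x = 2 * pi * n%:~R.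
Proof.
have p0 := pi_gt0 R.
move: x; apply: (@shift_ind R (2 * pi) 0) => [|x|x]; first by lra.
  have -> : cos (x + 2 * pi) = cos x.
    by rewrite -[RHS](@cosD2pi R); congr cos; rewrite mulr_natl.
  split=> H /H [n E].
    by exists (n + 1); rewrite E rmorphD /=; ring.
  by exists (n - 1); rewrite rmorphB /=; lra.
move=> /andP[]; rewrite le_eqVlt => /predU1P[<- _ _|x0 x2].
  by exists 0; rewrite mulr0.
have s0 : 0 < sin (x / 2) by apply: sin_gt0_pi; apply/andP; split; lra.
have : cos x = 1 - 2 * sin (x / 2) ^+ 2.
  have {1}-> : x = x / 2 + x / 2 by field.
  by rewrite cosD -!expr2 cos2sin2; ring.
by move=> -> /eqP; rewrite -subr_eq0; nra.
Qed.

Lemma angle_eq (a b : R) : cos a = cos b -> sin a = sin b ->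
  exists n : int, a = b + 2 * pi * n%:~R.
Proof.
move=> Ec Es; have [|n E] := @cos1_turns (a - b).
  by rewrite cosB Ec Es -!expr2 cos2Dsin2.
by exists n; rewrite -E addrC subrK.
Qed.

Lemma periodic_int (T : Type) (f : R -> T) (c : R) (n : int) :
  (forall x, f (x + c) = f x) -> forall x, f (x + c * n%:~R) = f x.
Proof.
move=> fc; have fn (m : nat) x : f (x + c * m%:R) = f x.
  elim: m => [|m IH]; first by rewrite mulr0 addr0.
  by rewrite -natr1 mulrDr mulr1 addrA fc.
case: n => n x; first exact: fn.
by rewrite NegzE rmorphN /= mulrN -{2}(subrK (c * n.+1%:R) x) fn.
Qed.

Lemma periodic_angle (T : Type) (f : R -> T) (a b : R) :
  (forall x, f (x + 2 * pi) = f x) -> cos a = cos b -> sin a = sin b ->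
  f a = f b.
Proof.
by move=> fT Ec Es; have [n ->] := angle_eq Ec Es; exact: periodic_int.
Qed.

Lemma cosD2pi_int (a : R) (n : int) : cos (a + 2 * pi * n%:~R) = cos a.
Proof.
apply: periodic_int => x; rewrite -[RHS](@cosD2pi R).
by congr cos; rewrite mulr_natl.
Qed.

Lemma sinD2pi_int (a : R) (n : int) : sin (a + 2 * pi * n%:~R) = sin a.
Proof.
apply: periodic_int => x; rewrite -[RHS](@sinD2pi R).
by congr sin; rewrite mulr_natl.
Qed.

Lemma angle_exists (x y : R) : x ^+ 2 + y ^+ 2 = 1 ->
  exists a, x = cos a /\ y = sin a.
Proof.
move=> E; have x1 : -1 <= x <= 1 by apply/andP; split; nra.
have cx := acosK x1; have s2 : sin (acos x) ^+ 2 = y ^+ 2.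
  by rewrite sin2cos2 cx -E; ring.
have /orP[/eqP H|/eqP H] : (sin (acos x) == y) || (sin (acos x) == - y).
  by rewrite -eqf_sqr s2.
  by exists (acos x).
by exists (- acos x); rewrite cosN sinN cx H opprK.
Qed.

Definition rho (P : space) : R := Num.sqrt (P.1.1 ^+ 2 + P.1.2 ^+ 2).

(** Only the values at [ang P] of functions of period [2 * pi] matter. *)
Definition ang (P : space) : R :=
  xget 0 [set a | P.1.1 = rho P * cos a /\ P.1.2 = rho P * sin a].

Lemma rho_ge0 P : 0 <= rho P. Proof. exact: sqrtr_ge0. Qed.

Lemma sqr_rho P : rho P ^+ 2 = P.1.1 ^+ 2 + P.1.2 ^+ 2.
Proof. by rewrite sqr_sqrtr // addr_ge0 // sqr_ge0. Qed.

Lemma angP P : P.1.1 = rho P * cos (ang P) /\ P.1.2 = rho P * sin (ang P).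
Proof.
rewrite /ang; case: xgetP => [a _ //|H]; exfalso.
have E := sqr_rho P; have [r0|r0] := eqVneq (rho P) 0.
  apply: (H 0); rewrite /= r0 !mul0r; rewrite r0 expr0n /= in E.
  by split; nra.
have [|a [Ex Ey]] := @angle_exists (P.1.1 / rho P) (P.1.2 / rho P).
  by rewrite !expr_div_n -mulrDl -E divff // expf_neq0.
by apply: (H a); rewrite /= -Ex -Ey; split; field.
Qed.

Lemma sqrt1_gt0 (s : R) : 0 < Num.sqrt (1 + s ^+ 2).
Proof. by rewrite sqrtr_gt0 ltr_pwDl // sqr_ge0. Qed.

Lemma sqr_sqrt1 (s : R) : Num.sqrt (1 + s ^+ 2) ^+ 2 = 1 + s ^+ 2.
Proof. by rewrite sqr_sqrtr // addr_ge0 // sqr_ge0. Qed.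

(** The point of azimuth [phi] whose distance to the equatorial plane is [s]
    times its distance to the axis. *)
Definition cyl (s phi : R) : space :=
  (cos phi / Num.sqrt (1 + s ^+ 2), sin phi / Num.sqrt (1 + s ^+ 2),
   s / Num.sqrt (1 + s ^+ 2)).

Lemma rho_cyl s phi : rho (cyl s phi) = (Num.sqrt (1 + s ^+ 2))^-1.
Proof.
rewrite /rho /= !expr_div_n -mulrDl cos2Dsin2 mul1r -exprVn sqrtr_sqr.
by rewrite ger0_norm // invr_ge0 ltW // sqrt1_gt0.
Qed.

Lemma rho_cyl_gt0 s phi : 0 < rho (cyl s phi).
Proof. by rewrite rho_cyl invr_gt0 sqrt1_gt0. Qed.

Lemma height_cyl s phi : (cyl s phi).2 / rho (cyl s phi) = s.
Proof. by rewrite rho_cyl invrK /= divfK // gt_eqF // sqrt1_gt0. Qed.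

Lemma ang_cyl s phi :
  cos (ang (cyl s phi)) = cos phi /\ sin (ang (cyl s phi)) = sin phi.
Proof.
have [] := angP (cyl s phi); rewrite rho_cyl /= => Ec Es.
have n0 : (Num.sqrt (1 + s ^+ 2))^-1 != 0.
  by rewrite invr_eq0 gt_eqF // sqrt1_gt0.
by split; apply: (mulIf n0); rewrite mulrC.
Qed.

Lemma cyl_inj s phi s' phi' : cyl s phi = cyl s' phi' ->
  [/\ s = s', cos phi = cos phi' & sin phi = sin phi'].
Proof.
move=> E; have [c1 s1] := ang_cyl s phi; have [c2 s2] := ang_cyl s' phi'.
split; first by rewrite -(height_cyl s phi) E height_cyl.
  by rewrite -c1 -c2 E.
by rewrite -s1 -s2 E.
Qed.

Lemma sphere_cyl s phi : sphere (cyl s phi).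
Proof.
rewrite /sphere /= !expr_div_n -!mulrDl cos2Dsin2 -[X in X / _]sqr_sqrt1 divff //.
by rewrite expf_neq0 // gt_eqF // sqrt1_gt0.
Qed.

Lemma pole_rho b : rho (pole b : space) = 0.
Proof. by rewrite /rho /= expr0n /= addr0 sqrtr0. Qed.

Lemma sphere_pole b : sphere (pole b : space).
Proof. by case: b; rewrite /sphere /= ?expr0 ?expr1 ?sqrrN !expr1n !expr0n /= !add0r. Qed.

Lemma cyl_not_pole s phi b : cyl s phi <> pole b.
Proof. by move=> E; have := rho_cyl_gt0 s phi; rewrite E pole_rho ltxx. Qed.

Lemma poles_neq (b c : bool) : pole b = pole c :> space -> b = c.
Proof.
case: b c => [] [] // [] /eqP; rewrite /= ?expr0 ?expr1 -subr_eq0; last first.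
  by rewrite -opprD oppr_eq0 (_ : 1 + 1 = 2%:R) // pnatr_eq0.
by rewrite opprK (_ : 1 + 1 = 2%:R) // pnatr_eq0.
Qed.

Lemma sphereP P : sphere P ->
  (exists b, P = pole b) \/ (exists s phi, P = cyl s phi).
Proof.
case: P => [[x y] w]; rewrite /sphere /= => E.
have Er := sqr_rho (x, y, w); have [/= Ex Ey] := angP (x, y, w).
have r0 := rho_ge0 (x, y, w); move: (rho _) (ang _) => r a in Er Ex Ey r0.
move: Er r0; rewrite /= => Er; rewrite le_eqVlt => /predU1P[r0|r0].
  left; have Hw : (w == 1) || (w == - 1).
    by rewrite -eqf_sqr expr1n -E -Er -r0 expr0n /= add0r.
  rewrite Ex Ey -r0 !mul0r; case/orP: Hw => /eqP ->; [exists true|exists false].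
    by rewrite /pole /= expr0.
  by rewrite /pole /= expr1.
right; exists (w / r), a; have E2 : 1 + (w / r) ^+ 2 = r ^- 2.
  have Ew : w ^+ 2 = 1 - r ^+ 2 by lra.
  by rewrite expr_div_n Ew; field; rewrite gt_eqF.
rewrite /cyl E2 -exprVn sqrtr_sqr ger0_norm ?invr_ge0 ?ltW // !invrK divfK ?gt_eqF //.
by rewrite Ex Ey ![r * _]mulrC.
Qed.

Lemma sphere_not_pole P : sphere P -> (forall b, P <> pole b) ->
  exists s phi, P = cyl s phi.
Proof. by move=> /sphereP[[b ->]|//] /(_ b). Qed.

(** The latitude [r_1 ^ 2] of [cyl s phi]. *)
Definition lat (s : R) : R := (1 - s / Num.sqrt (1 + s ^+ 2)) / 2.

Lemma lat_prod s : lat s * (1 - lat s) = (Num.sqrt (1 + s ^+ 2))^-1 ^+ 2 / 4.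
Proof.
have n0 : Num.sqrt (1 + s ^+ 2) != 0 by rewrite gt_eqF // sqrt1_gt0.
rewrite /lat exprVn; have := sqr_sqrt1 s; move: (Num.sqrt _) n0 => r n0 E.
have -> : (1 - s / r) / 2 * (1 - (1 - s / r) / 2) = (r ^+ 2 - s ^+ 2) / r ^+ 2 / 4.
  by field.
by rewrite E addrK mul1r.
Qed.

Lemma sphere_pt_lat s phi : sphere_pt (lat s) phi = cyl s phi.
Proof.
rewrite /sphere_pt lat_prod sqrtrM ?sqr_ge0 // sqrtr_sqr.
have r0 := sqrt1_gt0 s; rewrite ger0_norm ?invr_ge0 ?ltW //.
have -> : Num.sqrt (4^-1) = 2^-1 :> R.
  by rewrite (_ : 4^-1 = 2^-1 ^+ 2) ?sqrtr_sqr ?ger0_norm ?invr_ge0 //; field.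
rewrite /cyl /lat; congr (_, _, _); field; by rewrite gt_eqF.
Qed.

Lemma lat01 s : 0 < lat s < 1.
Proof.
have r0 := sqrt1_gt0 s; have : `|s / Num.sqrt (1 + s ^+ 2)| < 1.
  rewrite normrM normfV (gtr0_norm r0) ltr_pdivrMr // mul1r.
  by rewrite -sqrtr_sqr ltr_sqrt ?ltrDr // ltr_pwDl // sqr_ge0.
by rewrite ltr_norml /lat => /andP[H1 H2]; apply/andP; split; lra.
Qed.

Lemma lat_surj u : 0 < u < 1 -> exists s, u = lat s.
Proof.
move=> /andP[u0 u1]; pose v := u * (1 - u).
have v0 : 0 < v by rewrite mulr_gt0 // subr_gt0.
have r0 : 0 < 2 * Num.sqrt v by rewrite mulr_gt0 // sqrtr_gt0.
exists ((1 - 2 * u) / (2 * Num.sqrt v)); rewrite /lat.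
have -> : 1 + ((1 - 2 * u) / (2 * Num.sqrt v)) ^+ 2 = (2 * Num.sqrt v) ^- 2.
  rewrite expr_div_n exprMn sqr_sqrtr; last exact: ltW.
  by rewrite /v; field; rewrite subr_eq0 !gt_eqF.
rewrite -exprVn sqrtr_sqr ger0_norm ?invr_ge0 ?ltW // invrK divfK ?gt_eqF //.
by field.
Qed.

Lemma lat_lt s s' : (lat s < lat s') = (s' < s).
Proof.
suff mono x y : x < y -> lat y < lat x.
  apply/idP/idP; last exact: mono.
  by apply: contraTT; rewrite -!leNgt le_eqVlt => /predU1P[->//|/mono/ltW].
move=> xy; rewrite /lat ltr_pM2r ?invr_gt0 // ltrD2l ltrN2.
have rx := sqrt1_gt0 x; have ry := sqrt1_gt0 y.
have Ex := sqr_sqrt1 x; have Ey := sqr_sqrt1 y.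
move: (Num.sqrt (1 + x ^+ 2)) (Num.sqrt (1 + y ^+ 2)) rx ry Ex Ey => a b a0 b0 Ea Eb.
rewrite ltr_pdivrMr // mulrAC ltr_pdivlMr // [ltLHS]mulrC.
have [x0|x0] := leP 0 x.
  have xy2 : x ^+ 2 < y ^+ 2 by rewrite ltr_sqr ?nnegrE //; lra.
  have H : (b * x) ^+ 2 < (y * a) ^+ 2 by rewrite !exprMn Ea Eb; lra.
  by rewrite ltr_sqr ?nnegrE ?mulr_ge0 // in H; [exact: ltW|lra|exact: ltW].
have [y0|y0] := leP 0 y.
  by apply: (@lt_le_trans _ _ 0); [rewrite pmulr_rlt0|rewrite mulr_ge0 // ltW].
have xy2 : y ^+ 2 < x ^+ 2 by rewrite -sqrrN -[ltRHS]sqrrN ltr_sqr ?nnegrE; lra.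
have H : (y * a) ^+ 2 < (b * x) ^+ 2 by rewrite !exprMn Ea Eb; lra.
rewrite -sqrrN -[ltRHS]sqrrN ltr_sqr ?nnegrE in H; first by rewrite -ltrN2.
  by rewrite oppr_ge0; nra.
by rewrite oppr_ge0; nra.
Qed.

Lemma lat_smooth_at s : smooth_at lat s.
Proof.
apply: smooth_atM; last exact: smooth_at_cst.
apply: smooth_atB; first exact: smooth_at_cst.
apply: smooth_atM; first exact: smooth_at_id.
apply: smooth_atV; first by rewrite gt_eqF // sqrt1_gt0.
apply: smooth_at_comp; first by apply: smooth_at_sqrt; rewrite ltr_pwDl // sqr_ge0.
apply: smooth_atD; first exact: smooth_at_cst.
have := smooth_atM (smooth_at_id s) (smooth_at_id s).
by apply: smooth_at_eq; near=> y; rewrite expr2.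
Unshelve. all: by end_near. Qed.

End Cylinder.

(** * The flip of the sphere *)

Section DirectionalDerivatives.
Context {R : realType} {V : normedModType R}.
Implicit Types f g : V -> R.

Lemma smooth_at_derivable f z v : smooth_at f z -> derivable f z v.
Proof. by move=> H; exact/diff_derivable/smooth_at_diff. Qed.

Lemma smooth_deriveD f g z v : smooth_at f z -> smooth_at g z ->
  'D_v (fun y => f y + g y) z = 'D_v f z + 'D_v g z.
Proof. by move=> Hf Hg; rewrite deriveD //; exact: smooth_at_derivable. Qed.

Lemma smooth_deriveM f g z v : smooth_at f z -> smooth_at g z ->
  'D_v (fun y => f y * g y) z = f z * 'D_v g z + g z * 'D_v f z.
Proof. by move=> Hf Hg; rewrite deriveM //; exact: smooth_at_derivable. Qed.

Lemma smooth_derive_comp f (phi : R -> R) z v :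
  smooth_at phi (f z) -> smooth_at f z ->
  'D_v (fun y => phi (f y)) z = 'D_1 phi (f z) * 'D_v f z.
Proof.
move=> /smooth_at_diff Hp /smooth_at_diff Hf.
rewrite deriveE; last exact: differentiable_comp.
have -> : 'd (fun y => phi (f y)) z = 'd phi (f z) \o 'd f z :> (_ -> _).
  exact: diff_comp.
rewrite /= !deriveE // mulrC.
by rewrite -[in LHS](mulr1 ('d f z v)) -[_ * 1]/(_ *: 1) linearZ.
Qed.

Lemma smooth_deriveB f g z v : smooth_at f z -> smooth_at g z ->
  'D_v (fun y => f y - g y) z = 'D_v f z - 'D_v g z.
Proof. by move=> Hf Hg; rewrite deriveB //; exact: smooth_at_derivable. Qed.

Lemma smooth_deriveV f z v : f z != 0 -> smooth_at f z ->
  'D_v (fun y => (f y)^-1) z = - 'D_v f z / f z ^+ 2.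
Proof.
move=> f0 Hf; rewrite deriveV //; last exact: smooth_at_derivable.
by rewrite /GRing.scale /= mulNr mulrC mulNr.
Qed.

Lemma smooth_deriveZ (a : R) f z v : smooth_at f z ->
  'D_v (fun y => a * f y) z = a * 'D_v f z.
Proof.
move=> Hf; rewrite smooth_deriveM //; last exact: smooth_at_cst.
by rewrite derive_cst mulr0 addr0.
Qed.

End DirectionalDerivatives.

Section Angle.
Context {R : realType} {V : normedModType R}.
Local Notation space := (R * R * R)%type.
Implicit Types f : V -> space.

Lemma smooth_at_x f z : smooth_at f z -> smooth_at (fun y => (f y).1.1) z.
Proof. by move=> Hf; apply: smooth_at_fst; exact: smooth_at_fst. Qed.

Lemma smooth_at_y f z : smooth_at f z -> smooth_at (fun y => (f y).1.2) z.
Proof. by move=> Hf; apply: smooth_at_snd; exact: smooth_at_fst. Qed.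

Lemma smooth_at_sqr (g : V -> R) z : smooth_at g z ->
  smooth_at (fun y => g y ^+ 2) z.
Proof.
by move=> Hg; have := smooth_atM Hg Hg; apply: smooth_at_eq; near=> y; rewrite expr2.
Unshelve. all: by end_near. Qed.

Lemma rho_smooth_at f z : rho (f z) != 0 -> smooth_at f z ->
  smooth_at (fun y => rho (f y)) z.
Proof.
move=> r0 Hf; apply: smooth_at_comp.
  by apply: smooth_at_sqrt; rewrite -sqrtr_gt0 lt_neqAle eq_sym r0 rho_ge0.
apply: smooth_atD; apply: smooth_at_sqr; [exact: smooth_at_x|exact: smooth_at_y].
Qed.

Lemma sqr_derive (g : V -> R) z v : smooth_at g z ->
  'D_v (fun y => g y ^+ 2) z = 2 * (g z * 'D_v g z).
Proof.
move=> Hg; rewrite (_ : (fun y => g y ^+ 2) = (fun y => g y * g y)); last first.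
  by apply/funext => y; rewrite expr2.
by rewrite smooth_deriveM // mulr2n mulrDl !mul1r.
Qed.

Lemma rho_derive f z v : rho (f z) != 0 -> smooth_at f z ->
  'D_v (fun y => rho (f y)) z =
  ((f z).1.1 * 'D_v (fun y => (f y).1.1) z
   + (f z).1.2 * 'D_v (fun y => (f y).1.2) z) / rho (f z).
Proof.
move=> r0 Hf; have Hr := rho_smooth_at r0 Hf.
have := sqr_derive v Hr.
have -> : (fun y => rho (f y) ^+ 2) = (fun y => (f y).1.1 ^+ 2 + (f y).1.2 ^+ 2).
  by apply/funext => y; exact: sqr_rho.
have Hx := smooth_at_x Hf; have Hy := smooth_at_y Hf.
rewrite smooth_deriveD ?sqr_derive //; try exact: smooth_at_sqr.
by move=> E; apply: (mulfI r0); rewrite mulrCA divff // mulr1; lra.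
Qed.

(** The branch of the azimuth near a point of azimuth [a]. *)
Definition branch (a : R) (P : space) : R :=
  a + atan ((cos a * P.1.2 - sin a * P.1.1) / (cos a * P.1.1 + sin a * P.1.2)).

Lemma sin_atan (x : R) : sin (atan x) = x * (Num.sqrt (1 + x ^+ 2))^-1.
Proof.
rewrite -cos_atan -{2}(atanK x) /tan divfK // gt_eqF // cos_gt0_pihalf //.
by rewrite atan_gtNpi2 atan_ltpi2.
Qed.

Lemma branchP a P : 0 < cos a * P.1.1 + sin a * P.1.2 ->
  cos (branch a P) = cos (ang P) /\ sin (branch a P) = sin (ang P).
Proof.
move=> X0; have [Ex Ey] := angP P.
rewrite /branch; set X := cos a * P.1.1 + _ in X0 *; set Y := _ - _.
have r0 : 0 < rho P.
  rewrite lt_neqAle rho_ge0 andbT eq_sym; apply: contraTN X0 => /eqP r0.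
  by rewrite /X Ex Ey r0 !mul0r !mulr0 addr0 ltxx.
have E : 1 + (Y / X) ^+ 2 = (rho P / X) ^+ 2.
  have : X ^+ 2 + Y ^+ 2 = (cos a ^+ 2 + sin a ^+ 2) * rho P ^+ 2.
    by rewrite sqr_rho /X /Y; ring.
  rewrite cos2Dsin2 mul1r => E; rewrite !expr_div_n -E; field.
  by rewrite gt_eqF.
have Ec : cos (atan (Y / X)) = X / rho P.
  rewrite cos_atan E sqrtr_sqr gtr0_norm ?divr_gt0 // invf_div //.
have Es : sin (atan (Y / X)) = Y / rho P.
  rewrite sin_atan E sqrtr_sqr gtr0_norm ?divr_gt0 // invf_div mulrA divfK //.
  by rewrite gt_eqF.
have rn : rho P != 0 by rewrite gt_eqF.
have C := cos2Dsin2 a.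
rewrite cosD sinD Ec Es; split; apply: (mulfI rn).
  rewrite -Ex (_ : rho P * _ = cos a * X - sin a * Y); last by field.
  transitivity ((cos a ^+ 2 + sin a ^+ 2) * P.1.1); first by rewrite /X /Y; ring.
  by rewrite C mul1r.
rewrite -Ey (_ : rho P * _ = sin a * X + cos a * Y); last by field.
transitivity ((cos a ^+ 2 + sin a ^+ 2) * P.1.2); first by rewrite /X /Y; ring.
by rewrite C mul1r.
Qed.

Lemma branch_num f z : smooth_at f z -> forall a : R,
  smooth_at (fun y => cos a * (f y).1.2 - sin a * (f y).1.1) z /\
  smooth_at (fun y => cos a * (f y).1.1 + sin a * (f y).1.2) z.
Proof.
move=> Hf a; have Hx := smooth_at_x Hf; have Hy := smooth_at_y Hf.
split; [apply: smooth_atB|apply: smooth_atD];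
  by apply: smooth_atM => //; exact: smooth_at_cst.
Qed.

Lemma branch_at (P : space) :
  cos (ang P) * P.1.2 - sin (ang P) * P.1.1 = 0 /\
  cos (ang P) * P.1.1 + sin (ang P) * P.1.2 = rho P.
Proof.
have [Ex Ey] := angP P; have C := cos2Dsin2 (ang P).
split; first by rewrite Ex Ey; ring.
by rewrite Ex Ey -[RHS]mulr1 -C; ring.
Qed.

Lemma branch_smooth_at f z : rho (f z) != 0 -> smooth_at f z ->
  smooth_at (fun y => branch (ang (f z)) (f y)) z.
Proof.
move=> r0 Hf; have [HY HX] := branch_num Hf (ang (f z)).
apply: smooth_atD; first exact: smooth_at_cst.
apply: (smooth_at_comp (phi := @atan R)); first exact: smooth_at_atan.
apply: smooth_atM => //; apply: smooth_atV => //.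
by have [_ ->] := branch_at (f z).
Qed.

(** The differential of the azimuth is [(x dy - y dx) / rho ^+ 2]. *)
Lemma branch_derive f z v : rho (f z) != 0 -> smooth_at f z ->
  'D_v (fun y => branch (ang (f z)) (f y)) z =
  ((f z).1.1 * 'D_v (fun y => (f y).1.2) z
   - (f z).1.2 * 'D_v (fun y => (f y).1.1) z) / rho (f z) ^+ 2.
Proof.
move=> r0 Hf; have [HY HX] := branch_num Hf (ang (f z)).
have [Y0 Xr] := branch_at (f z); have [Ex Ey] := angP (f z).
have Hx := smooth_at_x Hf; have Hy := smooth_at_y Hf.
have X0 : cos (ang (f z)) * (f z).1.1 + sin (ang (f z)) * (f z).1.2 != 0 by rewrite Xr.
rewrite /branch smooth_deriveD; last first.
- apply: (smooth_at_comp (phi := @atan R)); first exact: smooth_at_atan.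
  by apply: smooth_atM => //; exact: smooth_atV.
- exact: smooth_at_cst.
rewrite derive_cst add0r (smooth_derive_comp (phi := @atan R)); last first.
- by apply: smooth_atM => //; exact: smooth_atV.
- exact: smooth_at_atan.
rewrite -derive1E derive1_atan smooth_deriveM //; last exact: smooth_atV.
rewrite Y0 mul0r expr0n /= addr0 invr1 mul1r mul0r add0r Xr.
rewrite smooth_deriveB ?smooth_deriveZ //; try by apply: smooth_atM => //; exact: smooth_at_cst.
by rewrite Ex Ey; field.
Qed.

Lemma near_branch f z : rho (f z) != 0 -> smooth_at f z ->
  \forall y \near z, cos (branch (ang (f z)) (f y)) = cos (ang (f y)) /\
                     sin (branch (ang (f z)) (f y)) = sin (ang (f y)).
Proof.
move=> r0 Hf; have [_ HX] := branch_num Hf (ang (f z)).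
have := smooth_at_continuous HX; have [_ E] := branch_at (f z).
move=> /cvgr_gt H; have := H 0; rewrite E lt_neqAle eq_sym r0 rho_ge0.
by move=> /(_ isT); apply: filterS => y; exact: branchP.
Qed.

Lemma ang_smooth_at (A : R -> R) f z : smooth setT A -> periodic A (2 * pi) ->
  rho (f z) != 0 -> smooth_at f z -> smooth_at (fun y => A (ang (f y))) z.
Proof.
move=> sA TA r0 Hf.
have H : smooth_at (fun y => A (branch (ang (f z)) (f y))) z.
  by apply: smooth_at_comp; [exact: smooth_at_of|exact: branch_smooth_at].
apply: smooth_at_eq H; apply: filterS (near_branch r0 Hf) => y [Ec Es].
exact: periodic_angle.
Qed.

Lemma ang_derive (A : R -> R) f z v : smooth setT A -> periodic A (2 * pi) ->
  rho (f z) != 0 -> smooth_at f z ->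
  'D_v (fun y => A (ang (f y))) z = 'D_1 A (ang (f z)) *
  (((f z).1.1 * 'D_v (fun y => (f y).1.2) z
   - (f z).1.2 * 'D_v (fun y => (f y).1.1) z) / rho (f z) ^+ 2).
Proof.
move=> sA TA r0 Hf; have E : branch (ang (f z)) (f z) = ang (f z).
  by rewrite /branch (branch_at (f z)).1 mul0r atan0 addr0.
rewrite -(branch_derive v r0 Hf).
rewrite -[X in 'D_1 A X]E -(smooth_derive_comp (phi := A) v); last first.
- exact: branch_smooth_at.
- exact: smooth_at_of.
apply: near_eq_derive; apply: filterS (near_branch r0 Hf) => y [Ec Es].
by apply: periodic_angle.
Qed.

End Angle.

Section FlipMap.
Context {R : realType}.
Local Notation space := (R * R * R)%type.

Definition scale3 (m : R) (P : space) : space := (m * P.1.1, m * P.1.2, m * P.2).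

Definition enorm (P : space) : R :=
  Num.sqrt (P.1.1 ^+ 2 + P.1.2 ^+ 2 + P.2 ^+ 2).

Lemma derive_components (V : normedModType R) (g : V -> space) z v :
  smooth_at g z -> 'D_v g z =
    ('D_v (fun y => (g y).1.1) z, 'D_v (fun y => (g y).1.2) z,
     'D_v (fun y => (g y).2) z).
Proof.
move=> /smooth_at_diff dg.
have -> : 'D_v (fun y => (g y).1.1) z = ('D_v g z).1.1.
  apply: (derive_lin_comp (l := fst \o fst)) => // P.
  by apply: continuous_comp; exact: continuous_fst_pair.
have -> : 'D_v (fun y => (g y).1.2) z = ('D_v g z).1.2.
  apply: (derive_lin_comp (l := snd \o fst)) => // P.
  by apply: continuous_comp; [exact: continuous_fst_pair|exact: continuous_snd_pair].
have -> : 'D_v (fun y => (g y).2) z = ('D_v g z).2.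
  by apply: (derive_lin_comp (l := snd)) => // P; exact: continuous_snd_pair.
by case: ('D_v g z) => [[]].
Qed.

(** The derivatives of the scaling factor contribute multiples of [f z], which
    do not change the determinant. *)
Lemma det3_scale (V : normedModType R) (m : V -> R) (f : V -> space) z v1 v2 :
  smooth_at m z -> smooth_at f z ->
  det3 (scale3 (m z) (f z)) ('D_v1 (fun y => scale3 (m y) (f y)) z)
       ('D_v2 (fun y => scale3 (m y) (f y)) z)
  = m z ^+ 3 * det3 (f z) ('D_v1 f z) ('D_v2 f z).
Proof.
move=> Hm Hf; have Hx := smooth_at_x Hf; have Hy := smooth_at_y Hf.
have Hw := smooth_at_snd Hf.
have HS : smooth_at (fun y => scale3 (m y) (f y)) z.
  by do 2?[apply: smooth_at_pair]; apply: smooth_atM.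
rewrite !(derive_components _ HS) !(derive_components _ Hf) /scale3 /=.
by rewrite !smooth_deriveM // /det3 /=; ring.
Qed.

Context (k : R -> R) (sg ps : R) (A lam chi : R -> R) (N : R).

(** The height [- F] of the flip at the same distance from the axis: with
    [s = z / rho], the value of [- rho * F s]. *)
Definition flip_z (P : space) : R :=
  if rho P == 0 then - P.2
  else - (P.2 + chi (P.2 / rho P) * (rho P * A (ang P) + (lam (ang P) - 1) * P.2)).

(** Azimuths are reflected about [ps]. *)
Definition flip_raw (P : space) : space :=
  (cos (2 * ps) * P.1.1 + sin (2 * ps) * P.1.2,
   sin (2 * ps) * P.1.1 - cos (2 * ps) * P.1.2, flip_z P).

(** The flip changes the height but not the distance to the axis, and is then
    projected back to the sphere along the radius. *)
Definition flip_map (P : space) : space :=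
  scale3 (enorm (flip_raw P))^-1 (flip_raw P).

Context (Hk : profile k sg ps) (HF : flip k sg ps A lam chi N).
Local Notation F := (flip_height A lam chi).

Lemma flip_map_cyl s phi :
  flip_map (cyl s phi) = cyl (- F s phi) (2 * ps - phi).
Proof.
have [ca sa] := ang_cyl s phi.
have AE : A (ang (cyl s phi)) = A phi by exact: periodic_angle (flipA_per HF) _ _.
have lE : lam (ang (cyl s phi)) = lam phi by exact: periodic_angle (flipl_per HF) _ _.
have r0 := sqrt1_gt0 s.
have zE : flip_z (cyl s phi) = - F s phi / Num.sqrt (1 + s ^+ 2).
  rewrite /flip_z gt_eqF ?rho_cyl_gt0 // height_cyl AE lE rho_cyl /flip_height /=.
  by field; rewrite gt_eqF.
have rawE : flip_raw (cyl s phi) =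
    scale3 (Num.sqrt (1 + s ^+ 2))^-1 (cos (2 * ps - phi), sin (2 * ps - phi), - F s phi).
  rewrite /flip_raw zE cosB sinB /scale3 /=; congr (_, _, _); ring.
rewrite /flip_map rawE; set r := Num.sqrt _ in r0 *.
have -> : enorm (scale3 r^-1 (cos (2 * ps - phi), sin (2 * ps - phi), - F s phi))
    = r^-1 * Num.sqrt (1 + (- F s phi) ^+ 2).
  rewrite /enorm /= !exprMn -!mulrDr cos2Dsin2 sqrtrM ?sqr_ge0 // sqrtr_sqr.
  by rewrite ger0_norm // invr_ge0 ltW.
have := sqrt1_gt0 (- F s phi); rewrite /cyl /scale3 /=.
move: (Num.sqrt (1 + (- F s phi) ^+ 2)) => q q0.
by congr (_, _, _); field; rewrite !gt_eqF.
Qed.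

Lemma flip_map_pole b : flip_map (pole b) = pole (~~ b).
Proof.
have rE : flip_raw (pole b) = pole (~~ b).
  rewrite /flip_raw /flip_z pole_rho eqxx /pole /= !mulr0 addr0 subr0.
  by case: b => /=; rewrite ?expr0 ?expr1 ?opprK.
rewrite /flip_map rE (_ : enorm (pole (~~ b)) = 1).
  by rewrite invr1 /scale3 /= !mul1r.
by rewrite /enorm; have := sphere_pole (~~ b); rewrite /sphere /= => ->; rewrite sqrtr1.
Qed.

Lemma flip_map_sphere P : sphere P -> sphere (flip_map P).
Proof.
move=> /sphereP[[b ->]|[s [phi ->]]]; first by rewrite flip_map_pole; exact: sphere_pole.
by rewrite flip_map_cyl; exact: sphere_cyl.
Qed.

Lemma flip_height_derive (s phi : R) : is_derive s 1 (F ^~ phi)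
  (1 + chi s * (lam phi - 1) + 'D_1 chi s * (A phi + (lam phi - 1) * s)).
Proof.
have Dc : is_derive s 1 chi ('D_1 chi s).
  by apply/derivableP/smooth_at_derivable/smooth_at_of/(flipc_smooth HF).
have Dl := is_derive_affine (lam phi - 1) (A phi) s.
have H := is_deriveD (is_derive_id s (1 : R)) (is_deriveM Dc Dl).
have -> : F ^~ phi = id + (chi * (fun t => (lam phi - 1) * t + A phi)).
  apply/funext => t; rewrite /flip_height. by rewrite [A phi + _]addrC.
by apply: (is_derive_eq H); rewrite /GRing.scale /=; ring.
Qed.

Lemma flip_height_lt phi s s' : s < s' -> F s phi < F s' phi.
Proof.
move=> ss'; apply: (@gtr0_derive1_incr R (F ^~ phi) s s'); rewrite ?lexx //.
- by move=> x _; have := flip_height_derive x phi; move=> H; exact: ex_derive.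
- move=> x _; rewrite derive1E; have [_ ->] := flip_height_derive x phi.
  exact: flip_slope HF _ _.
- apply: continuous_subspaceT => x; apply: differentiable_continuous.
  by apply/derivable1_diffP; have := flip_height_derive x phi; move=> H; exact: ex_derive.
Qed.

Lemma flip_height_inj phi : injective (F ^~ phi).
Proof.
move=> s s' E; apply/eqP; rewrite eq_le !leNgt.
by apply/andP; split; apply/negP => /(flip_height_lt phi); rewrite E ltxx.
Qed.

(** The flip takes meridians to meridians, monotonically on each. *)
Lemma flip_map_inj P Q : sphere P -> sphere Q -> flip_map P = flip_map Q -> P = Q.
Proof.
move=> /sphereP[[b ->]|[s [phi ->]]] /sphereP[[c ->]|[s' [phi' ->]]];
  rewrite ?flip_map_pole ?flip_map_cyl.
- by move=> /poles_neq/(congr1 negb); rewrite !negbK => ->.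
- by move=> /esym /cyl_not_pole.
- by move=> /cyl_not_pole.
move=> /cyl_inj[/oppr_inj EF Ec Es].
have [n E] := angle_eq Ec Es.
have Ec' : cos phi = cos phi'.
  have -> : phi' = phi + 2 * pi * n%:~R by lra.
  by rewrite cosD2pi_int.
have Es' : sin phi = sin phi'.
  have -> : phi' = phi + 2 * pi * n%:~R by lra.
  by rewrite sinD2pi_int.
have AE := periodic_angle (flipA_per HF) Ec' Es'.
have lE := periodic_angle (flipl_per HF) Ec' Es'.
have -> : s = s'.
  by apply: (@flip_height_inj phi); rewrite /= EF /flip_height AE lE.
by rewrite /cyl Ec' Es'.
Qed.

Section Composition.
Context {V : normedModType R} (f : V -> space) (z : V).
Hypothesis Hf : smooth_at f z.

Let Hx := smooth_at_x Hf.
Let Hy := smooth_at_y Hf.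
Let Hw := smooth_at_snd Hf.

Lemma flip_z_near : rho (f z) != 0 -> \forall y \near z, flip_z (f y) =
  - ((f y).2 + chi ((f y).2 / rho (f y)) *
     (rho (f y) * A (ang (f y)) + (lam (ang (f y)) - 1) * (f y).2)).
Proof.
move=> r0; have Hr := smooth_at_continuous (rho_smooth_at r0 Hf).
have r1 : 0 < rho (f z) by rewrite lt_neqAle eq_sym r0 rho_ge0.
move: Hr => /cvgr_gt /(_ 0 r1).
by apply: filterS => y ry; rewrite /flip_z gt_eqF.
Qed.

(** Near a pole the height over the distance to the axis is large, where the
    cutoff vanishes. *)
Lemma flip_z_near_pole b : f z = pole b ->
  \forall y \near z, flip_z (f y) = - (f y).2.
Proof.
move=> fz.
have Hr : smooth_at (fun y => (f y).1.1 ^+ 2 + (f y).1.2 ^+ 2) z.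
  by apply: smooth_atD; exact: smooth_at_sqr.
have H2 : smooth_at (fun y => (f y).2 ^+ 2) z by exact: smooth_at_sqr.
have w2 : (f z).2 ^+ 2 = 1.
  by rewrite fz; case: (b); rewrite /= ?expr0 ?expr1 ?sqrrN expr1n.
have r2 : (f z).1.1 ^+ 2 + (f z).1.2 ^+ 2 = 0 by rewrite fz /= !expr0n addr0.
have H1 : \forall y \near z, 2^-1 < (f y).2 ^+ 2.
  by move: (smooth_at_continuous H2) => /cvgr_gt; apply; rewrite w2; lra.
pose M := 2 * (N ^+ 2 + 1).
have M0 : 0 < M by rewrite /M mulr_gt0 // ltr_pwDr // sqr_ge0.
have H3 : \forall y \near z, (f y).1.1 ^+ 2 + (f y).1.2 ^+ 2 < M^-1.
  by move: (smooth_at_continuous Hr) => /cvgr_lt; apply; rewrite r2 invr_gt0.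
apply: filterS2 H1 H3 => y Y1; rewrite -sqr_rho => Y3; rewrite /flip_z.
case: eqVneq => // ry; have r0 : 0 < rho (f y) by rewrite lt_neqAle eq_sym ry rho_ge0.
rewrite (flipc0 HF) ?mul0r ?addr0 //.
have M1 : rho (f y) ^+ 2 * M < 1 by rewrite -ltr_pdivlMr // mul1r.
rewrite normrM normfV (gtr0_norm r0) ltr_pdivlMr //.
have [N0|N0] := ltP N 0.
  by apply: (@lt_le_trans _ _ 0); rewrite ?normr_ge0 // pmulr_llt0.
rewrite -ltr_sqr ?nnegrE ?normr_ge0 ?mulr_ge0 ?rho_ge0 // real_normK ?num_real //.
apply: lt_trans Y1; rewrite exprMn; move: M1; rewrite /M; nra.
Qed.

Lemma flip_z_smooth_at : sphere (f z) -> smooth_at (fun y => flip_z (f y)) z.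
Proof.
move=> Sf; have [r0|r0] := eqVneq (rho (f z)) 0.
  have [[b fz]|[s [phi fz]]] := sphereP Sf; last first.
    by move: r0; rewrite fz => /eqP; rewrite gt_eqF ?rho_cyl_gt0.
  apply: smooth_at_eq (smooth_atN Hw).
  by apply: filterS (flip_z_near_pole fz) => y ->.
have Hr := rho_smooth_at r0 Hf.
have HA := ang_smooth_at (flipA_smooth HF) (flipA_per HF) r0 Hf.
have Hl := ang_smooth_at (flipl_smooth HF) (flipl_per HF) r0 Hf.
have H : smooth_at (fun y => - ((f y).2 + chi ((f y).2 / rho (f y)) *
    (rho (f y) * A (ang (f y)) + (lam (ang (f y)) - 1) * (f y).2))) z.
  apply: smooth_atN; apply: smooth_atD => //; apply: smooth_atM.
    apply: smooth_at_comp; first exact/smooth_at_of/(flipc_smooth HF).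
    by apply: smooth_atM => //; exact: smooth_atV.
  apply: smooth_atD; first exact: smooth_atM.
  by apply: smooth_atM => //; apply: smooth_atB => //; exact: smooth_at_cst.
by apply: smooth_at_eq H; apply: filterS (flip_z_near r0) => y ->.
Qed.

Lemma flip_raw_smooth_at : sphere (f z) -> smooth_at (fun y => flip_raw (f y)) z.
Proof.
move=> Sf; apply: smooth_at_pair; last exact: flip_z_smooth_at.
apply: smooth_at_pair.
  by apply: smooth_atD; apply: smooth_atM => //; exact: smooth_at_cst.
by apply: smooth_atB; apply: smooth_atM => //; exact: smooth_at_cst.
Qed.

Lemma flip_raw_xy P :
  (flip_raw P).1.1 ^+ 2 + (flip_raw P).1.2 ^+ 2 = rho P ^+ 2.
Proof.
rewrite sqr_rho -[RHS]mul1r -(cos2Dsin2 (2 * ps)) /=; ring.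
Qed.

Lemma enorm_flip_raw_gt0 P : sphere P -> 0 < enorm (flip_raw P).
Proof.
move=> SP; rewrite sqrtr_gt0 flip_raw_xy.
have [r0|r0] := eqVneq (rho P) 0; last first.
  by rewrite ltr_pwDl ?sqr_ge0 // exprn_even_gt0.
rewrite /flip_raw /= /flip_z r0 eqxx; move: SP; rewrite /sphere /= -sqr_rho r0.
by rewrite sqrrN => ->.
Qed.

Lemma enorm_flip_raw_smooth_at : sphere (f z) ->
  smooth_at (fun y => (enorm (flip_raw (f y)))^-1) z.
Proof.
move=> Sf; have H := flip_raw_smooth_at Sf; have n0 := enorm_flip_raw_gt0 Sf.
apply: smooth_atV; first by rewrite gt_eqF.
apply: smooth_at_comp; first by apply: smooth_at_sqrt; rewrite -sqrtr_gt0.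
apply: smooth_atD; last by apply: smooth_at_sqr; exact: smooth_at_snd.
by apply: smooth_atD; apply: smooth_at_sqr; [exact: smooth_at_x|exact: smooth_at_y].
Qed.

Lemma flip_map_smooth_at : sphere (f z) -> smooth_at (fun y => flip_map (f y)) z.
Proof.
move=> Sf; have H := flip_raw_smooth_at Sf; have Hn := enorm_flip_raw_smooth_at Sf.
by do 2?[apply: smooth_at_pair]; apply: smooth_atM => //;
  [exact: smooth_at_x H|exact: smooth_at_y H|exact: smooth_at_snd H].
Qed.

(** The differential of the third coordinate; the relation satisfied by its
    coefficients is Euler's identity for a homogeneous function. *)
Lemma flip_z_derive : rho (f z) != 0 -> exists a b c : R,
  [/\ c < 0, a * (f z).1.1 + b * (f z).1.2 + c * (f z).2 = flip_z (f z)
    & forall v, 'D_v (fun y => flip_z (f y)) z =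
        a * 'D_v (fun y => (f y).1.1) z + b * 'D_v (fun y => (f y).1.2) z
        + c * 'D_v (fun y => (f y).2) z].
Proof.
move=> r0; have Hr := rho_smooth_at r0 Hf.
have HA := ang_smooth_at (flipA_smooth HF) (flipA_per HF) r0 Hf.
have Hl := ang_smooth_at (flipl_smooth HF) (flipl_per HF) r0 Hf.
have sl := flip_slope HF ((f z).2 / rho (f z)) (ang (f z)).
have Hs : smooth_at (fun y => (f y).2 / rho (f y)) z.
  by apply: smooth_atM => //; exact: smooth_atV.
have Hc : smooth_at (fun y => chi ((f y).2 / rho (f y))) z.
  by apply: smooth_at_comp => //; exact/smooth_at_of/(flipc_smooth HF).
have Hl1 : smooth_at (fun y => lam (ang (f y)) - 1) z.
  by apply: smooth_atB => //; exact: smooth_at_cst.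
have Hrest : smooth_at (fun y =>
    rho (f y) * A (ang (f y)) + (lam (ang (f y)) - 1) * (f y).2) z.
  by apply: smooth_atD; exact: smooth_atM.
have Er := sqr_rho (f z).
have DE v := near_eq_derive v (flip_z_near r0).
have zE := nbhs_singleton (flip_z_near r0).
pose s := (f z).2 / rho (f z).
pose a0 := A (ang (f z)); pose l0 := lam (ang (f z)) - 1.
pose a1 := 'D_1 A (ang (f z)); pose l1 := 'D_1 lam (ang (f z)).
pose c0 := chi s; pose c1 := 'D_1 chi s.
pose r := rho (f z); pose x := (f z).1.1; pose y := (f z).1.2; pose w := (f z).2.
exists (- (c1 * (- w * x / r ^+ 3) * (r * a0 + l0 * w)
           + c0 * (a0 * x / r - a1 * y / r - w * l1 * y / r ^+ 2))).
exists (- (c1 * (- w * y / r ^+ 3) * (r * a0 + l0 * w)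
           + c0 * (a0 * y / r + a1 * x / r + w * l1 * x / r ^+ 2))).
exists (- (1 + c0 * l0 + c1 * (a0 + l0 * s))); split.
- by rewrite oppr_lt0.
- rewrite zE -/r -/x -/y -/w -/s -/a0 -/l0 -/c0.
  have E2 : x ^+ 2 + y ^+ 2 = r ^+ 2 by rewrite Er.
  transitivity (- (c1 * (- w * (x ^+ 2 + y ^+ 2) / r ^+ 3) * (r * a0 + l0 * w)
    + c0 * (a0 * (x ^+ 2 + y ^+ 2) / r)) - (1 + c0 * l0 + c1 * (a0 + l0 * s)) * w).
    by rewrite -/x -/y -/w /r; field.
  by rewrite E2 /s -/w -/r; field.
move=> v; rewrite DE.
have E1 : 'D_v (fun y : V => - ((f y).2 + chi ((f y).2 / rho (f y)) *
     (rho (f y) * A (ang (f y)) + (lam (ang (f y)) - 1) * (f y).2))) z =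
  - 'D_v (fun y : V => ((f y).2 + chi ((f y).2 / rho (f y)) *
     (rho (f y) * A (ang (f y)) + (lam (ang (f y)) - 1) * (f y).2))) z.
  by rewrite deriveN //; apply: smooth_at_derivable; apply: smooth_atD => //; exact: smooth_atM.
have Ds : 'D_v (fun y => (f y).2 / rho (f y)) z
    = w * (- 'D_v (fun y => rho (f y)) z / r ^+ 2) + r^-1 * 'D_v (fun y => (f y).2) z.
  by rewrite smooth_deriveM ?smooth_deriveV //; exact: smooth_atV.
have DrA := smooth_deriveM v Hr HA.
have Dl : 'D_v (fun y => (lam (ang (f y)) - 1) * (f y).2) z
    = l0 * 'D_v (fun y => (f y).2) z + w * 'D_v (fun y => lam (ang (f y))) z.
  rewrite smooth_deriveM // smooth_deriveB //; last exact: smooth_at_cst.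
  by rewrite derive_cst subr0.
rewrite E1 smooth_deriveD //; last exact: smooth_atM.
rewrite [in X in - (_ + X)]smooth_deriveM // smooth_deriveD; try exact: smooth_atM.
rewrite (smooth_derive_comp (phi := chi)) //; last exact/smooth_at_of/(flipc_smooth HF).
rewrite Dl Ds DrA.
rewrite !(rho_derive, ang_derive) //;
  try exact: (flipl_smooth HF); try exact: (flipA_smooth HF);
  try exact: (flipl_per HF); try exact: (flipA_per HF).
rewrite -/s -/a0 -/l0 -/c0 -/a1 -/l1 -/c1 -/r -/x -/y -/w.
by rewrite /s -/w -/r; field.
Qed.

(** The projection to the sphere does not matter for the sign. Before it, the
    horizontal part is a reflection and the height decreases, so that the
    orientation is preserved. *)
Lemma flip_map_immersed v1 v2 : sphere (f z) -> rho (f z) != 0 ->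
  0 < det3 (f z) ('D_v1 f z) ('D_v2 f z) ->
  0 < det3 (flip_map (f z)) ('D_v1 (fun y => flip_map (f y)) z)
           ('D_v2 (fun y => flip_map (f y)) z).
Proof.
move=> Sf r0 H; have n0 := enorm_flip_raw_gt0 Sf.
rewrite (det3_scale v1 v2 (enorm_flip_raw_smooth_at Sf) (flip_raw_smooth_at Sf)).
apply: mulr_gt0; first by rewrite exprn_gt0 // invr_gt0.
have [a [b [c [c0 Euler Dz]]]] := flip_z_derive r0.
have DE v : 'D_v (fun y => flip_raw (f y)) z =
   (cos (2 * ps) * ('D_v f z).1.1 + sin (2 * ps) * ('D_v f z).1.2,
    sin (2 * ps) * ('D_v f z).1.1 - cos (2 * ps) * ('D_v f z).1.2,
    a * ('D_v f z).1.1 + b * ('D_v f z).1.2 + c * ('D_v f z).2).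
  have Sr := flip_raw_smooth_at Sf.
  rewrite derive_components // [in LHS]/flip_raw /=.
  rewrite smooth_deriveD ?smooth_deriveB; try (by apply: smooth_atM => //; exact: smooth_at_cst).
  rewrite !smooth_deriveZ // Dz [in RHS]derive_components //.
rewrite !DE /flip_raw -Euler.
move: H; move: ('D_v1 f z) ('D_v2 f z) (f z) => [[x1 y1] w1] [[x2 y2] w2] [[x y] w].
rewrite /det3 /= => H.
have C := cos2Dsin2 (2 * ps); move: (cos (2 * ps)) (sin (2 * ps)) C => p q C.
suff E : forall X, X = - c * (p ^+ 2 + q ^+ 2) * (x * (y1 * w2 - w1 * y2) - y * (x1 * w2 - w1 * x2) +
     w * (x1 * y2 - y1 * x2)) -> 0 < X.
  by apply: E; ring.
by move=> _ ->; rewrite C mulr1 mulr_gt0 // oppr_gt0.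
Qed.

End Composition.

End FlipMap.

(** * The special front *)

(** With one horizontal and one vertical segment, the basepoints lie at
    [(b0, b0)], [(b1, b1 - T)] and [(b0 + T, b0 - T)], where [T] is the period;
    the slopes of the two segments are inverse to each other. *)
Record two_segments {R : realType} (P : R) (g : R -> R)
    (s0 b0 l0 h0 b1 l1 h1 : R) : Prop := TwoSegments {
  ts_P : 0 < P;
  ts_slope : -1 < s0 < 0;
  ts_smooth : forall t, smooth_at g t;
  ts_per : forall t, g (t + 2 * pi / P) = g t - 2 * pi / P;
  ts_order0 : l0 < b0 < h0;
  ts_order1 : l1 < b1 < h1;
  ts_order : h0 < l1 /\ h1 < l0 + 2 * pi / P;
  ts_small0 : P * (1 - s0^-1) * (b0 - l0) < 1 /\ P * (1 - s0^-1) * (h0 - b0) < 1;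
  ts_small1 : P * (1 - s0^-1) * (b1 - l1) < 1 /\ P * (1 - s0^-1) * (h1 - b1) < 1;
  ts_line0 : forall t, h0 <= t <= l1 -> g t = b0 + s0 * (t - b0);
  ts_line1 : forall t, h1 <= t <= l0 + 2 * pi / P ->
    g t = b1 - 2 * pi / P + s0^-1 * (t - b1);
  ts_turn : b1 - 2 * pi / P = b0 + s0 * (b1 - b0);
  ts_turn1 : b0 - 2 * pi / P
             = b1 - 2 * pi / P + s0^-1 * (b0 + 2 * pi / P - b1);
  ts_convex : forall t, l0 < t < h0 -> 0 < derive1n 2 g t;
  ts_concave : forall t, l1 < t < h1 -> derive1n 2 g t < 0
}.

Lemma vertical_length1 (p : nat) : (3 <= p)%N -> vertical_length p (p - 1) 1 = 1%N.
Proof.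
case: p => [|[|[|p]]] // _; rewrite /vertical_length /=.
by rewrite subn1 /= mul1n add1n dvdnn.
Qed.

(** If [e] is the slide of the first basepoint minus that of the second, then
    the first segment has sides [T - e] and [e], and the second one has sides
    [e] and [T - e]. *)
Lemma special_front_two_segments (R : realType) (p : nat) : (3 <= p)%N ->
  exists2 eps : R, 0 < eps & forall d, small_slides p (p - 1) 1 eps d ->
  exists2 delta : R, 0 < delta & forall g, special_front p (p - 1) 1 d delta g ->
  exists s0 b0 l0 h0 b1 l1 h1, two_segments p%:R g s0 b0 l0 h0 b1 l1 h1.
Proof.
move=> p3; have P0 : 0 < p%:R :> R by rewrite ltr0n; case: (p) p3.
have pi0 := pi_gt0 R; pose T : R := 2 * pi / p%:R.
have pi3 : 3 * pi / p%:R = 3 * (pi / p%:R) :> R by rewrite mulrA.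
have T0 : 0 < T by rewrite divr_gt0 // mulr_gt0.
exists (T / 4); first by rewrite divr_gt0.
move=> d; rewrite /small_slides vertical_length1 // add1n => -[d20 dsmall slope0 _].
have := slope0 0%N isT; have := dsmall 0%N; have := dsmall 1%N.
rewrite /segment_slope /basepoint !min0n !minnn !subnn !sub0n.
pose b0 : R := pi / p%:R + d 0%N; pose b1 : R := 3 * pi / p%:R + d 1%N.
pose e := d 0%N - d 1%N.
rewrite !ltr_norml => /andP[d1l d1r] /andP[d0l d0r] /=.
pose s0 := - e / (T - e).
have TE : pi / p%:R = T / 2 by rewrite /T; field; rewrite gt_eqF.
have -> : pi / p%:R * (1 - 2 * 0%:R) + d 1%N - (pi / p%:R * (1 - 2 * 0%:R) + d 0%N) = - e.
  by rewrite /e; ring.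
have -> : pi / p%:R * (1 + 2 * 1%:R) + d 1%N - (pi / p%:R * (1 + 2 * 0%:R) + d 0%N) = T - e.
  by rewrite TE /e; field.
have Te : 0 < T - e by rewrite /e; lra.
rewrite ltr_pdivrMr // mul0r oppr_lt0 => e0.
have Te2 : 2 * e < T by rewrite /e; lra.
have s00 : s0 < 0 by rewrite /s0 ltr_pdivrMr // mul0r oppr_lt0.
have s01 : -1 < s0 by rewrite /s0 ltr_pdivlMr //; lra.
have sV : s0^-1 = - (T - e) / e by rewrite /s0; field; rewrite !gt_eqF.
have sV0 : s0^-1 < 0 by rewrite invr_lt0.
(* The azimuth has slope at most [p * (1 - s0^-1)], so that it varies by less
   than 1 over the smoothing neighborhoods. *)
pose delta := (p%:R * (1 - s0^-1))^-1.
have D0 : 0 < p%:R * (1 - s0^-1) by rewrite mulr_gt0 //; lra.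
exists delta; first by rewrite invr_gt0.
move=> g [lo [hi]]; rewrite /special_front vertical_length1 // !add1n.
have perE : period p 1 = T :> R by rewrite /period /T mulr1.
rewrite perE => -[[bd lohi lo2 hi2] [gs gper] lines conv conc].
have bp0 : basepoint p 1 d 0 = (b0, b0).
  by rewrite /basepoint min0n sub0n /b0 /=; congr (_, _); ring.
have bp1 : basepoint p 1 d 1 = (b1, b1 - T).
  rewrite /basepoint minnn subnn /b1 /=; congr (_, _).
    by field; rewrite gt_eqF.
  by rewrite pi3 TE; field.
have bp2 : basepoint p 1 d 2 = (b0 + T, b0 - T).
  rewrite /basepoint (_ : minn 2 1 = 1)%N // (_ : 2 - 1 = 1)%N // /b0 /=.
  by rewrite TE d20; congr (_, _); field.
have b01 : b1 - b0 = T - e.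
  by rewrite /b0 /b1 /e pi3 TE; field.
have sl0 : segment_slope p 1 d 0 = s0.
  by rewrite /segment_slope bp0 bp1 /= /s0 -b01; congr (_ / _); lra.
have sl1 : segment_slope p 1 d 1 = s0^-1.
  by rewrite /segment_slope bp2 bp1 /= sV; congr (_ / _); lra.
have [/andP[A1 A2] /andP[A3 A4]] := bd 0%N isT.
have [/andP[B1 B2] /andP[B3 B4]] := bd 1%N isT.
have L0 := lohi 0%N isT; have L1 := lohi 1%N isT.
rewrite bp0 /= in A1 A2 A3 A4; rewrite bp1 /= in B1 B2 B3 B4.
have dl x : x < delta -> p%:R * (1 - s0^-1) * x < 1.
  by rewrite /delta => H; rewrite mulrC -ltr_pdivlMr // mul1r.
exists s0, b0, (lo 0%N), (hi 0%N), b1, (lo 1%N), (hi 1%N); rewrite -/T.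
split; rewrite -/T //.
- by rewrite s01.
- by move=> t; rewrite gper mulr1.
- by rewrite A2.
- by rewrite B2.
- by rewrite -lo2; split.
- by split; apply: dl; lra.
- by split; apply: dl; lra.
- by move=> t /(lines 0%N t isT); rewrite bp0 sl0.
- by move=> t; rewrite -lo2 => /(lines 1%N t isT); rewrite bp1 sl1.
- by rewrite b01 /s0; have : e = d 0%N - d 1%N by []; move: b01 => b01 _; rewrite divfK ?gt_eqF //; lra.
- rewrite (_ : b0 + T - b1 = e); last by lra.
  by rewrite sV divfK ?gt_eqF //; lra.
- by move=> t H; exact: (conc 1%N t isT H).
Qed.

(** The height [s] of the point of latitude [u] is a function of the slope
    [y = - u / (1 - u)] of the front. *)
Definition slope_height {R : realType} (y : R) : R := (1 + y) / (2 * Num.sqrt (- y)).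

Section SlopeHeight.
Context {R : realType}.

(** Exchanging the two angles exchanges the hemispheres. *)
Lemma slope_heightV (y : R) : y < 0 -> slope_height y^-1 = - slope_height y.
Proof.
move=> y0; rewrite /slope_height -invrN sqrtrV ?oppr_ge0 ?ltW //.
have r0 : 0 < Num.sqrt (- y) by rewrite sqrtr_gt0 oppr_gt0.
have E : y = - Num.sqrt (- y) ^+ 2 by rewrite sqr_sqrtr ?opprK // oppr_ge0 ltW.
move: (Num.sqrt _) r0 E => r r0 ->; field.
by rewrite gt_eqF.
Qed.

Lemma slope_height_lat (y : R) : y < 0 -> lat (slope_height y) = - y / (1 - y).
Proof.
move=> y0; rewrite /slope_height /lat.
have r0 : 0 < Num.sqrt (- y) by rewrite sqrtr_gt0 oppr_gt0.
have E : y = - Num.sqrt (- y) ^+ 2 by rewrite sqr_sqrtr ?opprK // oppr_ge0 ltW.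
move: (Num.sqrt (- y)) r0 E => r r0 ->.
have -> : 1 + ((1 + - r ^+ 2) / (2 * r)) ^+ 2 = ((1 + r ^+ 2) / (2 * r)) ^+ 2.
  by field; rewrite gt_eqF.
have r1 : 0 < 1 + r ^+ 2 by rewrite ltr_pwDl // sqr_ge0.
rewrite sqrtr_sqr ger0_norm; last by rewrite divr_ge0 ?ltW // mulr_gt0.
by field; rewrite !gt_eqF //; lra.
Qed.

Lemma slope_height_smooth_at (y : R) : y < 0 -> smooth_at slope_height y.
Proof.
move=> y0; have Hs : smooth_at (fun y : R => Num.sqrt (- y)) y.
  apply: smooth_at_comp; first by apply: smooth_at_sqrt; rewrite oppr_gt0.
  by apply: smooth_atN; exact: smooth_at_id.
apply: smooth_atM.
  by apply: smooth_atD; [exact: smooth_at_cst|exact: smooth_at_id].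
apply: smooth_atV; last by apply: smooth_atM => //; exact: smooth_at_cst.
by rewrite mulf_neq0 // gt_eqF // sqrtr_gt0 oppr_gt0.
Qed.

Lemma slope_height_derive (y : R) : y < 0 -> 0 < 'D_1 slope_height y.
Proof.
move=> y0; have Hs : smooth_at (fun y : R => Num.sqrt (- y)) y.
  apply: smooth_at_comp; first by apply: smooth_at_sqrt; rewrite oppr_gt0.
  by apply: smooth_atN; exact: smooth_at_id.
have Hs2 : smooth_at (fun y : R => 2 * Num.sqrt (- y)) y.
  by apply: smooth_atM => //; exact: smooth_at_cst.
have Hn : smooth_at (fun y : R => 1 + y) y.
  by apply: smooth_atD; [exact: smooth_at_cst|exact: smooth_at_id].
have r0 : 0 < Num.sqrt (- y) by rewrite sqrtr_gt0 oppr_gt0.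
have n0 : 2 * Num.sqrt (- y) != 0 by rewrite mulf_neq0 // gt_eqF.
rewrite /slope_height smooth_deriveM //; last exact: smooth_atV.
rewrite smooth_deriveV // smooth_deriveZ // smooth_deriveD;
  [|exact: smooth_at_cst|exact: smooth_at_id].
rewrite derive_cst derive_id add0r mulr1.
have -> : 'D_1 (fun y : R => Num.sqrt (- y)) y = - (2 * Num.sqrt (- y))^-1.
  have y1 : 0 < - y by rewrite oppr_gt0.
  have D : is_derive y 1 (fun y : R => - y) (-1).
    by have := is_deriveN (is_derive_id y (1 : R)).
  have [_ ->] := @is_derive1_comp R (@Num.sqrt R) (fun y => - y) y _ _ (is_derive1_sqrt y1) D.
  by rewrite mulrN1.
have E : y = - Num.sqrt (- y) ^+ 2 by rewrite sqr_sqrtr ?opprK // oppr_ge0 ltW.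
move: (Num.sqrt (- y)) r0 n0 E => r r0 _ ->.
rewrite (_ : _ + _ = (1 + r ^+ 2) / (4 * r ^+ 3)); last by field; rewrite gt_eqF.
by rewrite divr_gt0 ?mulr_gt0 ?exprn_gt0 // ltr_pwDl // sqr_ge0.
Qed.

Lemma slope_height_lt (y y' : R) : y < y' -> y' < 0 ->
  slope_height y < slope_height y'.
Proof.
move=> yy' y0; rewrite -lat_lt !slope_height_lat //; last exact: lt_trans yy' y0.
by rewrite ltr_pdivrMr 1?mulrAC 1?ltr_pdivlMr; lra.
Qed.

End SlopeHeight.

Section ProfileOfFront.
Context {R : realType} (P : R) (g : R -> R) (s0 b0 l0 h0 b1 l1 h1 : R).
Hypothesis TS : two_segments P g s0 b0 l0 h0 b1 l1 h1.

Let T : R := 2 * pi / P.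
Let az (t : R) := P * (t - g t).

Let P0 : 0 < P. Proof. exact: ts_P TS. Qed.
Let PT : P * T = 2 * pi. Proof. by rewrite /T mulrC divfK // gt_eqF. Qed.
Let T0 : 0 < T. Proof. by rewrite divr_gt0 // mulr_gt0 // pi_gt0. Qed.

Lemma affine_slope (f : R -> R) (a b c m : R) : a < b ->
  (forall t, smooth_at f t) ->
  (forall t, a <= t <= b -> f t = c + m * t) ->
  forall t, a <= t <= b -> derive1 f t = m.
Proof.
move=> ab sf line.
have int t : a < t < b -> derive1 f t = m.
  move=> tab; have D : is_derive t 1 (fun t : R => m * t + c) m.
    exact: is_derive_affine.
  have [_ <-] := D; rewrite derive1E; apply: near_eq_derive.
  have : \forall y \near t, y \in `]a, b[ by exact: near_in_itvoo.
  by apply: filterS => y; rewrite in_itv /= => /andP[/ltW ya /ltW yb]; rewrite line ?ya // addrC.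
have cf : continuous (fun t => derive1 f t - m).
  move=> t; apply: smooth_at_continuous.
  have H : smooth_at (fun t => 'D_1 f t - m) t.
    by apply: smooth_atB; [exact: smooth_at_derive|exact: smooth_at_cst].
  by apply: smooth_at_eq H; near=> y; rewrite derive1E.
move=> t /andP[ta tb]; apply/eqP; rewrite -subr_eq0; apply/negPn/negP => n0.
(* A nonzero difference would persist at interior points. *)
have /nbhs_ballP[e /= e0 He] : \forall y \near t, derive1 f y - m != 0.
  exact: cvgr_neq0 (cf t) n0.
have [r [r0 re rb]] : exists r, [/\ 0 < r, r < e & r <= (b - a) / 4].
  exists (Num.min (e / 2) ((b - a) / 4)); split.
  - by rewrite lt_min !divr_gt0 // subr_gt0.
  - by rewrite gt_min; apply/orP; left; lra.
  - by rewrite ge_min lexx orbT.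
have [y /andP[yab yt]] : exists y, (a < y < b) && (`|t - y| < e).
  have [tm|tm] := leP t ((a + b) / 2); [exists (t + r)|exists (t - r)];
    apply/andP; split; try by apply/andP; split; lra.
    by rewrite (_ : t - (t + r) = - r) ?normrN ?gtr0_norm //; ring.
  by rewrite (_ : t - (t - r) = r) ?gtr0_norm //; ring.
by have := He y yt; rewrite int // subrr eqxx.
Unshelve. all: by end_near. Qed.

Let gs t : smooth_at g t. Proof. exact: ts_smooth TS t. Qed.

Lemma front_smooth_derive t : smooth_at (derive1 g) t.
Proof.
have H : smooth_at ('D_1 g) t by exact: smooth_at_derive.
by apply: smooth_at_eq H; near=> y; rewrite derive1E.
Unshelve. all: by end_near. Qed.

Lemma front_slope_per t : derive1 g (t + T) = derive1 g t.
Proof.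
rewrite !derive1E.
have := smooth_derive_comp (phi := g) (f := fun t : R => 1 * t + T) (z := t) 1.
rewrite mul1r => /(_ (gs _)) H.
have D := is_derive_affine 1 T t.
have {}H : 'D_1 (fun t : R => g (1 * t + T)) t = 'D_1 g (t + T).
  rewrite H; first by have [_ ->] := D; rewrite mulr1.
  apply: smooth_atD; last exact: smooth_at_cst.
  by apply: smooth_atM; [exact: smooth_at_cst|exact: smooth_at_id].
rewrite -H (_ : (fun t : R => g (1 * t + T)) = (fun t => g t - T)); last first.
  by apply/funext => x; rewrite mul1r (ts_per TS).
by rewrite smooth_deriveB ?derive_cst ?subr0 //; exact: smooth_at_cst.
Qed.

Let s00 : s0 < 0. Proof. by have /andP[] := ts_slope TS. Qed.
Let s01 : -1 < s0. Proof. by have /andP[] := ts_slope TS. Qed.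
Let sV0 : s0^-1 < 0. Proof. by rewrite invr_lt0. Qed.
Let sV1 : s0^-1 < -1.
Proof. by rewrite -ltrN2 opprK -invrN invf_gt1 ?oppr_gt0 // ltrNl. Qed.

Lemma front_slope0 t : h0 <= t <= l1 -> derive1 g t = s0.
Proof.
apply: (@affine_slope g h0 l1 (b0 - s0 * b0)) => //; first by have [] := ts_order TS.
by move=> x /(ts_line0 TS) ->; ring.
Qed.

Lemma front_slope1 t : h1 <= t <= l0 + T -> derive1 g t = s0^-1.
Proof.
apply: (@affine_slope g h1 (l0 + T) (b1 - T - s0^-1 * b1)) => //.
  by have [] := ts_order TS.
by move=> x /(ts_line1 TS) ->; rewrite -/T; ring.
Qed.

Let o0 : l0 < b0 < h0. Proof. exact: ts_order0 TS. Qed.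
Let o1 : l1 < b1 < h1. Proof. exact: ts_order1 TS. Qed.
Let o2 : h0 < l1. Proof. by have [] := ts_order TS. Qed.
Let o3 : h1 < l0 + T. Proof. by have [] := ts_order TS. Qed.

Let g1_l0 : derive1 g l0 = s0^-1.
Proof.
by rewrite -front_slope_per front_slope1 // lexx andbT ltW // o3.
Qed.

Let front_slope_continuous : continuous (derive1 g).
Proof. by move=> t; exact/smooth_at_continuous/front_smooth_derive. Qed.

Lemma front_slope_incr x y : l0 <= x -> x < y -> y <= h0 ->
  derive1 g x < derive1 g y.
Proof.
apply: gtr0_derive1_incr => [t _|t|].
- exact/smooth_at_derivable/front_smooth_derive.
- by rewrite in_itv /= => /(ts_convex TS).
- exact: continuous_subspaceT front_slope_continuous.
Qed.

Lemma front_slope_decr x y : l1 <= x -> x < y -> y <= h1 ->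
  derive1 g y < derive1 g x.
Proof.
apply: ltr0_derive1_decr => [t _|t|].
- exact/smooth_at_derivable/front_smooth_derive.
- by rewrite in_itv /= => /(ts_concave TS).
- exact: continuous_subspaceT front_slope_continuous.
Qed.

(** The slope is constant on the segments and monotone in between. *)
Lemma front_slope_bounds t : s0^-1 <= derive1 g t <= s0.
Proof.
have /andP[A1 A2] := o0; have /andP[A3 A4] := o1; have A5 := o2; have A6 := o3.
have B1 := s00; have B2 := sV1; have B3 := s01.
move: t; apply: (@shift_ind R T l0) => [|t|t /andP[tl tr]]; first exact: T0.
  by rewrite front_slope_per.
have [th|th] := ltP t h0.
  have E : derive1 g h0 = s0 by rewrite front_slope0 // lexx ltW.
  have U := front_slope_incr tl th (lexx _); rewrite E in U.
  rewrite (ltW U) andbT; move: tl; rewrite le_eqVlt => /predU1P[<-|tl].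
    by rewrite g1_l0.
  by rewrite -g1_l0 ltW // front_slope_incr // ltW.
have [tl1|tl1] := leP t l1.
  by rewrite front_slope0 ?th // lexx andbT ltW // (lt_trans B2).
have [th1|th1] := ltP t h1.
  have E : derive1 g h1 = s0^-1 by rewrite front_slope1 // lexx ltW.
  have E1 : derive1 g l1 = s0 by rewrite front_slope0 // lexx andbT ltW.
  by rewrite -{1}E -E1 !ltW // front_slope_decr // ltW.
by rewrite front_slope1 ?th1 ?(ltW tr) // lexx ltW // (lt_trans B2).
Qed.

Lemma front_slope_lt0 t : derive1 g t < 0.
Proof. by have /andP[_ H] := front_slope_bounds t; apply: le_lt_trans H s00. Qed.

Lemma azimuth_derive (t : R) : is_derive t 1 az (P * (1 - derive1 g t)).
Proof.
have Dg : is_derive t 1 g (derive1 g t).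
  by rewrite derive1E; apply/derivableP/smooth_at_derivable.
by have H := is_deriveZ P (is_deriveB (is_derive_id t (1 : R)) Dg).
Qed.

Lemma azimuth_smooth : smooth setT az.
Proof.
apply: smooth_of_at => t; apply: smooth_atM; first exact: smooth_at_cst.
by apply: smooth_atB => //; exact: smooth_at_id.
Qed.

Lemma azimuth_slope_gt0 t : 0 < derive1 az t.
Proof.
rewrite derive1E; have [_ ->] := azimuth_derive t.
by rewrite mulr_gt0 ?P0 //; have := front_slope_lt0 t; lra.
Qed.

Lemma azimuth_continuous : continuous az.
Proof. by move=> t; exact: (Ck_continuous (azimuth_smooth 0)). Qed.

Lemma azimuth_lt x y : x < y -> az x < az y.
Proof.
move=> xy; apply: (@gtr0_derive1_incr R az x y); rewrite ?lexx //.
- by move=> t _; apply: smooth_at_derivable; exact/smooth_at_of/azimuth_smooth.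
- by move=> t _; exact: azimuth_slope_gt0.
- exact/continuous_subspaceT/azimuth_continuous.
Qed.

Lemma azimuth_le_mono : {mono az : x y / x <= y}.
Proof. by apply: le_mono => x y; exact: azimuth_lt. Qed.

Lemma azimuth_per t : az (t + T) = az t + 4 * pi.
Proof. by rewrite /az (ts_per TS) -/T; have := PT; lra. Qed.

Lemma azimuth_surj y : exists t, az t = y.
Proof.
have p0 := pi_gt0 R.
move: y; apply: (@shift_ind R (4 * pi) (az 0)) => [|y|y /andP[y0 y1]]; first by lra.
  split=> -[t E]; first by exists (t + T); rewrite azimuth_per E.
  by exists (t - T); have := azimuth_per (t - T); rewrite subrK E; lra.
have c : {within `[0, T], continuous az} by exact/continuous_subspaceT/azimuth_continuous.
have E := azimuth_per 0; rewrite add0r in E.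
have [|t _ <-] := @IVT R az 0 T y (ltW T0) c; last by exists t.
by rewrite ge_min le_max y0 E (ltW y1) orbT.
Qed.

Definition azimuth_inv (y : R) : R := xget 0 [set t | az t = y].
Local Notation tau := azimuth_inv.

Lemma azimuth_invK : cancel tau az.
Proof.
move=> y; rewrite /tau; case: xgetP => [t _ //|H].
by have [t E] := azimuth_surj y; case: (H t).
Qed.

Lemma azimuthK : cancel az tau.
Proof. by move=> t; apply: (inc_inj azimuth_le_mono); rewrite azimuth_invK. Qed.

Lemma azimuth_inv_continuous : continuous tau.
Proof.
move=> y; rewrite -(azimuth_invK y).
have := @near_can_continuous R az tau (tau y).
move=> H; apply: (nbhs_singleton (H _ _)).
  by near=> x; exact: azimuthK.
by near=> x; exact: azimuth_continuous.
Unshelve. all: by end_near. Qed.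

Lemma azimuth_inv_smooth : smooth setT tau.
Proof.
apply: (smooth_inverse azimuth_smooth) => //.
- by move=> t; rewrite gt_eqF // azimuth_slope_gt0.
- exact: azimuthK.
- exact: azimuth_invK.
- exact: azimuth_inv_continuous.
Qed.

Lemma azimuth_inv_lt x y : x < y -> tau x < tau y.
Proof. by rewrite -{1}(azimuth_invK x) -{1}(azimuth_invK y) (leW_mono azimuth_le_mono). Qed.

Lemma azimuth_inv_le x y : x <= y -> tau x <= tau y.
Proof. by rewrite -{1}(azimuth_invK x) -{1}(azimuth_invK y) azimuth_le_mono. Qed.

Lemma azimuth_inv_per y : tau (y + 4 * pi) = tau y + T.
Proof. by rewrite -{1}(azimuth_invK y) -azimuth_per azimuthK. Qed.

Lemma azimuth_inv_derive (y : R) : is_derive y 1 tau (P * (1 - derive1 g (tau y)))^-1.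
Proof.
rewrite -{1}(azimuth_invK y); apply: is_derive_inverse.
- by near=> x; exact: azimuthK.
- by near=> x; exact: azimuth_continuous.
- exact: azimuth_derive.
- by rewrite gt_eqF // mulr_gt0 ?P0 //; have := front_slope_lt0 (tau y); lra.
Unshelve. all: by end_near. Qed.

(** The height of the strand of the Lagrangian projection at a given azimuth,
    counted over two turns. *)
Definition strand (y : R) : R := slope_height (derive1 g (tau y)).
Local Notation k := strand.
Definition strand_max : R := slope_height s0.
Local Notation sg := strand_max.

Lemma strand_smooth : smooth setT k.
Proof.
apply: smooth_of_at => y; apply: smooth_at_comp.
  exact/slope_height_smooth_at/front_slope_lt0.
apply: smooth_at_comp; first exact: front_smooth_derive.
exact/smooth_at_of/azimuth_inv_smooth.
Qed.

(** The height increases at the convex corner and decreases at the concave one. *)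
Lemma strand_derive y : exists2 c, 0 < c & 'D_1 k y = c * derive1n 2 g (tau y).
Proof.
have Ht := smooth_at_of y azimuth_inv_smooth.
have Hg1 := front_smooth_derive (tau y).
have Hgt : smooth_at (fun y => derive1 g (tau y)) y by exact: smooth_at_comp.
rewrite /strand smooth_derive_comp //; last exact/slope_height_smooth_at/front_slope_lt0.
rewrite (smooth_derive_comp (phi := derive1 g)) //.
have [_ ->] := azimuth_inv_derive y.
exists ('D_1 slope_height (derive1 g (tau y)) * (P * (1 - derive1 g (tau y)))^-1).
  have H := front_slope_lt0 (tau y).
  by rewrite mulr_gt0 ?slope_height_derive // invr_gt0 mulr_gt0 ?P0 //; lra.
have F (a b c : R) : a * (b * c) = a * c * b by ring.
have -> : derive1n 2 g (tau y) = 'D_1 (derive1 g) (tau y) by rewrite -derive1E.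
exact: F.
Qed.

Lemma strand_per : periodic k (4 * pi).
Proof. by move=> y; rewrite /strand azimuth_inv_per front_slope_per. Qed.

Lemma strand_max_gt0 : 0 < sg.
Proof.
rewrite /strand_max /slope_height divr_gt0 ?mulr_gt0 ?sqrtr_gt0 ?oppr_gt0 //.
by have := s01; lra.
Qed.

Let heightV : slope_height s0^-1 = - sg.
Proof. exact: slope_heightV. Qed.

Lemma slope_height_le (x y : R) : x <= y -> y < 0 -> slope_height x <= slope_height y.
Proof.
rewrite le_eqVlt => /predU1P[->//|xy] y0; exact/ltW/slope_height_lt.
Qed.

Lemma strand_bound y : - sg <= k y <= sg.
Proof.
have /andP[H1 H2] := front_slope_bounds (tau y).
rewrite -heightV !slope_height_le //; exact: front_slope_lt0.
Qed.

(** The basepoints have azimuths 0 and [2 * pi], from which the azimuth varies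
    by less than 1 along the segments over the smoothing intervals. *)
Lemma azimuth_ends : [/\ -1 < az l0 < 0, 0 < az h0 < 1,
  2 * pi - 1 < az l1 < 2 * pi & 2 * pi < az h1 < 2 * pi + 1].
Proof.
have /andP[A1 A2] := o0; have /andP[A3 A4] := o1; have A5 := o2; have A6 := o3.
have [C1 C2] := ts_small0 TS; have [C3 C4] := ts_small1 TS.
have t1 := ts_turn TS; have t2 := ts_turn1 TS; rewrite -/T in t1 t2.
have p0 := P0; have pT := PT; have B1 := s00; have B2 := sV1; have B3 := s01.
have Eh0 : az h0 = P * (1 - s0) * (h0 - b0).
  by rewrite /az (ts_line0 TS) ?lexx ?ltW //; ring.
have El1 : az l1 = 2 * pi + P * (1 - s0) * (l1 - b1).
  rewrite /az (ts_line0 TS) ?lexx ?ltW // -pT.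
  by rewrite (_ : T = b1 - b0 - s0 * (b1 - b0)); [ring|lra].
have Eh1 : az h1 = 2 * pi + P * (1 - s0^-1) * (h1 - b1).
  by rewrite /az (ts_line1 TS) ?lexx ?ltW // -/T -pT; ring.
have El0 : az l0 = P * (1 - s0^-1) * (l0 - b0).
  have E := azimuth_per l0; have p4 : 4 * pi = 2 * (P * T) by rewrite pT; ring.
  have : az (l0 + T) = P * (1 - s0^-1) * (l0 - b0) + 2 * (P * T).
    rewrite /az (ts_line1 TS) ?lexx ?ltW // -/T.
    have e1 : s0^-1 * (b0 + T - b1) = b0 - b1 by lra.
    have -> : l0 + T - (b1 - T + s0^-1 * (l0 + T - b1))
      = (1 - s0^-1) * (l0 - b0) + 2 * T by lra.
    by ring.
  by rewrite E p4 => /addIr.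
have D0 : 0 < P * (1 - s0) by rewrite mulr_gt0 //; lra.
have D1 : 0 < P * (1 - s0^-1) by rewrite mulr_gt0 //; lra.
have DD x : 0 < x -> P * (1 - s0) * x < P * (1 - s0^-1) * x.
  by move=> x0; rewrite ltr_pM2r // ltr_pM2l //; lra.
have F1 := DD (h0 - b0) ltac:(lra); have F2 := DD (b1 - l1) ltac:(lra).
have G1 : 0 < P * (1 - s0) * (h0 - b0) by rewrite mulr_gt0 //; lra.
have G2 : 0 < P * (1 - s0) * (b1 - l1) by rewrite mulr_gt0 //; lra.
have G3 : 0 < P * (1 - s0^-1) * (h1 - b1) by rewrite mulr_gt0 //; lra.
have G4 : 0 < P * (1 - s0^-1) * (b0 - l0) by rewrite mulr_gt0 //; lra.
have N1 : P * (1 - s0) * (l1 - b1) = - (P * (1 - s0) * (b1 - l1)) by ring.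
have N2 : P * (1 - s0^-1) * (l0 - b0) = - (P * (1 - s0^-1) * (b0 - l0)) by ring.
by rewrite El0 Eh0 El1 Eh1 N1 N2; split; apply/andP; split; lra.
Qed.

Lemma strand_hi y : az h0 <= y <= az l1 -> k y = sg.
Proof.
move=> /andP[/azimuth_inv_le H1 /azimuth_inv_le H2].
by rewrite /strand front_slope0 // -(azimuthK h0) -(azimuthK l1) H1 H2.
Qed.

Lemma strand_lo y : az h1 <= y <= az l0 + 4 * pi -> k y = - sg.
Proof.
rewrite -azimuth_per => /andP[/azimuth_inv_le H1 /azimuth_inv_le H2].
by rewrite /strand front_slope1 ?heightV // -(azimuthK h1) -(azimuthK (l0 + T)) H1 H2.
Qed.

Lemma strand_incr x y : az l0 <= x -> x < y -> y <= az h0 -> k x < k y.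
Proof.
move=> /azimuth_inv_le H1 /azimuth_inv_lt H2 /azimuth_inv_le H3.
apply: slope_height_lt; last exact: front_slope_lt0.
by rewrite !azimuthK in H1 H3; exact: front_slope_incr.
Qed.

Lemma strand_decr x y : az l1 <= x -> x < y -> y <= az h1 -> k y < k x.
Proof.
move=> /azimuth_inv_le H1 /azimuth_inv_lt H2 /azimuth_inv_le H3.
apply: slope_height_lt; last exact: front_slope_lt0.
by rewrite !azimuthK in H1 H3; exact: front_slope_decr.
Qed.

End ProfileOfFront.

Lemma turn_arith {R : realFieldType} :
  [/\ forall u v w : R, v - 1 < u -> u < w + v -> -1 <= u - v < w,
      forall u v : R, u <= 2 * v - 1 -> u + 2 * v <= 4 * v - 1
    & forall u v : R, u - 2 * v + 4 * v = u + 2 * v].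
Proof.
split=> [u v w H1 H2|u v H|u v]; [|by lra|by ring].
by apply/andP; split; lra.
Qed.

Section FrontProfile.
Context {R : realType} (P : R) (g : R -> R) (s0 b0 l0 h0 b1 l1 h1 : R).
Hypothesis TS : two_segments P g s0 b0 l0 h0 b1 l1 h1.
Local Notation k := (strand P g).
Local Notation sg := (strand_max s0).
Let az (t : R) := P * (t - g t).
Let a0 := az l0.
Let e0 := az h0.
Let a1 := az l1 - 2 * pi.
Let e1 := az h1 - 2 * pi.
Let gap (y : R) := k y - k (y + 2 * pi).

Let ends : [/\ -1 < a0 < 0, 0 < e0 < 1, -1 < a1 < 0 & 0 < e1 < 1].
Proof.
have [A B /andP[C1 C2] /andP[D1 D2]] := azimuth_ends TS.
by split=> //; rewrite /a1 /e1 /az; apply/andP; split; lra.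
Qed.

Let sg0 : 0 < sg. Proof. exact: strand_max_gt0 TS. Qed.

Let lo1 y : -1 <= y <= a0 -> k y = - sg.
Proof.
have p2 := pi_ge2 R; have [_ _ _ /andP[D1 D2]] := ends.
move=> /andP[y1 y2]; rewrite -(strand_per TS y) (strand_lo TS) //.
by rewrite -/(az h1) -/(az l0); move: D2 y2; rewrite /e1 /a0 => D2 y2; apply/andP; split; lra.
Qed.

Let hi1 y : e0 <= y <= 2 * pi + a1 -> k y = sg.
Proof.
move=> /andP[y1 y2]; rewrite (strand_hi TS) // -/(az h0) -/(az l1).
by move: y1 y2; rewrite /e0 /a1 => y1 y2; apply/andP; split; lra.
Qed.

Let lo2 y : 2 * pi + e1 <= y <= 4 * pi - 1 -> k y = - sg.
Proof.
have [/andP[A1 A2] _ _ _] := ends.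
move=> /andP[y1 y2]; rewrite (strand_lo TS) // -/(az h1) -/(az l0).
by move: y1 A1; rewrite /e1 /a0 => y1 A1; apply/andP; split; lra.
Qed.

Let incr x y : a0 <= x -> x < y -> y <= e0 -> k x < k y.
Proof. by move=> H1 xy H2; apply: (strand_incr TS). Qed.

Let decr x y : a1 <= x -> x < y -> y <= e1 -> k (y + 2 * pi) < k (x + 2 * pi).
Proof.
move=> ax xy ye; apply: (strand_decr TS); rewrite -?/(az l1) -?/(az h1).
- by move: ax; rewrite /a1; lra.
- by lra.
- by move: ye; rewrite /e1; lra.
Qed.

Let k_gt y : a0 < y <= 1 -> - sg < k y.
Proof.
have s0' := sg0; have p2 := pi_ge2 R; have [/andP[A1 A2] /andP[B1 B2] /andP[C1 C2] _] := ends.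
move=> /andP[ay y1]; have [ye|ye] := leP y e0.
  have <- : k a0 = - sg by apply: lo1; rewrite lexx andbT ltW.
  exact: incr.
by rewrite hi1; [lra|apply/andP; split; lra].
Qed.

Let k_lt y : -1 <= y < e0 -> k y < sg.
Proof.
have s0' := sg0; have p2 := pi_ge2 R; have [/andP[A1 A2] /andP[B1 B2] /andP[C1 C2] _] := ends.
move=> /andP[y1 ye]; have [ay|ay] := leP a0 y.
  have <- : k e0 = sg by apply: hi1; apply/andP; split; lra.
  exact: incr.
by rewrite lo1; [lra|apply/andP; split; lra].
Qed.

Let k2_gt y : -1 <= y < e1 -> - sg < k (y + 2 * pi).
Proof.
have s0' := sg0; have p2 := pi_ge2 R; have [/andP[A1 A2] /andP[B1 B2] /andP[C1 C2] /andP[D1 D2]] := ends.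
move=> /andP[y1 ye]; have [ay|ay] := leP a1 y.
  have <- : k (e1 + 2 * pi) = - sg by apply: lo2; apply/andP; split; lra.
  exact: decr.
by rewrite hi1; [lra|apply/andP; split; lra].
Qed.

Let k2_lt y : a1 < y <= 1 -> k (y + 2 * pi) < sg.
Proof.
have s0' := sg0; have p2 := pi_ge2 R; have [/andP[A1 A2] /andP[B1 B2] /andP[C1 C2] /andP[D1 D2]] := ends.
move=> /andP[y1 ye]; have [ay|ay] := leP y e1.
  have <- : k (a1 + 2 * pi) = sg by apply: hi1; apply/andP; split; lra.
  exact: decr.
by rewrite lo2; [lra|apply/andP; split; lra].
Qed.

(** Strands cross only where both change their height: elsewhere one of them
    is at an extreme height that the other does not reach nearby. *)
Let gap0 y : -1 <= y <= 1 -> gap y = 0 -> (a0 < y < e0) && (a1 < y < e1).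
Proof.
have p2 := pi_ge2 R; have [/andP[A1 A2] /andP[B1 B2] /andP[C1 C2] /andP[D1 D2]] := ends.
have s0' := sg0.
move=> /andP[y1 y2] /eqP; rewrite subr_eq0 => /eqP E.
have F1 : a0 < y.
  rewrite ltNge; apply/negP => ya.
  have : k y = - sg by apply: lo1; rewrite y1.
  by have := @k2_gt y; rewrite y1 -E => /(_ ltac:(lra)); lra.
have F2 : y < e0.
  rewrite ltNge; apply/negP => ya.
  have : k y = sg by apply: hi1; apply/andP; split; lra.
  by have := @k2_lt y; rewrite y2 -E andbT => /(_ ltac:(lra)); lra.
have F3 : a1 < y.
  rewrite ltNge; apply/negP => ya.
  have : k (y + 2 * pi) = sg by apply: hi1; apply/andP; split; lra.
  by have := @k_lt y; rewrite y1 -E => /(_ ltac:(lra)); lra.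
have F4 : y < e1.
  rewrite ltNge; apply/negP => ya.
  have : k (y + 2 * pi) = - sg by apply: lo2; apply/andP; split; lra.
  by have := @k_gt y; rewrite y2 -E andbT => /(_ ltac:(lra)); lra.
by rewrite F1 F2 F3 F4.
Qed.

Let gap_incr x y : a0 <= x -> a1 <= x -> x < y -> y <= e0 -> y <= e1 -> gap x < gap y.
Proof.
by move=> H1 H2 xy H3 H4; rewrite /gap; apply: ltrB; [exact: incr|exact: decr].
Qed.

Let gap_slope y : (a0 < y < e0) && (a1 < y < e1) -> 0 < 'D_1 gap y.
Proof.
move=> /andP[/andP[H1 H2] /andP[H3 H4]].
have Sk x : smooth_at k x by exact/smooth_at_of/(strand_smooth TS).
have Ss : smooth_at (fun x : R => x + 2 * pi) y.
  by apply: smooth_atD; [exact: smooth_at_id|exact: smooth_at_cst].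
have Sk2 : smooth_at (fun x => k (x + 2 * pi)) y by exact: (smooth_at_comp (f := fun x => x + 2 * pi)).
rewrite /gap smooth_deriveB // (smooth_derive_comp (f := fun x => x + 2 * pi)) //.
have -> : 'D_1 (fun x : R => x + 2 * pi) y = 1.
  by rewrite smooth_deriveD ?derive_id ?derive_cst ?addr0 //;
    [exact: smooth_at_id|exact: smooth_at_cst].
have [c c0 ->] := strand_derive TS y.
have [c' c'0 ->] := strand_derive TS (y + 2 * pi).
have X1 : 0 < derive1n 2 g (azimuth_inv P g y).
  apply: (ts_convex TS); rewrite -(azimuthK TS l0) -(azimuthK TS h0).
  by rewrite !(azimuth_inv_lt TS).
have X2 : derive1n 2 g (azimuth_inv P g (y + 2 * pi)) < 0.
  apply: (ts_concave TS); rewrite -(azimuthK TS l1) -(azimuthK TS h1).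
  move: H3 H4; rewrite /a1 /e1 /az => H3 H4.
  by rewrite !(azimuth_inv_lt TS) //; lra.
rewrite mulr1 subr_gt0; apply: lt_trans (mulr_gt0 c0 X1).
by rewrite pmulr_rlt0.
Qed.

Let gap_continuous : continuous gap.
Proof.
have kc : continuous k by move=> y; exact/smooth_at_continuous/smooth_at_of/(strand_smooth TS).
move=> y; apply: cvgB; first exact: kc.
apply: (@continuous_comp _ _ _ (fun y : R => y + 2 * pi) k); last exact: kc.
by apply: cvgD; [exact: cvg_id|exact: cvg_cst].
Qed.

(** The gap changes sign between the two ends of the interval on which both
    strands move, and is increasing there, so that it vanishes exactly once. *)
Lemma front_profile : exists ps, profile k sg ps.
Proof.
have p2 := pi_ge2 R; have [/andP[A1 A2] /andP[B1 B2] /andP[C1 C2] /andP[D1 D2]] := ends.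
have s0' := sg0.
have Fe0 : e0 <= 1 by exact: ltW.
have Fa1 : 2 * pi - 1 <= 2 * pi + a1 by rewrite lerD2l ltW.
have Fe1 : 2 * pi + e1 <= 2 * pi + 1 by rewrite lerD2l ltW.
have [turn1 turn2 turn3] := @turn_arith R.
have sg2 : 0 <= 2 * sg by rewrite mulr_ge0 // ltW.
have gm : gap (-1) = - (2 * sg).
  rewrite /gap lo1 ?hi1; [ring|apply/andP; split; lra|apply/andP; split; lra].
have gp : gap 1 = 2 * sg.
  rewrite /gap hi1 ?lo2; [ring|apply/andP; split; lra|apply/andP; split; lra].
have [|||ps] := @IVT R gap (-1) 1 0; first exact: (@le_trans _ _ 0).
- exact: continuous_subspaceT gap_continuous.
- by rewrite gm gp ge_min le_max oppr_le0 sg2 orbT.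
rewrite in_itv /= => psb gps.
have /andP[P1 P2] := psb.
have loc := gap0 psb gps; have /andP[/andP[L1 L2] /andP[L3 L4]] := loc.
have unique y : -1 <= y <= 1 -> gap y = 0 -> y = ps.
  move=> yb gy; have /andP[/andP[M1 M2] /andP[M3 M4]] := gap0 yb gy.
  apply/eqP; rewrite eq_le !leNgt; apply/andP; split; apply/negP => lt.
    by have := @gap_incr ps y (ltW L1) (ltW L3) lt (ltW M2) (ltW M4); rewrite gps gy ltxx.
  by have := @gap_incr y ps (ltW M1) (ltW M3) lt (ltW L2) (ltW L4); rewrite gps gy ltxx.
have pos y : ps < y <= 1 -> 0 < gap y.
  move=> /andP[y1 y2]; rewrite ltNge; apply/negP => gy.
  have [||x] := @IVT R gap y 1 0 y2; first exact: continuous_subspaceT gap_continuous.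
    by rewrite gp ge_min le_max gy sg2 orbT.
  rewrite in_itv /= => /andP[x1 x2] gx.
  have xe : x = ps.
    by apply: unique gx; rewrite x2 andbT; exact: le_trans P1 (le_trans (ltW y1) x1).
  by have := lt_le_trans y1 x1; rewrite xe ltxx.
have neg y : -1 <= y < ps -> gap y < 0.
  move=> /andP[y1 y2]; rewrite ltNge; apply/negP => gy.
  have [||x] := @IVT R gap (-1) y 0 y1; first exact: continuous_subspaceT gap_continuous.
    by rewrite gm ge_min le_max gy oppr_le0 sg2 orbT.
  rewrite in_itv /= => /andP[x1 x2] gx.
  have xe : x = ps.
    by apply: unique gx; rewrite x1; exact: le_trans x2 (le_trans (ltW y2) P2).
  by have := le_lt_trans x2 y2; rewrite xe ltxx.
exists ps; split.
- exact: strand_smooth TS.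
- exact: strand_per TS.
- exact: sg0.
- exact: strand_bound TS.
- by move=> y /andP[y1 y2]; apply: hi1; rewrite (le_trans Fe0 y1) (le_trans y2 Fa1).
- by move=> y /andP[y1 y2]; apply: lo2; rewrite y2 andbT; exact: le_trans Fe1 y1.
- by rewrite (lt_trans A1 L1) (lt_trans L2 B2).
- by move: gps => /eqP; rewrite subr_eq0 => /eqP ->.
- move=> y /andP[y1 y2]; rewrite -subr_gt0 -/(gap y).
  have [yl|yl] := leP y 1; first by apply: pos; rewrite y1.
  have [yr|yr] := leP y (2 * pi - 1).
    rewrite /gap hi1 ?lo2 ?opprK ?addr_gt0 //.
      by rewrite addrC lerD2r (le_trans (ltW D2) (ltW yl)) turn2.
    by rewrite (le_trans Fe0 (ltW yl)) (le_trans yr Fa1).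
  have : gap (y - 2 * pi) < 0 by apply: neg; exact: turn1.
  have -> : gap (y - 2 * pi) = - gap y.
    rewrite /gap subrK opprB -(strand_per TS (y - 2 * pi)); congr (k _ - _); exact: turn3.
  by rewrite oppr_lt0.
- exact: gap_slope.
Qed.

(** Since [dphi = P * (1 - g') dt] and the latitude is [- g' / (1 - g')], the
    function [- P * g] is an antiderivative. *)
Lemma lat_antiderivative : exists G : R -> R,
  (forall y : R, is_derive y 1 G (lat (k y))) /\
  (forall y, G (y + 4 * pi) = G y + 2 * pi).
Proof.
exists (fun y => - P * g (azimuth_inv P g y)); split=> y.
  have g0 := front_slope_lt0 TS (azimuth_inv P g y).
  have Dg : is_derive (azimuth_inv P g y) 1 g (derive1 g (azimuth_inv P g y)).
    by rewrite derive1E; apply/derivableP/smooth_at_derivable; exact: ts_smooth TS _.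
  have D := is_deriveZ (- P) (is_derive1_comp Dg (azimuth_inv_derive TS y)).
  apply: (is_derive_eq D); rewrite /strand slope_height_lat // /GRing.scale /=.
  move: (derive1 g _) g0 (ts_P TS) => c c0 P0; field.
  by rewrite !gt_eqF //; lra.
rewrite (azimuth_inv_per TS) (ts_per TS).
by have := ts_P TS => P0; field; rewrite gt_eqF.
Qed.

End FrontProfile.

(** * The crossing and its chords *)

(** The inverse [tau] of the azimuth recovers the parameter of the knot.  The
    last clause says that the mean latitude of the knot is 1/2. *)
Record one_crossing {R : realType} (p : nat) (g k : R -> R) (sg ps : R)
    (tau : R -> R) : Prop := OneCrossing {
  oc_profile : profile k sg ps;
  oc_gamma : forall t, gamma p g t = cyl (k (azimuth p g t)) (azimuth p g t);
  oc_r1sq : forall t, r1sq g t = lat (k (azimuth p g t));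
  oc_azK : cancel (azimuth p g) tau;
  oc_tauK : cancel tau (azimuth p g);
  oc_az_lt : forall x y, (azimuth p g x < azimuth p g y) = (x < y);
  oc_az_cont : continuous (azimuth p g);
  oc_tau_cont : continuous tau;
  oc_az_per : forall t, azimuth p g (t + period p 1) = azimuth p g t + 4 * pi;
  oc_antiderivative : exists G : R -> R,
    (forall y : R, is_derive y 1 G (lat (k y))) /\
    (forall y, G (y + 4 * pi) = G y + 2 * pi)
}.

Lemma special_front_one_crossing (R : realType) (p : nat) : (3 <= p)%N ->
  sufficiently_small_fronts p (p - 1) 1 (fun g : R -> R =>
    exists k sg ps tau, one_crossing p g k sg ps tau).
Proof.
move=> p3; have [eps eps0 H] := @special_front_two_segments R p p3.
exists eps => // d /H [delta delta0 {}H]; exists delta => // g.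
move=> /H [s0 [b0 [l0 [h0 [b1 [l1 [h1 TS]]]]]]].
have [ps Hk] := front_profile TS.
exists (strand p%:R g), (strand_max s0), ps, (azimuth_inv p%:R g).
have rE t : r1sq g t = lat (strand p%:R g (azimuth p g t)).
  have -> : strand p%:R g (azimuth p g t) = slope_height (derive1 g t).
    by rewrite /strand /azimuth (azimuthK TS).
  by rewrite slope_height_lat //; exact: front_slope_lt0 TS t.
split=> //.
- by move=> t; rewrite /gamma rE sphere_pt_lat.
- exact: azimuthK TS.
- exact: azimuth_invK TS.
- exact: leW_mono (azimuth_le_mono TS).
- exact: azimuth_continuous TS.
- exact: azimuth_inv_continuous TS.
- by move=> t; rewrite /period mulr1; exact: azimuth_per TS t.
- exact: lat_antiderivative TS.
Qed.

Section Chords.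
Context {R : realType} (p : nat) (g k : R -> R) (sg ps : R) (tau : R -> R).
Hypothesis OC : one_crossing p g k sg ps tau.
Local Notation az := (azimuth p g).
Local Notation T := (period p 1 : R).

Let Hk : profile k sg ps. Proof. exact: oc_profile OC. Qed.

Lemma az_inj : injective az.
Proof. exact: can_inj (oc_azK OC). Qed.

(** The parameters of chords range over one period, which is two turns. *)
Lemma az_period x y : 0 <= x < T -> 0 <= y < T -> az x < az y + 4 * pi.
Proof.
by move=> /andP[x0 xT] /andP[y0 yT]; rewrite -(oc_az_per OC) (oc_az_lt OC); lra.
Qed.

Lemma GammaP P : Gamma p g P <-> exists y, P = cyl (k y) y.
Proof.
split=> [[t _ <-]|[y ->]]; first by exists (az t); rewrite (oc_gamma OC).
by exists (tau y) => //; rewrite (oc_gamma OC) (oc_tauK OC).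
Qed.

Lemma crossing_azimuth y : k (y + 2 * pi) = k y -> exists n : int, y = ps + 2 * pi * n%:~R.
Proof.
have p0 := pi_gt0 R.
move: y; apply: (@shift_ind R (2 * pi) ps) => [|y|y /andP[]]; first by lra.
  have -> : k (y + 2 * pi + 2 * pi) = k y.
    by rewrite -[RHS](profile_per Hk); congr k; ring.
  split=> H E.
    by have [n ->] := H (esym E); exists (n + 1); rewrite rmorphD /=; ring.
  by have [n En] := H (esym E); exists (n - 1); rewrite rmorphB /=; lra.
rewrite le_eqVlt => /predU1P[<- _ _|y1 y2 E].
  by exists 0; rewrite mulr0 addr0.
by have := @profile_above _ _ _ _ Hk y; rewrite y1 y2 E ltxx => /(_ isT).
Qed.

Lemma crossing_azimuthE (n : int) : k (ps + 2 * pi * n%:~R + 2 * pi) = k (ps + 2 * pi * n%:~R).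
Proof.
have swap y : k (y + 2 * pi) = k y -> k (y + 2 * pi + 2 * pi) = k (y + 2 * pi).
  by move=> ->; rewrite -[RHS](profile_per Hk); congr k; ring.
have E : (fun y => k (y + 2 * pi) = k y) (ps + 2 * pi * n%:~R)
       = (fun y => k (y + 2 * pi) = k y) ps.
  apply: (@periodic_int R Prop (fun y => k (y + 2 * pi) = k y)) => y.
  apply/propext; split; last exact: swap.
  have -> : y + 2 * pi + 2 * pi = y + 4 * pi by ring.
  by rewrite (profile_per Hk) => ->.
by rewrite E; exact: profile_cross Hk.
Qed.

(** The two strands of the knot at an azimuth are one turn apart, and they meet
    at the azimuth of the crossing only. *)
Lemma chordsP x : chords p 1 g x <->
  [/\ 0 <= x.1 < T, 0 <= x.2 < T,
      exists n : int, az x.1 = ps + 2 * pi * n%:~R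
    & az x.2 = az x.1 + 2 * pi \/ az x.2 = az x.1 - 2 * pi].
Proof.
have p0 := pi_gt0 R; split=> [[x1 x2 xn]|[x1 x2 [n E1] E2]].
  rewrite !(oc_gamma OC) => /esym /cyl_inj[Ek Ec Es].
  have [m Em] := angle_eq Ec Es.
  have B1 := az_period x1 x2; have B2 := az_period x2 x1.
  have m2 : (-2 < m < 2)%R.
    rewrite -(ltr_int R) -(ltr_int R) /= !rmorphN /=; set z := m%:~R : R in Em *.
    have : z = (az x.2 - az x.1) / (2 * pi) by rewrite Em; field; lra.
    by move=> ->; rewrite ltr_pdivlMr ?ltr_pdivrMr; try lra; apply/andP; split; lra.
  have m0 : m != 0.
    by apply/eqP => m0; apply: xn; apply: az_inj; rewrite Em m0 mulr0 addr0.
  have [m1|m1] : m = 1 \/ m = -1.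
    by case: (m) m2 m0 => [[|[|k0]]|[|k0]] //; [left|right].
    have E : az x.2 = az x.1 + 2 * pi by rewrite Em m1 mulr1.
    split=> //; last by left.
    by apply: crossing_azimuth; rewrite -E.
  have E : az x.2 = az x.1 - 2 * pi by rewrite Em m1 mulrN1.
  split=> //; last by right.
  apply: crossing_azimuth; rewrite -Ek E -(profile_per Hk (az x.1 - 2 * pi)).
  by congr k; ring.
split=> //.
  by move=> E; case: E2; rewrite E; lra.
rewrite !(oc_gamma OC).
have kE : k (az x.2) = k (az x.1).
  case: E2 => ->; first by rewrite E1 crossing_azimuthE.
  rewrite E1 -[RHS]crossing_azimuthE -(profile_per Hk (_ - _)).
  by congr k; ring.
have [m Em] : exists m : int, az x.2 = az x.1 + 2 * pi * m%:~R.
  by case: E2 => ->; [exists 1; rewrite mulr1|exists (-1); rewrite mulrN1].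
by rewrite kE Em /cyl cosD2pi_int sinD2pi_int.
Qed.

Lemma chords_swap x : chords p 1 g x -> chords p 1 g (x.2, x.1).
Proof. by move=> [x1 x2 xn E]; split=> //= E'; apply: xn. Qed.

(** The knot passes twice through the crossing in a period; the two chords are
    the two orders of these passages. *)
Lemma chords_card : (chords p 1 g #= `I_2)%card.
Proof.
have p0 := pi_gt0 R.
have [y0 [[n0 yE] y0l y0r]] : exists y0, [/\ exists n : int, y0 = ps + 2 * pi * n%:~R,
    az 0 <= y0 & y0 < az 0 + 2 * pi].
  pose n0 := Num.ceil ((az 0 - ps) / (2 * pi)).
  exists (ps + 2 * pi * n0%:~R).
  have /andP[] := @ceil_itv R ((az 0 - ps) / (2 * pi)); rewrite -/n0 rmorphB /= => H1 H2.
  move: H1 H2; rewrite ltr_pdivlMr ?ler_pdivrMr; try lra.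
  by move=> H1 H2; split; [exists n0|lra|lra].
have T1 : az T = az 0 + 4 * pi by rewrite -(oc_az_per OC) add0r.
have tauin y : az 0 <= y -> y < az 0 + 4 * pi -> 0 <= tau y < T.
  move=> H1 H2; rewrite leNgt -(oc_az_lt OC (tau y) 0) -(oc_az_lt OC (tau y) T).
  by rewrite (oc_tauK OC) T1 H2 andbT -leNgt.
have b1 : 0 <= tau y0 < T by apply: tauin => //; lra.
have b2 : 0 <= tau (y0 + 2 * pi) < T by apply: tauin; lra.
have c12 : chords p 1 g (tau y0, tau (y0 + 2 * pi)).
  by apply/chordsP; split=> //=; rewrite !(oc_tauK OC); [exists n0|left].
have t12 : tau y0 <> tau (y0 + 2 * pi) by case: c12.
suff -> : chords p 1 g = [set` [fset (tau y0, tau (y0 + 2 * pi));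
                                (tau (y0 + 2 * pi), tau y0)]%fset].
  apply/card_eq_fsetP; rewrite cardfs2 xpair_eqE; congr (_.+1).
  by case: eqP => [/t12|].
apply/seteqP; split=> x /=; last first.
  by rewrite !inE => /orP[/eqP ->|/eqP ->] //; exact: chords_swap c12.
rewrite !inE => xc; have [x1 x2 [n E1] E2] := (chordsP x).1 xc.
have azin t : 0 <= t < T -> az 0 <= az t < az 0 + 4 * pi.
  by move=> /andP[t0 tT]; rewrite -T1 (oc_az_lt OC) tT andbT leNgt (oc_az_lt OC) -leNgt.
have /andP[B1 B2] := azin _ x1; have /andP[B3 B4] := azin _ x2.
have tE t y : az t = y -> t = tau y by move=> <-; rewrite (oc_azK OC).
have Em : az x.1 = y0 + 2 * pi * (n - n0)%:~R.
  by rewrite E1 yE rmorphB /=; move: (n%:~R : R) (n0%:~R : R) => u v; ring.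
have mb : (-1 < n - n0 < 2)%R.
  rewrite -(ltr_int R) -(ltr_int R) /= rmorphN /=; move: ((n - n0)%:~R : R) Em => z Em.
  have : z = (az x.1 - y0) / (2 * pi) by rewrite Em; field; lra.
  by move=> ->; rewrite ltr_pdivlMr ?ltr_pdivrMr; try lra; apply/andP; split; lra.
have [m0|m1] : n - n0 = 0 \/ n - n0 = 1.
- by case: (n - n0) mb => [[|[|m]]|m] //; [left|right].
- rewrite m0 mulr0 addr0 in Em.
  case: E2; rewrite Em => E2; last by lra.
  by rewrite (surjective_pairing x) (tE _ _ Em) (tE _ _ E2) eqxx.
- rewrite m1 mulr1 in Em.
  case: E2; rewrite Em => E2; first by lra.
  rewrite addrK in E2.
  by rewrite (surjective_pairing x) (tE _ _ Em) (tE _ _ E2) eqxx orbT.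
Qed.

End Chords.

(** * The regions of the sphere *)

Section ConnectedRectangles.
Context {R : realType}.

Lemma continuous_pair {T U W : topologicalType} (f : T -> U) (h : T -> W) :
  continuous f -> continuous h -> continuous (fun x => (f x, h x)).
Proof. by move=> cf ch x; apply: cvg_pair; [exact: cf|exact: ch]. Qed.

Lemma connected_rectangle (I J : set R) : connected I -> connected J ->
  connected (I `*` J).
Proof.
move=> cI cJ; have [[j0 Jj0]|J0] := pselect (J !=set0); last first.
  suff -> : I `*` J = set0 by exact: connected0.
  by rewrite -subset0 => -[i j] [_ Jj]; apply: J0; exists j.
have [[i0 Ii0]|I0] := pselect (I !=set0); last first.
  suff -> : I `*` J = set0 by exact: connected0.
  by rewrite -subset0 => -[i j] [Ii _]; apply: I0; exists i.
pose cross i := (fun j => (i, j)) @` J `|` (fun i => (i, j0)) @` I.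
have -> : I `*` J = \bigcup_(i in I) cross i.
  apply/seteqP; split=> [[i j] [Ii Jj]|_ [i Ii [[j Jj <-]|[i' Ii' <-]]]] //.
  by exists i => //; left; exists j.
apply: bigcup_connected.
  by exists (i0, j0) => i Ii; right; exists i0.
move=> i Ii; apply: connectedU.
- by exists (i, j0); split; [exists j0|exists i].
- apply: connected_continuous_connected => //.
  apply: continuous_subspaceT; apply: continuous_pair => j; [exact: cvg_cst|exact: cvg_id].
- apply: connected_continuous_connected => //.
  apply: continuous_subspaceT; apply: continuous_pair => i'; [exact: cvg_id|exact: cvg_cst].
Qed.

End ConnectedRectangles.

Section AngleContinuity.
Context {R : realType}.
Local Notation space := (R * R * R)%type.

Lemma rho_continuous : continuous (@rho R).
Proof.
move=> P; apply: continuous_comp; last exact: sqrt_continuous.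
apply: continuousD.
  by apply: smooth_at_continuous; apply: smooth_at_sqr; apply: smooth_at_x; exact: smooth_at_id.
by apply: smooth_at_continuous; apply: smooth_at_sqr; apply: smooth_at_y; exact: smooth_at_id.
Qed.

Lemma ang_continuous (A : R -> R) (P : space) : continuous A ->
  periodic A (2 * pi) -> rho P != 0 -> {for P, continuous (fun Q => A (ang Q))}.
Proof.
move=> cA TA r0; have Hid := smooth_at_id P.
have cb := smooth_at_continuous (branch_smooth_at r0 Hid).
have cAb : {for P, continuous (fun Q => A (branch (ang P) Q))}.
  by apply: (@continuous_comp _ _ _ _ A) => //; exact: cA.
have nb := near_branch r0 Hid.
have nE : \forall Q \near P, A (branch (ang P) Q) = A (ang Q).
  by apply: filterS nb => Q [Ec Es]; exact: periodic_angle.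
rewrite /prop_for /continuous_at -(nbhs_singleton nE).
by apply: cvg_trans cAb; exact: near_eq_cvg.
Qed.

(** The height of a point above the graph of a bounded function of the
    azimuth, scaled so as to be continuous at the poles. *)
Definition above (A : R -> R) (P : space) : R := P.2 - rho P * A (ang P).

Lemma above_continuous A (M : R) : continuous A -> periodic A (2 * pi) ->
  (forall y, `|A y| <= M) -> continuous (above A).
Proof.
move=> cA TA bA P; apply: continuousB; first exact: continuous_snd_pair.
have [r0|r0] := eqVneq (rho P) 0; last first.
  by apply: continuousM; [exact: rho_continuous|exact: ang_continuous].
rewrite /prop_for /continuous_at r0 mul0r.
apply/cvgr0Pnorm_le => e e0.
have M0 : 0 <= M by apply: le_trans (bA 0).
have := @rho_continuous P; rewrite /continuous_at r0 => /cvgr0Pnorm_lt.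
move=> /(_ (e / (M + 1))) H; have {}H := H ltac:(by rewrite divr_gt0 // ltr_wpDl).
apply: filterS H => Q; rewrite ltr_pdivlMr ?ltr_wpDl // => HQ.
rewrite normrM; apply: le_trans (ltW HQ); apply: ler_wpM2l => //.
by apply: le_trans (bA _) _; rewrite lerDl.
Qed.

Lemma above_cyl A s phi : periodic A (2 * pi) ->
  above A (cyl s phi) = (s - A phi) / Num.sqrt (1 + s ^+ 2).
Proof.
move=> TA; have [ca sa] := ang_cyl s phi.
have AE : A (ang (cyl s phi)) = A phi by exact: periodic_angle.
by rewrite /above AE rho_cyl /=; field; rewrite gt_eqF // sqrt1_gt0.
Qed.

Lemma above_pole A b : above A (pole b) = (-1) ^+ (~~ b).
Proof. by rewrite /above pole_rho mul0r subr0. Qed.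

Lemma cyl_continuous : continuous (fun z : R * R => cyl z.1 z.2).
Proof.
move=> z; apply: smooth_at_continuous.
have S1 : smooth_at (fun z : R * R => z.1) z by apply: smooth_at_fst; exact: smooth_at_id.
have S2 : smooth_at (fun z : R * R => z.2) z by apply: smooth_at_snd; exact: smooth_at_id.
have Sr : smooth_at (fun z : R * R => (Num.sqrt (1 + z.1 ^+ 2))^-1) z.
  apply: smooth_atV; first by rewrite gt_eqF // sqrt1_gt0.
  apply: smooth_at_comp; first by apply: smooth_at_sqrt; rewrite ltr_pwDl // sqr_ge0.
  by apply: smooth_atD; [exact: smooth_at_cst|exact: smooth_at_sqr].
do 2?[apply: smooth_at_pair]; apply: smooth_atM => //.
  by apply: smooth_at_comp => //; exact: smooth_at_cos.
by apply: smooth_at_comp => //; exact: smooth_at_sin.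
Qed.

End AngleContinuity.

Section SignSets.
Context {R : realType} {T : topologicalType} (f : T -> R).
Hypothesis cf : continuous f.

Lemma open_pos : open [set x | 0 < f x].
Proof.
have H : open (f @^-1` [set y | 0 < y]) by apply: open_comp; [move=> x _; exact: cf|exact: open_gt].
exact: H.
Qed.

Lemma open_neg : open [set x | f x < 0].
Proof.
have H : open (f @^-1` [set y | y < 0]) by apply: open_comp; [move=> x _; exact: cf|exact: open_lt].
exact: H.
Qed.

Lemma closed_nneg : closed [set x | 0 <= f x].
Proof.
have H : closed (f @^-1` [set y | 0 <= y]) by apply: closed_comp; [move=> x _; exact: cf|exact: closed_ge].
exact: H.
Qed.

Lemma closed_npos : closed [set x | f x <= 0].
Proof.
have H : closed (f @^-1` [set y | y <= 0]) by apply: closed_comp; [move=> x _; exact: cf|exact: closed_le].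
exact: H.
Qed.

End SignSets.

Section Regions.
Context {R : realType} (p : nat) (g k : R -> R) (sg ps : R) (tau : R -> R).
Hypothesis OC : one_crossing p g k sg ps tau.
Local Notation space := (R * R * R)%type.

Let Hk : profile k sg ps. Proof. exact: oc_profile OC. Qed.

Definition top (y : R) : R := Num.max (k y) (k (y + 2 * pi)).
Definition bot (y : R) : R := Num.min (k y) (k (y + 2 * pi)).

Let k4 y : k (y + 2 * pi + 2 * pi) = k y.
Proof. by rewrite -[RHS](profile_per Hk); congr k; ring. Qed.

Lemma top_per : periodic top (2 * pi).
Proof. by move=> y; rewrite /top k4 maxC. Qed.

Lemma bot_per : periodic bot (2 * pi).
Proof. by move=> y; rewrite /bot k4 minC. Qed.

Let kc : continuous k.
Proof. by move=> y; exact/smooth_at_continuous/(profile_smooth_at Hk). Qed.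

Let k2c : continuous (fun y => k (y + 2 * pi)).
Proof.
move=> y; apply: continuous_comp; last exact: kc.
by apply: continuousD; [exact: cvg_id|exact: cst_continuous].
Qed.

Lemma top_continuous : continuous top.
Proof. by move=> y; apply: continuous_max; [exact: kc|exact: k2c]. Qed.

Lemma bot_continuous : continuous bot.
Proof. by move=> y; apply: continuous_min; [exact: kc|exact: k2c]. Qed.

Let knorm y : `|k y| <= sg.
Proof. by rewrite ler_norml; exact: profile_bound Hk y. Qed.

Lemma top_bound y : `|top y| <= sg.
Proof. by rewrite /top maxEle; case: ifP => _; exact: knorm. Qed.

Lemma bot_bound y : `|bot y| <= sg.
Proof. by rewrite /bot minEle; case: ifP => _; exact: knorm. Qed.

Lemma bot_le_top y : bot y <= top y.
Proof. by rewrite /bot /top ge_min !le_max lexx. Qed.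

Lemma bot_lt_top y : ps < y < ps + 2 * pi -> bot y < top y.
Proof.
move=> /(profile_above Hk) H; rewrite /bot /top.
by rewrite minEle maxEle leNgt H.
Qed.

Lemma Gamma_cyl s y : Gamma p g (cyl s y) <-> s = k y \/ s = k (y + 2 * pi).
Proof.
split.
  move=> /(GammaP OC) [y' /cyl_inj[-> Ec Es]].
  have E : (fun x => k y' = k x \/ k y' = k (x + 2 * pi)) y =
           (fun x => k y' = k x \/ k y' = k (x + 2 * pi)) y'.
    apply: (@periodic_angle R Prop (fun x => k y' = k x \/ k y' = k (x + 2 * pi))) => // x.
    by rewrite k4; apply/propext; split=> -[]; [right|left|right|left].
  by rewrite E; left.
case=> ->; apply/(GammaP OC); first by exists y.
exists (y + 2 * pi); rewrite /cyl.
have := cosD2pi_int y 1; have := sinD2pi_int y 1.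
by rewrite !mulr1 => -> ->.
Qed.

Lemma Gamma_not_pole b : ~ Gamma p g (pole b : space).
Proof. by move=> /(GammaP OC) [y E]; apply: (@cyl_not_pole _ (k y) y b). Qed.

Definition region_north : set space := [set P | sphere P /\ 0 < above top P].
Definition region_south : set space := [set P | sphere P /\ above bot P < 0].
Definition region_mid : set space :=
  [set P | [/\ sphere P, above top P < 0 & 0 < above bot P]].

Let div_sign (a s : R) : (0 < a / Num.sqrt (1 + s ^+ 2)) = (0 < a) /\
  (a / Num.sqrt (1 + s ^+ 2) < 0) = (a < 0).
Proof. by rewrite pmulr_lgt0 ?pmulr_llt0 ?invr_gt0 ?sqrt1_gt0. Qed.

Lemma north_cyl s y : region_north (cyl s y) <-> top y < s.
Proof.
rewrite /region_north /= (above_cyl _ _ top_per) (div_sign _ _).1 subr_gt0.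
by split=> [[]|] //; split=> //; exact: sphere_cyl.
Qed.

Lemma south_cyl s y : region_south (cyl s y) <-> s < bot y.
Proof.
rewrite /region_south /= (above_cyl _ _ bot_per) (div_sign _ _).2 subr_lt0.
by split=> [[]|] //; split=> //; exact: sphere_cyl.
Qed.

Lemma mid_cyl s y : region_mid (cyl s y) <-> bot y < s < top y.
Proof.
rewrite /region_mid /= (above_cyl _ _ bot_per) (above_cyl _ _ top_per).
rewrite (div_sign _ _).1 (div_sign _ _).2 subr_lt0 subr_gt0.
split=> [[_ -> ->]//|/andP[H1 H2]]; split=> //; exact: sphere_cyl.
Qed.

Lemma north_pole : region_north (pole true).
Proof. by split; [exact: sphere_pole|rewrite above_pole expr0]. Qed.

Lemma south_pole : region_south (pole false).
Proof. by split; [exact: sphere_pole|rewrite above_pole expr1 oppr_lt0]. Qed.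

Lemma north_not_south_pole : ~ region_north (pole false).
Proof. by move=> [_]; rewrite above_pole expr1 oppr_gt0 ltr10. Qed.

Lemma south_not_north_pole : ~ region_south (pole true).
Proof. by move=> [_]; rewrite above_pole expr0 ltr10. Qed.

Lemma mid_not_pole b : ~ region_mid (pole b).
Proof.
move=> [_]; rewrite !above_pole; case: b => /=; rewrite ?expr0 ?expr1.
  by rewrite ltr10.
by rewrite oppr_gt0 ltr10.
Qed.

Lemma regions_cover P : sphere P -> ~ Gamma p g P ->
  [\/ region_north P, region_south P | region_mid P].
Proof.
move=> /sphereP[[[] ->] _|[s [y ->]] nG].
- by constructor 1; exact: north_pole.
- by constructor 2; exact: south_pole.
have [ts|st|E] := ltgtP (top y) s; first by constructor 1; apply/north_cyl.
  have [bs|sb|E] := ltgtP (bot y) s; first by constructor 3; apply/mid_cyl; rewrite bs.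
    by constructor 2; apply/south_cyl.
  by case: nG; apply/Gamma_cyl; rewrite -E /bot; case: leP; [left|right].
by case: nG; apply/Gamma_cyl; rewrite -E /top; case: leP; [right|left].
Qed.

Lemma regions_off P : [\/ region_north P, region_south P | region_mid P] ->
  (sphere `\` Gamma p g) P.
Proof.
move=> H; have SP : sphere P by case: H => [][].
split=> // /(GammaP OC) [y E].
have /andP[b1 b2] : bot y <= k y <= top y by rewrite /bot /top ge_min le_max lexx.
move: H; rewrite E => -[/north_cyl lt|/south_cyl lt|/mid_cyl /andP[]].
- by have := lt_le_trans lt b2; rewrite ltxx.
- by have := le_lt_trans b1 lt; rewrite ltxx.
- by rewrite /bot /top minEle maxEle; case: ifP => _; rewrite ?ltxx.
Qed.

Let top_above_cont : continuous (above top).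
Proof. exact: above_continuous top_continuous top_per top_bound. Qed.

Let bot_above_cont : continuous (above bot).
Proof. exact: above_continuous bot_continuous bot_per bot_bound. Qed.

Lemma region_disjoint_NS P : region_north P -> region_south P -> False.
Proof.
move=> [SP H1] [_ H2]; move: SP H1 H2 => /sphereP[[b ->]|[s [y ->]]].
  by rewrite !above_pole => H1 /(lt_trans H1); rewrite ltxx.
rewrite (above_cyl _ _ bot_per) (above_cyl _ _ top_per).
rewrite (div_sign _ _).1 (div_sign _ _).2 subr_lt0 subr_gt0 => H1 H2.
by have := lt_trans H1 H2; rewrite ltNge bot_le_top.
Qed.

Lemma region_disjoint_NM P : region_north P -> region_mid P -> False.
Proof. by move=> [_ H1] [_ H2 _]; have := lt_trans H1 H2; rewrite ltxx. Qed.

Lemma region_disjoint_SM P : region_south P -> region_mid P -> False.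
Proof. by move=> [_ H1] [_ _ H2]; have := lt_trans H1 H2; rewrite ltxx. Qed.

(** A connected set that is both open and closed in the complement of the knot
    is a component.  Each region is cut out of this complement by strict
    inequalities, and also by weak ones. *)
Lemma component_eq (N U F : set space) :
  (forall P, N P <-> (sphere `\` Gamma p g) P /\ U P) ->
  (forall P, N P <-> (sphere `\` Gamma p g) P /\ F P) ->
  open U -> closed F -> connected N ->
  forall P, N P -> connected_component (sphere `\` Gamma p g) P = N.
Proof.
move=> NU NF oU cF cN P NP; apply/seteqP; split; last first.
  by apply: connected_component_max => // Q /NU[].
move=> Q [C [CP CS cC] CQ]; suff E : C `&` U = C.
  by apply/NU; split; [exact: CS|move: CQ; rewrite -E => -[]].
apply: cC.
- by exists P; split => //; have [] := (NU P).1 NP.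
- by exists U.
exists F => //; apply/seteqP; split=> x [Cx Ux]; split=> //.
  by have [] := (NF x).1 ((NU x).2 (conj (CS x Cx) Ux)).
by have [] := (NU x).1 ((NF x).2 (conj (CS x Cx) Ux)).
Qed.

Lemma north_open P : region_north P <-> (sphere `\` Gamma p g) P /\ 0 < above top P.
Proof.
split=> [H|[[SP _] H]]; last by split.
by split; [apply: regions_off; constructor 1|case: H].
Qed.

Lemma north_closed P : region_north P <-> (sphere `\` Gamma p g) P /\ 0 <= above top P.
Proof.
split=> [/north_open[? /ltW]//|[[SP nG] H]].
have [//|S|[_ M _]] := regions_cover SP nG; last by move: M; rewrite ltNge H.
exfalso; case: S => _; move: H; case/sphereP: SP => [[b ->]|[s [y ->]]].
  by rewrite !above_pole leNgt => /negbTE ->.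
rewrite !above_cyl ?(div_sign _ _).2; [|exact: bot_per|exact: top_per].
rewrite leNgt (div_sign _ _).2 -leNgt subr_ge0 subr_lt0 => H1 H2.
by have := lt_le_trans H2 (le_trans (bot_le_top y) H1); rewrite ltxx.
Qed.

Lemma south_open P : region_south P <-> (sphere `\` Gamma p g) P /\ above bot P < 0.
Proof.
split=> [H|[[SP _] H]]; last by split.
by split; [apply: regions_off; constructor 2|case: H].
Qed.

Lemma south_closed P : region_south P <-> (sphere `\` Gamma p g) P /\ above bot P <= 0.
Proof.
split=> [/south_open[? /ltW]//|[[SP nG] H]].
have [N|//|[_ _ M]] := regions_cover SP nG; last by move: M; rewrite ltNge H.
exfalso; case: N => _; move: H; case/sphereP: SP => [[b ->]|[s [y ->]]].
  by rewrite !above_pole leNgt => /negbTE ->.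
rewrite !above_cyl ?(div_sign _ _).1; [|exact: top_per|exact: bot_per].
rewrite leNgt (div_sign _ _).1 -leNgt subr_le0 subr_gt0 => H1 H2.
by have := lt_le_trans H2 (le_trans H1 (bot_le_top y)); rewrite ltxx.
Qed.

Lemma mid_open P : region_mid P <->
  (sphere `\` Gamma p g) P /\ (above top P < 0 /\ 0 < above bot P).
Proof.
split=> [H|[[SP _] [H1 H2]]]; last by split.
by split; [apply: regions_off; constructor 3|case: H].
Qed.

Lemma mid_closed P : region_mid P <->
  (sphere `\` Gamma p g) P /\ (above top P <= 0 /\ 0 <= above bot P).
Proof.
split=> [/mid_open[? [/ltW ? /ltW ?]]//|[[SP nG] [H1 H2]]].
have [[_ N]|[_ S]|//] := regions_cover SP nG.
  by move: N; rewrite ltNge H1.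
by move: S; rewrite ltNge H2.
Qed.

(** Without its pole the region is the image of a product of intervals. *)
Lemma north_punctured_connected : connected (region_north `\ pole true).
Proof.
have -> : region_north `\ pole true =
    (fun z : R * R => cyl (top z.2 + z.1) z.2) @` (`]0, +oo[ `*` setT).
  apply/seteqP; split=> [P [NP Pn]|_ [[a y] [/= a0 _] <-]].
    have [SP _] := NP; case/sphereP: SP NP Pn => [[[] ->] NP Pn|[s [y ->]] NP _].
    - by case: Pn.
    - by case: (north_not_south_pole NP).
    exists (s - top y, y) => /=; last by rewrite addrC subrK.
    by split=> //=; rewrite in_itv /= subr_gt0 andbT; apply/north_cyl.
  split; last exact: cyl_not_pole.
  by apply/north_cyl; move: a0; rewrite in_itv /= andbT ltrDl.
apply: connected_continuous_connected.
  apply: connected_rectangle; apply/connected_intervalP; first exact: interval_is_interval.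
  by move=> x y _ _ z _.
apply: continuous_subspaceT => z.
apply: (@continuous_comp _ _ _ (fun z => (top z.2 + z.1, z.2)) (fun z => cyl z.1 z.2)); last exact: cyl_continuous.
apply: continuous_pair => w; last exact: cvg_snd.
apply: (@continuousD _ _ _ (fun z : R * R => top z.2)); last exact: cvg_fst.
by apply: (@continuous_comp _ _ _ snd top); [exact: cvg_snd|exact: top_continuous].
Qed.

Lemma south_punctured_connected : connected (region_south `\ pole false).
Proof.
have -> : region_south `\ pole false =
    (fun z : R * R => cyl (bot z.2 - z.1) z.2) @` (`]0, +oo[ `*` setT).
  apply/seteqP; split=> [P [NP Pn]|_ [[a y] [/= a0 _] <-]].
    have [SP _] := NP; case/sphereP: SP NP Pn => [[[] ->] NP Pn|[s [y ->]] NP _].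
    - by case: (south_not_north_pole NP).
    - by case: Pn.
    exists (bot y - s, y) => /=; last by rewrite subKr.
    by split=> //=; rewrite in_itv /= subr_gt0 andbT; apply/south_cyl.
  split; last exact: cyl_not_pole.
  by apply/south_cyl; move: a0; rewrite in_itv /= andbT => a0; rewrite ltrBlDr ltrDl.
apply: connected_continuous_connected.
  apply: connected_rectangle; apply/connected_intervalP; first exact: interval_is_interval.
  by move=> x y _ _ z _.
apply: continuous_subspaceT => z.
apply: (@continuous_comp _ _ _ (fun z => (bot z.2 - z.1, z.2)) (fun z => cyl z.1 z.2)); last exact: cyl_continuous.
apply: continuous_pair => w; last exact: cvg_snd.
apply: (@continuousB _ _ _ (fun z : R * R => bot z.2)); last exact: cvg_fst.
by apply: (@continuous_comp _ _ _ snd bot); [exact: cvg_snd|exact: bot_continuous].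
Qed.

(** The middle region is swept by the segments between the strands over the
    turn from the crossing to itself. *)
Lemma mid_connected : connected region_mid.
Proof.
have -> : region_mid = (fun z : R * R =>
    cyl (bot z.2 + z.1 * (top z.2 - bot z.2)) z.2) @` (`]0, 1[ `*` `]ps, (ps + 2 * pi)[).
  apply/seteqP; split=> [P MP|_ [[a y] [/= a0 y0] <-]].
    have [SP _ _] := MP; case/sphereP: SP MP => [[b ->] /mid_not_pole//|[s [y ->]]].
    have p2 : 0 < 2 * pi :> R by rewrite mulr_gt0 // pi_gt0.
    have [z [Ec Es /andP[z1 z2]]] : exists z,
        [/\ cos y = cos z, sin y = sin z & ps <= z < ps + 2 * pi].
      move: y; apply: (@shift_ind R (2 * pi) ps) => // y; last by exists y.
      have := cosD2pi_int y 1; have := sinD2pi_int y 1; rewrite !mulr1 => -> ->.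
      by [].
    have -> : cyl s y = cyl s z by rewrite /cyl Ec Es.
    move=> /mid_cyl /andP[m1 m2].
    have z1' : ps < z.
      rewrite lt_neqAle z1 andbT; apply/eqP => E; move: (lt_trans m1 m2).
      by rewrite /bot /top -E (profile_cross Hk) maxxx minxx ltxx.
    have d0 : 0 < top z - bot z by rewrite subr_gt0 (lt_trans m1).
    exists ((s - bot z) / (top z - bot z), z).
      split=> /=; rewrite in_itv /= ?z1' //.
      apply/andP; split; first by rewrite divr_gt0 // subr_gt0.
      by rewrite ltr_pdivrMr // mul1r ltrD2r.
    by rewrite /= divfK ?gt_eqF // addrC subrK.
  apply/mid_cyl; move: a0 y0; rewrite !in_itv /= => /andP[a0 a1] /bot_lt_top lt.
  have d0 : 0 < top y - bot y by rewrite subr_gt0.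
  rewrite ltrDl mulr_gt0 //= -ltrBrDl -[ltRHS]mul1r ltr_pM2r //.
apply: connected_continuous_connected.
  by apply: connected_rectangle; apply/connected_intervalP; exact: interval_is_interval.
apply: continuous_subspaceT => z.
apply: (@continuous_comp _ _ _ (fun z : R * R => (bot z.2 + z.1 * (top z.2 - bot z.2), z.2))
  (fun z : R * R => cyl z.1 z.2)); last exact: cyl_continuous.
have ct : continuous (fun z : R * R => top z.2).
  by move=> w; apply: (@continuous_comp _ _ _ snd top); [exact: cvg_snd|exact: top_continuous].
have cb : continuous (fun z : R * R => bot z.2).
  by move=> w; apply: (@continuous_comp _ _ _ snd bot); [exact: cvg_snd|exact: bot_continuous].
apply: continuous_pair => w; last exact: cvg_snd.
apply: (@continuousD _ _ _ (fun z : R * R => bot z.2)); first exact: cb.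
apply: cvgM; first exact: cvg_fst.
by apply: (@continuousB _ _ _ (fun z : R * R => top z.2)); [exact: ct|exact: cb].
Qed.

Lemma sphere_pt_meridian_continuous : continuous (fun u : R => sphere_pt u 0).
Proof.
have cs : continuous (fun u : R => 2 * Num.sqrt (u * (1 - u))).
  have cq : continuous (fun u : R => u * (1 - u)).
    move=> u; apply: smooth_at_continuous; apply: smooth_atM; first exact: smooth_at_id.
    by apply: smooth_atB; [exact: smooth_at_cst|exact: smooth_at_id].
  have cr : continuous (fun u : R => Num.sqrt (u * (1 - u))).
    by move=> u; apply: continuous_comp; [exact: cq|exact: sqrt_continuous].
  by move=> u; apply: cvgM; [exact: cvg_cst|exact: cr].
apply: continuous_pair.
  by apply: continuous_pair => u;
    apply: cvgM; first [exact: cs|exact: cvg_cst].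
move=> u; apply: smooth_at_continuous; apply: smooth_atB; first exact: smooth_at_cst.
by apply: smooth_atM; [exact: smooth_at_cst|exact: smooth_at_id].
Qed.

Lemma sphere_pt0 : sphere_pt 0 0 = pole true :> space.
Proof. by rewrite /sphere_pt mul0r sqrtr0 !mulr0 !mul0r subr0. Qed.

Lemma sphere_pt1 : sphere_pt 1 0 = pole false :> space.
Proof.
rewrite /sphere_pt subrr mulr0 sqrtr0 !mulr0 !mul0r mulr1 /pole /= expr1.
by congr (_, _, _); ring.
Qed.

Lemma arc_connected (a b : R) :
  connected ((fun u : R => sphere_pt u 0) @` `[a, b] : set space).
Proof.
apply: connected_continuous_connected; first exact: segment_connected.
exact/continuous_subspaceT/sphere_pt_meridian_continuous.
Qed.

Let sg0 : 0 < sg. Proof. exact: profile_gt0 Hk. Qed.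

(** A meridian arc joins the pole to the punctured region. *)
Lemma north_connected : connected region_north.
Proof.
have L := @lat01 R (sg + 1); have /andP[L0 L1] := L.
have arcN : (fun u : R => sphere_pt u 0) @` `[0, lat (sg + 1)] `<=` region_north.
  move=> _ [u /= + <-]; rewrite in_itv /= => /andP[].
  rewrite le_eqVlt => /predU1P[<- _|u0 ul]; first by rewrite sphere_pt0; exact: north_pole.
  have [|s us] := @lat_surj R u; first by rewrite u0 (le_lt_trans ul).
  rewrite us sphere_pt_lat; apply/north_cyl.
  have : sg + 1 <= s by rewrite leNgt -lat_lt -us -leNgt.
  by have := top_bound 0; rewrite ler_norml => /andP[]; lra.
have -> : region_north =
    (region_north `\ pole true) `|` (fun u : R => sphere_pt u 0) @` `[0, lat (sg + 1)].
  apply/seteqP; split=> [P NP|P [[]//|/arcN//]].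
  have [->|Pn] := pselect (P = pole true); last by left.
  by right; exists 0; rewrite ?sphere_pt0 //= in_itv /= lexx ltW.
apply: connectedU.
- exists (sphere_pt (lat (sg + 1)) 0); split; last first.
    by exists (lat (sg + 1)) => //=; rewrite in_itv /= lexx andbT ltW.
  split; last by rewrite sphere_pt_lat; exact: cyl_not_pole.
  by apply: arcN; exists (lat (sg + 1)) => //=; rewrite in_itv /= lexx andbT ltW.
- exact: north_punctured_connected.
- exact: arc_connected.
Qed.

Lemma south_connected : connected region_south.
Proof.
have L := @lat01 R (- sg - 1); have /andP[L0 L1] := L.
have arcS : (fun u : R => sphere_pt u 0) @` `[lat (- sg - 1), 1] `<=` region_south.
  move=> _ [u /= + <-]; rewrite in_itv /= => /andP[ul].
  rewrite le_eqVlt => /predU1P[->|u1]; first by rewrite sphere_pt1; exact: south_pole.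
  have [|s us] := @lat_surj R u; first by rewrite u1 (lt_le_trans L0).
  rewrite us sphere_pt_lat; apply/south_cyl.
  have : s <= - sg - 1 by rewrite leNgt -lat_lt -us -leNgt.
  by have := bot_bound 0; rewrite ler_norml => /andP[]; lra.
have -> : region_south =
    (region_south `\ pole false) `|` (fun u : R => sphere_pt u 0) @` `[lat (- sg - 1), 1].
  apply/seteqP; split=> [P NP|P [[]//|/arcS//]].
  have [->|Pn] := pselect (P = pole false); last by left.
  by right; exists 1; rewrite ?sphere_pt1 //= in_itv /= lexx andbT ltW.
apply: connectedU.
- exists (sphere_pt (lat (- sg - 1)) 0); split; last first.
    by exists (lat (- sg - 1)) => //=; rewrite in_itv /= lexx /= ltW.
  split; last by rewrite sphere_pt_lat; exact: cyl_not_pole.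
  by apply: arcS; exists (lat (- sg - 1)) => //=; rewrite in_itv /= lexx /= ltW.
- exact: south_punctured_connected.
- exact: arc_connected.
Qed.

Lemma component_north P : region_north P ->
  connected_component (sphere `\` Gamma p g) P = region_north.
Proof.
apply: component_eq north_open north_closed _ _ north_connected P.
  exact: open_pos top_above_cont.
exact: closed_nneg top_above_cont.
Qed.

Lemma component_south P : region_south P ->
  connected_component (sphere `\` Gamma p g) P = region_south.
Proof.
apply: component_eq south_open south_closed _ _ south_connected P.
  exact: open_neg bot_above_cont.
exact: closed_npos bot_above_cont.
Qed.

Lemma component_mid P : region_mid P ->
  connected_component (sphere `\` Gamma p g) P = region_mid.
Proof.
apply: component_eq mid_open mid_closed _ _ mid_connected P.
  apply: openI.
    exact: open_neg top_above_cont.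
  exact: open_pos bot_above_cont.
apply: closedI.
  exact: closed_npos top_above_cont.
exact: closed_nneg bot_above_cont.
Qed.

Lemma mid_nonempty : region_mid !=set0.
Proof.
have p0 := pi_gt0 R.
have H : ps < ps + pi < ps + 2 * pi by apply/andP; split; lra.
have lt := bot_lt_top H.
by exists (cyl ((bot (ps + pi) + top (ps + pi)) / 2) (ps + pi)); apply/mid_cyl;
  rewrite !midf_lt.
Qed.

Lemma regionsE : regions p g = [set region_north; region_south; region_mid].
Proof.
apply/seteqP; split=> [C [P [SP nG] ->]|C].
  have [N|S|M] := regions_cover SP nG.
  - by left; left; exact: component_north.
  - by left; right; exact: component_south.
  - by right; exact: component_mid.
case=> [[->|->]|->].
- exists (pole true); last by rewrite component_north //; exact: north_pole.
  by apply: regions_off; constructor 1; exact: north_pole.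
- exists (pole false); last by rewrite component_south //; exact: south_pole.
  by apply: regions_off; constructor 2; exact: south_pole.
- have [P MP] := mid_nonempty; exists P; last by rewrite component_mid.
  by apply: regions_off; constructor 3.
Qed.

End Regions.

(** * The areas of the polar regions *)
Section Areas.
Context {R : realType} (p : nat) (g k : R -> R) (sg ps : R) (tau : R -> R).
Hypothesis OC : one_crossing p g k sg ps tau.
Local Notation space := (R * R * R)%type.
Local Notation mu := (@lebesgue_measure R).

Let Hk : profile k sg ps. Proof. exact: oc_profile OC. Qed.

Lemma meridian_cases u : 0 <= u <= 1 ->
  [\/ u = 0, u = 1 | exists s : R, u = lat s].
Proof.
move=> /andP[]; rewrite le_eqVlt => /predU1P[<-|u0]; first by constructor 1.
rewrite le_eqVlt => /predU1P[->|u1]; first by constructor 2.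
by constructor 3; apply: lat_surj; rewrite u0.
Qed.

Lemma sphere_pt0E (phi : R) : sphere_pt 0 phi = pole true.
Proof. by rewrite /sphere_pt mul0r sqrtr0 !mulr0 !mul0r subr0. Qed.

Lemma sphere_pt1E (phi : R) : sphere_pt 1 phi = pole false.
Proof.
rewrite /sphere_pt subrr mulr0 sqrtr0 !mulr0 !mul0r mulr1 /pole /= expr1.
by congr (_, _, _); ring.
Qed.

Lemma north_sphere_pt u phi : 0 <= u <= 1 ->
  region_north k (sphere_pt u phi) <-> u < lat (top k phi).
Proof.
have /andP[l0 l1] := lat01 (top k phi).
move=> /meridian_cases[->|->|[s ->]].
- by rewrite sphere_pt0E; split=> // _; exact: north_pole.
- rewrite sphere_pt1E; split=> [/north_not_south_pole//|].
  by move=> /(lt_trans l1); rewrite ltxx.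
- by rewrite sphere_pt_lat lat_lt; exact: north_cyl OC s phi.
Qed.

Lemma south_sphere_pt u phi : 0 <= u <= 1 ->
  region_south k (sphere_pt u phi) <-> lat (bot k phi) < u.
Proof.
have /andP[l0 l1] := lat01 (bot k phi).
move=> /meridian_cases[->|->|[s ->]].
- rewrite sphere_pt0E; split=> [/south_not_north_pole//|].
  by move=> /(lt_trans l0); rewrite ltxx.
- by rewrite sphere_pt1E; split=> // _; exact: south_pole.
- by rewrite sphere_pt_lat lat_lt; exact: south_cyl OC s phi.
Qed.

Lemma lat_top_bot y :
  lat (top k y) + lat (bot k y) = lat (k y) + lat (k (y + 2 * pi)).
Proof. by rewrite /top /bot maxEle minEle; case: ifP => _; rewrite // addrC. Qed.

End Areas.

Section Strips.
Context {R : realType}.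
Local Notation mu := (@lebesgue_measure R).

Lemma measurable_itv_section (sa sb : bool) (a b : R -> R) :
  continuous a -> continuous b ->
  measurable [set z : R * R | z.1 \in Interval (BSide sa (a z.2)) (BSide sb (b z.2))].
Proof.
move=> ca cb.
have m1 : measurable_fun [set: R * R] (fst : R * R -> R) by exact: measurable_fst.
have ma : measurable_fun [set: R * R] (fun z : R * R => a z.2).
  by apply: measurableT_comp; [exact: continuous_measurable_fun|exact: measurable_snd].
have mb : measurable_fun [set: R * R] (fun z : R * R => b z.2).
  by apply: measurableT_comp; [exact: continuous_measurable_fun|exact: measurable_snd].
have lt (f h : R * R -> R) : measurable_fun setT f -> measurable_fun setT h ->
    measurable [set z | f z < h z].
  move=> mf mh; have := measurable_fun_ltr mf mh measurableT (Y := [set true]).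
  rewrite setTI => H; suff -> : [set z | f z < h z] = (fun z => f z < h z) @^-1` [set true].
    exact: H.
  by apply/seteqP; split=> z /=.
have le (f h : R * R -> R) : measurable_fun setT f -> measurable_fun setT h ->
    measurable [set z | f z <= h z].
  move=> mf mh; suff -> : [set z | f z <= h z] = ~` [set z | h z < f z].
    by apply: measurableC; exact: lt.
  by apply/seteqP; split=> z /=; rewrite leNgt => /negP.
rewrite (_ : [set z | _] = [set z : R * R | if sa then a z.2 <= z.1 else a z.2 < z.1]
   `&` [set z : R * R | if sb then z.1 < b z.2 else z.1 <= b z.2]); last first.
  by case: sa; case: sb; apply/seteqP; split=> z /=; rewrite in_itv /=;
    first [by move=> /andP[]|by move=> [-> ->]].
by apply: measurableI; [case: sa; [exact: le|exact: lt]|case: sb; [exact: lt|exact: le]].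
Qed.

(** Fubini; the sections are intervals. *)
Lemma measure_strip (A : set (R * R)) (sa sb : bool) (a b : R -> R) (c : R) :
  (forall y, a y < b y) -> continuous a -> continuous b ->
  (forall z, A z <-> z.1 \in Interval (BSide sa (a z.2)) (BSide sb (b z.2)) /\
                     0 <= z.2 < c) ->
  ((mu \x mu) A = \int[mu]_(y in `[0%R, c]) (b y - a y)%:E)%E.
Proof.
move=> ab ca cb AE.
have mA : measurable A.
  rewrite (_ : A = [set z : R * R | z.1 \in Interval (BSide sa (a z.2)) (BSide sb (b z.2))]
    `&` (setT `*` `[0, c[)); last first.
    apply/seteqP; split=> z.
      by move=> /AE[z1 z2]; split=> //; split=> //=; rewrite in_itv.
    by move=> [z1 [_ z2]]; apply/AE; split=> //; move: z2; rewrite /= in_itv.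
  by apply: measurableI; [exact: measurable_itv_section|exact: measurableX].
have cba : continuous (fun y => b y - a y).
  by move=> y; apply: continuousB; [exact: cb|exact: ca].
rewrite (product_measure_unique (m' := (mu \x^ mu)%E)) //; last first.
  by move=> X Y mX mY; exact: product_measure2E.
rewrite -integral_itv_bndo_bndc; last first.
  apply/measurable_EFinP; apply: measurable_funS measurableT _ _ => //.
  exact: continuous_measurable_fun.
rewrite [RHS]integral_mkcond /product_measure2; apply: eq_integral => y _ /=.
rewrite patchE; case: ifPn; rewrite ?inE ?notin_setE /= in_itv /= => yc.
  rewrite (_ : ysection A y = [set` Interval (BSide sa (a y)) (BSide sb (b y))]).
    by rewrite lebesgue_measure_itv /= lte_fin ab EFinB.
  by apply/seteqP; split=> x; [move=> /ysectionP/AE[]|move=> xi; apply/ysectionP/AE].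
rewrite (_ : ysection A y = set0) ?measure0 //.
by rewrite -subset0 => x /ysectionP/AE[].
Qed.

End Strips.

Section EqualAreas.
Context {R : realType} (p : nat) (g k : R -> R) (sg ps : R) (tau : R -> R).
Hypothesis OC : one_crossing p g k sg ps tau.
Local Notation mu := (@lebesgue_measure R).

Let latc : continuous (@lat R).
Proof. by move=> s; exact/smooth_at_continuous/lat_smooth_at. Qed.

Let ltc : continuous (fun phi => lat (top k phi)).
Proof. by move=> y; apply: continuous_comp; [exact: top_continuous OC y|exact: latc]. Qed.

Let lbc : continuous (fun phi => lat (bot k phi)).
Proof. by move=> y; apply: continuous_comp; [exact: bot_continuous OC y|exact: latc]. Qed.

(** The areas are the integrals of [lat top] and [1 - lat bot].  Since the two
    strands together are [top] and [bot], the difference is the integral of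
    [1 - lat k] over the two turns of the knot, on which the latitude has
    mean value 1/2. *)
Lemma area_north_south : area p (region_north k) = area p (region_south k).
Proof.
have p0 := pi_gt0 R.
have [G [DG GT]] := oc_antiderivative OC.
rewrite /area; congr (_ * fine _).
rewrite (@measure_strip R _ true true (fun=> 0) (fun y => lat (top k y)) (2 * pi)); last first.
- move=> z; rewrite in_itv /=; split.
    move=> [z01 z2 /(north_sphere_pt OC _ z01) H]; split=> //.
    by have /andP[z0 _] := z01; rewrite z0.
  move=> [/andP[z0 zt] z2]; have /andP[_ l1] := lat01 (top k z.2).
  have z1 : 0 <= z.1 <= 1 by rewrite z0 ltW // (lt_trans zt).
  by split=> //; apply/(north_sphere_pt OC).
- exact: ltc.
- exact: cst_continuous.
- by move=> y; have /andP[] := lat01 (top k y).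
rewrite (@measure_strip R _ false false (fun y => lat (bot k y)) (fun=> 1) (2 * pi)); last first.
- move=> z; rewrite in_itv /=; split.
    move=> [z01 z2 /(south_sphere_pt OC _ z01) H]; split=> //.
    by have /andP[_ z1] := z01; rewrite z1 andbT.
  move=> [/andP[zb z1] z2]; have /andP[l0 _] := lat01 (bot k z.2).
  have z01 : 0 <= z.1 <= 1 by rewrite z1 andbT ltW // (lt_trans l0).
  by split=> //; apply/(south_sphere_pt OC).
- exact: cst_continuous.
- exact: lbc.
- by move=> y; have /andP[] := lat01 (bot k y).
have Dsh (y : R) : is_derive y 1 (fun y => G (y + 2 * pi)) (lat (k (y + 2 * pi))).
  have := is_derive_affine 1 (2 * pi) y.
  rewrite (_ : (fun t => 1 * t + 2 * pi) = (fun t : R => t + 2 * pi)); last first.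
    by apply/funext => t; rewrite mul1r.
  move=> Da; have := @is_derive1_comp R G (fun t => t + 2 * pi) y _ _ (DG _) Da.
  by rewrite mulr1.
pose F y := y - G y - G (y + 2 * pi).
pose f y := 1 - lat (k y) - lat (k (y + 2 * pi)).
have DF (y : R) : is_derive y 1 F (f y).
  exact: is_deriveB (is_deriveB (is_derive_id y (1 : R)) (DG y)) (Dsh y).
have fE y : f y = (1 - lat (bot k y)) - lat (top k y).
  by rewrite /f; have := lat_top_bot k y; lra.
have cf : continuous f.
  rewrite (_ : f = fun y => (1 - lat (bot k y)) - lat (top k y)); last exact/funext.
  by move=> y; apply: cvgB; [apply: cvgB; [exact: cvg_cst|exact: lbc]|exact: ltc].
have cF : continuous F.
  move=> y; apply: differentiable_continuous; apply/derivable1_diffP.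
  by have := DF y; move=> H; exact: ex_derive.
have If : (\int[mu]_(y in `[0%R, (2 * pi)%R]) (f y)%:E = 0)%E.
  rewrite (@continuous_FTC2 R f F 0 (2 * pi)) //; first last.
  - by move=> y _; rewrite derive1E; have [] := DF y.
  - split=> [y _||]; first by have := DF y; move=> H; exact: ex_derive.
      by apply: cvg_at_right_filter; exact: cF.
    by apply: cvg_at_left_filter; exact: cF.
  - exact: continuous_subspaceT.
  - by lra.
  rewrite -EFinB /F !add0r (_ : 2 * pi + 2 * pi = 0 + 4 * pi); last by ring.
  by rewrite GT; congr (_%:E); ring.
have int h : continuous h -> mu.-integrable `[0, 2 * pi] (EFin \o h).
  move=> ch; apply: continuous_compact_integrable; first exact: segment_compact.
  exact: continuous_subspaceT.
have intt := int (fun y => lat (top k y) - 0).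
rewrite -[LHS]adde0 -If -integralD //=; first last.
- exact: int cf.
- by apply: intt => y; apply: cvgB; [exact: ltc|exact: cvg_cst].
by apply: eq_integral => y _; rewrite -EFinD fE; congr (_%:E); ring.
Qed.

End EqualAreas.

(** * The multiplicities of a disc *)
Section LocalInverse.
Context {R : realType}.
Local Notation plane := (R * R)%type.
Local Notation space := (R * R * R)%type.
Lemma axis_derive (u : plane -> R) (z : plane) : smooth_at u z ->
  is_derive z.1 (1 : R) (fun t => u (t, z.2)) ('D_e1 u z) /\
  is_derive z.2 (1 : R) (fun t => u (z.1, t)) ('D_e2 u z).
Proof.
move=> Hu.
have D (v : plane) : derivable u z v by exact: smooth_at_derivable.
have E1 : (fun h : R => h^-1 *: (u (h *: 1 + z.1, z.2) - u (z.1, z.2))) =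
          (fun h => h^-1 *: (u (h *: e1 + z) - u z)).
  apply/funext => h; have -> : h *: e1 + z = (h *: 1 + z.1, z.2) :> plane.
    by apply: injective_projections => //=; rewrite [X in X + _]mulr0 add0r.
  by rewrite -surjective_pairing.
have E2 : (fun h : R => h^-1 *: (u (z.1, h *: 1 + z.2) - u (z.1, z.2))) =
          (fun h => h^-1 *: (u (h *: e2 + z) - u z)).
  apply/funext => h; have -> : h *: e2 + z = (z.1, h *: 1 + z.2) :> plane.
    by apply: injective_projections => //=; rewrite [X in X + _]mulr0 add0r.
  by rewrite -surjective_pairing.
split; apply: DeriveDef.
- by have := D e1; rewrite /derivable -E1.
- by rewrite /derive E1.
- by have := D e2; rewrite /derivable -E2.
- by rewrite /derive E2.
Qed.

Lemma ball_box (z : plane) (r : R) (a : plane) :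
  ball z r a <-> `|z.1 - a.1| < r /\ `|z.2 - a.2| < r.
Proof. by []. Qed.

(** The increment is split along the two axes, where the mean value theorem
    applies. *)
Lemma small_derivatives_contract (u : plane -> R) (z0 : plane) :
  smooth_at u z0 -> 'D_e1 u z0 = 0 -> 'D_e2 u z0 = 0 ->
  \forall r \near (0 : R)^'+, forall a b, ball z0 r a -> ball z0 r b ->
    `|u a - u b| <= 2^-1 * `|a - b|.
Proof.
move=> Hu D1 D2.
have N1 v : 'D_v u z0 = 0 -> \forall z \near z0, `|'D_v u z| < 4^-1.
  move=> Dv; have /smooth_at_continuous C := smooth_at_derive v Hu.
  have : (`|'D_v u z| @[z --> z0] --> `|'D_v u z0|) by exact: cvg_norm C.
  by move/cvgr_lt; apply; rewrite Dv normr0; lra.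
have N0 : \forall z \near z0, smooth_at u z := smooth_at_near Hu.
have : \forall z \near z0, [/\ smooth_at u z, `|'D_e1 u z| < 4^-1 & `|'D_e2 u z| < 4^-1].
  by apply: filterS3 N0 (N1 _ D1) (N1 _ D2) => z ? ? ?; split.
move=> /nbhs_ballP[r0 /= r0_gt0 Hr0].
near=> r.
have rr : r <= r0 by near: r; exact: nbhs_right_le.
have H z : ball z0 r z -> [/\ smooth_at u z, `|'D_e1 u z| < 4^-1 & `|'D_e2 u z| < 4^-1].
  by move=> Bz; apply: Hr0; exact: le_ball Bz.
have step (w : R -> R) (dw : R -> R) (a b : R) :
    (forall t, t \in `[a, b] -> is_derive t (1:R) w (dw t) /\ `|dw t| < 4^-1) -> a <= b ->
    `|w b - w a| <= 4^-1 * `|b - a|.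
  move=> Hw ab; have [||c cab ->] := @MVT_segment R w dw a b ab.
  - by move=> t /subset_itv_oo_cc tab; have [] := Hw t tab.
  - apply: derivable_within_continuous => t tab.
    by have [[]] := Hw t tab.
  by rewrite normrM ler_wpM2r // ltW //; have [] := Hw c cab.
have stepw (w : R -> R) (dw : R -> R) (c a b : R) : `|c - a| < r -> `|c - b| < r ->
    (forall t, `|c - t| < r -> is_derive t (1:R) w (dw t) /\ `|dw t| < 4^-1) ->
    `|w a - w b| <= 4^-1 * `|a - b|.
  move=> ca cb Hw; have [ab|/ltW ba] := leP a b.
    rewrite distrC (distrC a); apply: step ab => t tab; apply: Hw.
    by move: tab ca cb; rewrite in_itv /= !ltr_norml; lra.
  apply: step ba => t tab; apply: Hw.
  by move: tab ca cb; rewrite in_itv /= !ltr_norml; lra.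
move=> [a1 a2] [b1 b2] /ball_box[/= A1 A2] /ball_box[/= B1 B2].
have S1 : `|u (a1, a2) - u (b1, a2)| <= 4^-1 * `|a1 - b1|.
  apply: (stepw (fun t => u (t, a2)) (fun t => 'D_e1 u (t, a2)) z0.1 _ _ A1 B1) => t ct.
  have [//|st d1 d2] := H (t, a2).
  by split; [exact: (axis_derive st).1|exact: d1].
have S2 : `|u (b1, a2) - u (b1, b2)| <= 4^-1 * `|a2 - b2|.
  apply: (stepw (fun t => u (b1, t)) (fun t => 'D_e2 u (b1, t)) z0.2 _ _ A2 B2) => t ct.
  have [//|st d1 d2] := H (b1, t).
  by split; [exact: (axis_derive st).2|exact: d2].
have M1 : `|a1 - b1| <= `|(a1, a2) - (b1, b2)| by rewrite [leRHS]prod_normE /= le_max lexx.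
have M2 : `|a2 - b2| <= `|(a1, a2) - (b1, b2)| by rewrite [leRHS]prod_normE /= le_max lexx orbT.
have -> : u (a1, a2) - u (b1, b2) = (u (a1, a2) - u (b1, a2)) + (u (b1, a2) - u (b1, b2)) by ring.
apply: le_trans (ler_normD _ _) _.
have : 2^-1 = 4^-1 + 4^-1 :> R by field.
move=> ->; rewrite mulrDl; apply: lerD.
  by apply: le_trans S1 _; rewrite ler_wpM2l //; lra.
by apply: le_trans S2 _; rewrite ler_wpM2l //; lra.
Unshelve. all: by end_near. Qed.

Lemma derive_coordinates (z v : plane) :
  'D_v (fst : plane -> R) z = v.1 /\ 'D_v (snd : plane -> R) z = v.2.
Proof.
have D : differentiable (id : plane -> plane) z by exact: smooth_at_diff (smooth_at_id z).
have I : 'D_v (id : plane -> plane) z = v by exact: derive_id.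
split.
  have := @derive_lin_comp R plane plane R id fst z v (@continuous_fst_pair R _ _) D.
  by rewrite I.
have := @derive_lin_comp R plane plane R id snd z v (@continuous_snd_pair R _ _) D.
by rewrite I.
Qed.

Lemma max_norm (a b : plane) (M : R) :
  `|a - b| <= M <-> `|a.1 - b.1| <= M /\ `|a.2 - b.2| <= M.
Proof.
by rewrite [X in X <= _]prod_normE /= ge_max; split=> [/andP//|[-> ->]].
Qed.

(** The local inverse function theorem at a point where the derivative is the
    identity.  A value close to that of the center is attained because the
    distance to it cannot have a positive minimum on the closed square: one
    step of the Newton iteration would halve it. *)
Lemma local_inverse (h1 h2 : plane -> R) (z0 : plane) :
  smooth_at h1 z0 -> smooth_at h2 z0 ->
  'D_e1 h1 z0 = 1 -> 'D_e2 h1 z0 = 0 -> 'D_e1 h2 z0 = 0 -> 'D_e2 h2 z0 = 1 ->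
  \forall r \near (0 : R)^'+,
    (forall a b, ball z0 r a -> ball z0 r b ->
       h1 a = h1 b -> h2 a = h2 b -> a = b) /\
    (forall w1 w2, `|w1 - h1 z0| <= r / 4 -> `|w2 - h2 z0| <= r / 4 ->
       exists z, [/\ ball z0 r z, h1 z = w1 & h2 z = w2]).
Proof.
move=> H1 H2 D11 D12 D21 D22.
have S1 : smooth_at (fst : plane -> R) z0 by apply: (smooth_at_fst (smooth_at_id _)).
have S2 : smooth_at (snd : plane -> R) z0 by apply: (smooth_at_snd (smooth_at_id _)).
have C1 : \forall r \near (0 : R)^'+, forall a b, ball z0 r a -> ball z0 r b ->
    `|(a.1 - h1 a) - (b.1 - h1 b)| <= 2^-1 * `|a - b|.
  apply: (@small_derivatives_contract (fun z => z.1 - h1 z)).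
  - exact: smooth_atB.
  - by rewrite smooth_deriveB // (derive_coordinates _ _).1 D11 subrr.
  - by rewrite smooth_deriveB // (derive_coordinates _ _).1 D12 subrr.
have C2 : \forall r \near (0 : R)^'+, forall a b, ball z0 r a -> ball z0 r b ->
    `|(a.2 - h2 a) - (b.2 - h2 b)| <= 2^-1 * `|a - b|.
  apply: (@small_derivatives_contract (fun z => z.2 - h2 z)).
  - exact: smooth_atB.
  - by rewrite smooth_deriveB // (derive_coordinates _ _).2 D21 subrr.
  - by rewrite smooth_deriveB // (derive_coordinates _ _).2 D22 subrr.
have N1 : \forall z \near z0, smooth_at h1 z := smooth_at_near H1.
have N2 : \forall z \near z0, smooth_at h2 z := smooth_at_near H2.
have : \forall z \near z0, smooth_at h1 z /\ smooth_at h2 z.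
  by near=> z; split; near: z.
move=> /nbhs_ballP[r0 /= r0_gt0 Hr0].
near=> r.
have r_gt0 : 0 < r by near: r; exact: nbhs_right_gt.
have rr : r <= r0 by near: r; exact: nbhs_right_le.
have K1 : forall a b, ball z0 r a -> ball z0 r b ->
    `|(a.1 - h1 a) - (b.1 - h1 b)| <= 2^-1 * `|a - b| by near: r; exact: C1.
have K2 : forall a b, ball z0 r a -> ball z0 r b ->
    `|(a.2 - h2 a) - (b.2 - h2 b)| <= 2^-1 * `|a - b| by near: r; exact: C2.
split=> [a b Ba Bb E1 E2|w1 w2 W1 W2].
  have : `|a - b| <= 2^-1 * `|a - b|.
    apply/max_norm; split.
      by have := K1 a b Ba Bb; rewrite E1 (_ : _ - _ - _ = a.1 - b.1) //; ring.
    by have := K2 a b Ba Bb; rewrite E2 (_ : _ - _ - _ = a.2 - b.2) //; ring.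
  by have := normr_ge0 (a - b) => n0 n1; apply/eqP; rewrite -subr_eq0 -normr_eq0; lra.
pose K : set plane := `[z0.1 - r / 2, z0.1 + r / 2] `*` `[z0.2 - r / 2, z0.2 + r / 2].
have KE (z : plane) : K z <-> `|z.1 - z0.1| <= r / 2 /\ `|z.2 - z0.2| <= r / 2.
  by rewrite /K /= !in_itv /= -!ler_distl.
have [r2 rr2] : 0 <= r / 2 /\ r / 2 < r by clear -r_gt0; split; lra.
have KB z : K z -> ball z0 r z.
  by move=> /KE[k1 k2]; apply/ball_box; rewrite distrC (distrC z0.2); split; exact: le_lt_trans rr2.
have cK : compact K by apply: compact_setX; exact: segment_compact.
have K0 : K z0 by apply/KE; rewrite !subrr normr0.
pose phi (z : plane) := `|(w1, w2) - (h1 z, h2 z)|.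
have cphi : {within K, continuous phi}.
  apply: continuous_in_subspaceT => z /set_mem /KB Bz.
  have [s1 s2] := Hr0 z (le_ball rr Bz).
  apply: cvg_norm; apply: cvgB; first exact: cvg_cst.
  exact: (smooth_at_continuous (smooth_at_pair s1 s2)).
have [z /set_mem Kz zmin] := compact_EVT_min (ex_intro _ z0 K0) cK cphi.
pose z' : plane := (z.1 + (w1 - h1 z), z.2 + (w2 - h2 z)).
have Bz := KB z Kz; have B0 := KB z0 K0.
have zz0 : `|z - z0| <= r / 2 by apply/max_norm/KE.
have Kz' : K z'.
  apply/KE => /=; split.
    rewrite (_ : _ - _ = ((z.1 - h1 z) - (z0.1 - h1 z0)) + (w1 - h1 z0)); last by ring.
    by apply: le_trans (ler_normD _ _) _; have := K1 z z0 Bz B0; clear -zz0 W1; lra.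
  rewrite (_ : _ - _ = ((z.2 - h2 z) - (z0.2 - h2 z0)) + (w2 - h2 z0)); last by ring.
  by apply: le_trans (ler_normD _ _) _; have := K2 z z0 Bz B0; clear -zz0 W2; lra.
have Bz' := KB z' Kz'.
have step : `|z' - z| = phi z.
  by rewrite /phi; congr (`|_|); rewrite /z'; congr (_, _) => /=; ring.
have le : phi z' <= 2^-1 * phi z.
  rewrite -step; apply/max_norm => /=; split.
    have := K1 z z' Bz Bz'; rewrite distrC (_ : _ - _ - _ = w1 - h1 z') ?(distrC z) //.
    by rewrite /z' /=; ring.
  have := K2 z z' Bz Bz'; rewrite distrC (_ : _ - _ - _ = w2 - h2 z') ?(distrC z) //.
  by rewrite /z' /=; ring.
have := zmin z' (mem_set Kz') => min'.
have phi0 : 0 <= phi z by exact: normr_ge0.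
have : phi z = 0 by clear -le min' phi0; lra.
rewrite /phi => /normr0_eq0 [] E1 E2.
exists z; split=> //; apply/eqP; rewrite eq_sym -subr_eq0; apply/eqP; [exact: E1|exact: E2].
Unshelve. all: by end_near. Qed.

Lemma det3_derive (V : normedModType R) (f : V -> space) (z v : V) (a b : space) (d : R) :
  smooth_at f z ->
  smooth_at (fun y => det3 a (f y) b / d) z /\
  'D_v (fun y => det3 a (f y) b / d) z = det3 a ('D_v f z) b / d.
Proof.
move=> Hf; have Hx := smooth_at_x Hf; have Hy := smooth_at_y Hf.
have Hw := smooth_at_snd Hf.
pose c1 := (a.2 * b.1.2 - a.1.2 * b.2) / d.
pose c2 := (a.1.1 * b.2 - a.2 * b.1.1) / d.
pose c3 := (a.1.2 * b.1.1 - a.1.1 * b.1.2) / d.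
have -> : (fun y => det3 a (f y) b / d) =
    (fun y => c1 * (f y).1.1 + (c2 * (f y).1.2 + c3 * (f y).2)).
  by apply/funext => y; rewrite /det3 /c1 /c2 /c3; ring.
have S1 : smooth_at (fun y => c1 * (f y).1.1) z by apply: smooth_atM => //; exact: smooth_at_cst.
have S2 : smooth_at (fun y => c2 * (f y).1.2) z by apply: smooth_atM => //; exact: smooth_at_cst.
have S3 : smooth_at (fun y => c3 * (f y).2) z by apply: smooth_atM => //; exact: smooth_at_cst.
have S23 := smooth_atD S2 S3.
split; first exact: smooth_atD.
rewrite smooth_deriveD // smooth_deriveD // !smooth_deriveZ // (derive_components _ Hf).
by rewrite /det3 /c1 /c2 /c3 /=; ring.
Qed.

(** A line parallel to [a] meets the sphere at most once on each side of the
    plane orthogonal to [a]. *)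
Lemma sphere_line_inj (a P Q : space) (t : R) : sphere P -> sphere Q ->
  sphere a ->
  Q = (P.1.1 + t * a.1.1, P.1.2 + t * a.1.2, P.2 + t * a.2) ->
  0 < P.1.1 * a.1.1 + P.1.2 * a.1.2 + P.2 * a.2 ->
  0 < Q.1.1 * a.1.1 + Q.1.2 * a.1.2 + Q.2 * a.2 -> Q = P.
Proof.
case: P => [[p1 p2] p3]; case: a => [[a1 a2] a3]; rewrite /sphere /= => P1 Q1 A1 QE.
move: Q1; rewrite QE /= => Q1 d1 d2.
set s := p1 * a1 + p2 * a2 + p3 * a3 in d1.
have d2' : 0 < s + t.
  have : s + t * (a1 ^+ 2 + a2 ^+ 2 + a3 ^+ 2) = s + t by rewrite A1 mulr1.
  by move=> <-; move: d2; rewrite /s; congr (0 < _); ring.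
have : t * (s + (s + t)) = 0.
  transitivity (((p1 + t * a1) ^+ 2 + (p2 + t * a2) ^+ 2 + (p3 + t * a3) ^+ 2)
    - (p1 ^+ 2 + p2 ^+ 2 + p3 ^+ 2) - t ^+ 2 * (a1 ^+ 2 + a2 ^+ 2 + a3 ^+ 2 - 1)).
    by rewrite /s; ring.
  by rewrite Q1 P1 A1; ring.
move=> /eqP; rewrite mulf_eq0 => /orP[/eqP -> | /eqP t0].
  by rewrite !mul0r !addr0.
by exfalso; move: d1 d2' t0; lra.
Qed.

Lemma det3_eq (a b : space) : det3 a b b = 0.
Proof. by rewrite /det3; ring. Qed.

Lemma det3_swap (a b c : space) : det3 a c b = - det3 a b c.
Proof. by rewrite /det3; ring. Qed.

Lemma det3B (a P Q b : space) : det3 a P b - det3 a Q b =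
  det3 a (P.1.1 - Q.1.1, P.1.2 - Q.1.2, P.2 - Q.2) b.
Proof. by rewrite /det3 /=; ring. Qed.

(** Cramer's rule. *)
Lemma det3_decompose (a b c w : space) : det3 a b c != 0 ->
  det3 a w c / det3 a b c = 0 -> det3 a w b / - det3 a b c = 0 ->
  exists t, w = (t * a.1.1, t * a.1.2, t * a.2).
Proof.
move=> d0 E1 E2; exists (det3 w b c / det3 a b c).
have {}E1 : det3 a w c = 0 by move/eqP: E1; rewrite mulf_eq0 invr_eq0 (negbTE d0) orbF => /eqP.
have {}E2 : det3 a w b = 0 by move/eqP: E2; rewrite mulf_eq0 invr_eq0 oppr_eq0 (negbTE d0) orbF => /eqP.
have K1 : det3 a b c * w.1.1 = det3 w b c * a.1.1 + det3 a w c * b.1.1 - det3 a w b * c.1.1.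
  by rewrite /det3; ring.
have K2 : det3 a b c * w.1.2 = det3 w b c * a.1.2 + det3 a w c * b.1.2 - det3 a w b * c.1.2.
  by rewrite /det3; ring.
have K3 : det3 a b c * w.2 = det3 w b c * a.2 + det3 a w c * b.2 - det3 a w b * c.2.
  by rewrite /det3; ring.
have {}K1 : det3 a b c * w.1.1 = det3 w b c * a.1.1 by rewrite K1 E1 E2; ring.
have {}K2 : det3 a b c * w.1.2 = det3 w b c * a.1.2 by rewrite K2 E1 E2; ring.
have {}K3 : det3 a b c * w.2 = det3 w b c * a.2 by rewrite K3 E1 E2; ring.
move: K1 K2 K3; clear E1 E2; set w' := w => K1 K2 K3; rewrite [LHS](_ : w = (w.1.1, w.1.2, w.2)); last by case: (w) => [[]].
have N u v : det3 a b c * u = det3 w' b c * v -> u = det3 w' b c / det3 a b c * v.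
  by move=> E; apply: (mulfI d0); rewrite E [RHS]mulrA [_ * (_ / _)]mulrC divfK.
by rewrite (N _ _ K1) (N _ _ K2) (N _ _ K3).
Qed.

(** Projecting along the radius of [f z0] reduces the statement to the planar
    case. *)
Lemma immersed_local_inverse (f : plane -> space) (z0 : plane) :
  smooth_at f z0 -> (\forall z \near z0, sphere (f z)) -> immersed_at f z0 ->
  \forall r \near (0 : R)^'+,
    (forall y z, ball z0 r y -> ball z0 r z -> f y = f z -> y = z) /\
    (\forall P \near f z0, sphere P -> exists2 z, ball z0 r z & f z = P).
Proof.
move=> Hf Hs; rewrite /immersed_at.
have [a Ea] : exists a, f z0 = a by exists (f z0).
have [b Eb] : exists b, 'D_e1 f z0 = b by exists ('D_e1 f z0).
have [c Ec] : exists c, 'D_e2 f z0 = c by exists ('D_e2 f z0).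
rewrite Ea Eb Ec => d_gt0.
have d0 : det3 a b c != 0 by rewrite gt_eqF.
pose dot (P : space) := P.1.1 * a.1.1 + P.1.2 * a.1.2 + P.2 * a.2.
have sa : sphere a by rewrite -Ea; exact: nbhs_singleton Hs.
have da : dot a = 1 by rewrite -sa /dot !expr2.
have cdot (g : space -> space) (P : space) : smooth_at g P -> {for P, continuous (fun P => dot (g P))}.
  move=> sg; apply: smooth_at_continuous; rewrite /dot.
  have Hx := smooth_at_x sg; have Hy := smooth_at_y sg; have Hw := smooth_at_snd sg.
  by do 2?[apply: smooth_atD]; apply: smooth_atM => //; exact: smooth_at_cst.
have Ndot : \forall P \near a, 0 < dot P.
  have C := cdot id a (smooth_at_id a).
  by move: C => /cvgr_gt; apply; rewrite da; lra.
have Cf : f z @[z --> z0] --> a by rewrite -Ea; exact: smooth_at_continuous Hf.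
have Nf : \forall z \near z0, sphere (f z) /\ 0 < dot (f z).
  near=> z; split; first by near: z.
  by near: z; exact: Cf Ndot.
move: Nf => /nbhs_ballP[r0 /= r0_gt0 Hr0].
pose h1 (P : space) := det3 a P c / det3 a b c.
pose h2 (P : space) := det3 a P b / - det3 a b c.
have [s1 _] := det3_derive e1 a c (det3 a b c) Hf.
have [s2 _] := det3_derive e1 a b (- det3 a b c) Hf.
have D (v : plane) x d := (det3_derive v a x d Hf).2.
have N := @local_inverse (fun z => h1 (f z)) (fun z => h2 (f z)) z0 s1 s2.
have {}N : \forall r \near (0 : R)^'+,
    (forall a b, ball z0 r a -> ball z0 r b ->
       h1 (f a) = h1 (f b) -> h2 (f a) = h2 (f b) -> a = b) /\
    (forall w1 w2, `|w1 - h1 (f z0)| <= r / 4 -> `|w2 - h2 (f z0)| <= r / 4 ->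
       exists z, [/\ ball z0 r z, h1 (f z) = w1 & h2 (f z) = w2]).
  apply: N; rewrite /h1 /h2 D ?Eb ?Ec.
  - by rewrite divff.
  - by rewrite det3_eq mul0r.
  - by rewrite det3_eq mul0r.
  - by rewrite det3_swap divff // oppr_eq0.
have lin x d P Q : det3 a P x / d = det3 a Q x / d ->
    det3 a (P.1.1 - Q.1.1, P.1.2 - Q.1.2, P.2 - Q.2) x / d = 0.
  move=> E; transitivity (det3 a P x / d - det3 a Q x / d); last by rewrite E subrr.
  by rewrite -mulrBl det3B.
near=> r.
have r_gt0 : 0 < r by near: r; exact: nbhs_right_gt.
have rr : r <= r0 by near: r; exact: nbhs_right_le.
have [inj onto] : (forall a b, ball z0 r a -> ball z0 r b ->
       h1 (f a) = h1 (f b) -> h2 (f a) = h2 (f b) -> a = b) /\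
    (forall w1 w2, `|w1 - h1 (f z0)| <= r / 4 -> `|w2 - h2 (f z0)| <= r / 4 ->
       exists z, [/\ ball z0 r z, h1 (f z) = w1 & h2 (f z) = w2]) by near: r.
split=> [y z By Bz E|]; first by apply: inj; rewrite ?E.
have r4 : 0 < r / 4 by lra.
have C (x : space) d : \forall P \near a, `|det3 a P x / d - det3 a a x / d| <= r / 4.
  have [s _] := det3_derive a a x d (smooth_at_id a).
  have := smooth_at_continuous s; move=> /cvgr_distC_le; apply; exact: r4.
near=> P => sP.
rewrite Ea in onto.
have w1 : `|h1 P - h1 a| <= r / 4 by near: P; exact: C.
have w2 : `|h2 P - h2 a| <= r / 4 by near: P; exact: C.
have [z [Bz E1 E2]] := onto _ _ w1 w2.
have [sz dz] := Hr0 z (le_ball rr Bz).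
exists z => //; have [t] := det3_decompose d0 (lin _ _ _ _ E1) (lin _ _ _ _ E2).
move=> [t1 t2 t3]; apply: (@sphere_line_inj a P (f z) t) => //; last by near: P.
rewrite -t1 -t2 -t3; case: (f z) => [[? ?] ?] /=; congr (_, _, _); ring.
Unshelve. all: by end_near. Qed.
End LocalInverse.

(* The covering form of compactness is stated for pointed spaces, and is
   applied to the plane. *)
HB.saturate prod.

Section Multiplicity.
Context {R : realType}.
Local Notation plane := (R * R)%type.
Local Notation space := (R * R * R)%type.

Lemma sqr_norm_continuous : continuous (fun z : plane => z.1 ^+ 2 + z.2 ^+ 2 - 1).
Proof.
move=> z; have s1 := smooth_at_fst (smooth_at_id z).
have s2 := smooth_at_snd (smooth_at_id z).
apply: smooth_at_continuous; apply: smooth_atB; last exact: smooth_at_cst.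
by apply: smooth_atD; exact: smooth_at_sqr.
Qed.

Lemma disc_compact : compact (disc : set plane).
Proof.
have cS : compact (`[(-1 : R), 1] `*` `[(-1 : R), 1] : set plane).
  by apply: compact_setX; exact: segment_compact.
apply: subclosed_compact cS _.
  have := closed_npos sqr_norm_continuous.
  by congr closed; apply/seteqP; split=> z /=; rewrite /disc /= subr_le0.
move=> [x y]; rewrite /disc /= => H; rewrite !in_itv /=.
have Hx := sqr_ge0 x; have Hy := sqr_ge0 y.
by split; rewrite -ler_norml -(@ler_sqr _ `|_|) ?nnegrE // ?real_normK ?num_real // expr1n; lra.
Qed.

Lemma open_disc_open : open (open_disc : set plane).
Proof.
have := open_neg sqr_norm_continuous.
by congr open; apply/seteqP; split=> z /=; rewrite /open_disc /= subr_lt0.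
Qed.

Lemma open_disc_sub : (open_disc : set plane) `<=` disc.
Proof. by move=> z /ltW. Qed.

Context (f : plane -> space) (B : set space).
Hypothesis (f_sphere : forall z, disc z -> sphere (f z)).
Hypothesis (f_continuous : {within disc, continuous f}).
Hypothesis (f_boundary : forall z, disc z -> ~ open_disc z -> B (f z)).
Hypothesis (f_smooth : forall z, open_disc z -> smooth_at f z).
Hypothesis (f_immersed : forall z, open_disc z -> ~ B (f z) -> immersed_at f z).

Definition fiber (P : space) : set plane := [set z | disc z /\ f z = P].

(** The radius is doubled for injectivity so that the disks of radius [r] around
    two points of the fiber contain no common preimage: the larger double disk
    would contain both points. *)
Lemma fiber_radius P z : ~ B P -> fiber P z -> exists2 r : R, 0 < r &
  [/\ ball z (2 * r) `<=` open_disc,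
      forall a b, ball z (2 * r) a -> ball z (2 * r) b -> f a = f b -> a = b
    & \forall Q \near P, sphere Q -> exists2 y, ball z r y & f y = Q].
Proof.
move=> BP [dz fz].
have oz : open_disc z by apply: contrapT => /(f_boundary dz); rewrite fz.
have Nz : nbhs z (open_disc : set plane) by apply: open_nbhs_nbhs; split => //; exact: open_disc_open.
have Ns : \forall y \near z, sphere (f y).
  by apply: filterS Nz => y /open_disc_sub; exact: f_sphere.
have im : immersed_at f z by apply: f_immersed; rewrite ?fz.
have N := immersed_local_inverse (f_smooth oz) Ns im.
move: Nz => /nbhs_ballP[r0 /= r0_gt0 Hr0].
have : \forall r \near (0 : R)^'+, r < r0 /\ ((forall a b, ball z r a -> ball z r b -> f a = f b -> a = b) /\
    (\forall Q \near f z, sphere Q -> exists2 y, ball z r y & f y = Q)).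
  near=> r; split; first by near: r; exact: nbhs_right_lt.
  by near: r; exact: N.
move=> /nbhs_ballP[e /= e_gt0 He0].
have He r : 0 < r < e -> r < r0 /\ ((forall a b, ball z r a -> ball z r b -> f a = f b -> a = b) /\
    (\forall Q \near f z, sphere Q -> exists2 y, ball z r y & f y = Q)).
  move=> /andP[r_gt0 re]; apply: He0 => //.
  by rewrite /ball /= sub0r normrN gtr0_norm.
exists (e / 3); first by lra.
have e2 : 0 < 2 * (e / 3) < e by lra.
have e1 : 0 < e / 3 < e by lra.
have [l2 [i2 _]] := He _ e2; have [_ [_ o1]] := He _ e1.
by split; [move=> y By; apply: Hr0; exact: le_ball (ltW l2) _ By|exact: i2|rewrite -fz].
Unshelve. all: by end_near. Qed.

Lemma fiber_compact (S : set space) : closed S ->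
  compact (disc `&` [set z : plane | S (f z)]).
Proof.
move=> cS; have /continuous_closedP/(_ _ cS)/closed_subspaceP[V cV E] := f_continuous.
rewrite setIC (_ : [set z | S (f z)] `&` disc = V `&` disc) //.
by rewrite setIC; exact: compact_closedI disc_compact cV.
Qed.

(** The fiber is finite by compactness, as its points are isolated.  Each point
    is continued to the nearby values by the local inverse, and there are no
    other preimages because the rest of the disc has a compact image that
    misses [P]. *)
Lemma fiber_card_near P : sphere P -> ~ B P -> exists n,
  (fiber P #= `I_n)%card /\ \forall Q \near P, sphere Q -> (fiber Q #= `I_n)%card.
Proof.
move=> sP BP.
have /choice[rad Hrad] z : exists r : R, fiber P z -> 0 < r /\
  [/\ ball z (2 * r) `<=` open_disc,
      forall a b, ball z (2 * r) a -> ball z (2 * r) b -> f a = f b -> a = b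
    & \forall Q \near P, sphere Q -> exists2 y, ball z r y & f y = Q].
  have [/(fiber_radius BP)[r r_gt0 H]|nz] := pselect (fiber P z); first by exists r.
  by exists 1.
have half z : fiber P z -> ball z (rad z) `<=` ball z (2 * rad z).
  by move=> /Hrad[r_gt0 _]; apply: le_ball; lra.
have : compact (fiber P).
  have := @fiber_compact [set P] (compact_closed (@norm_hausdorff _ _) (@compact_set1 _ P)).
  by [].
move=> cF; have Ecov := congr1 (fun C => C (fiber P)) (@compact_cover plane).
have : cover_compact (fiber P) by move: cF; rewrite -[X in _ -> X]Ecov.
move=> /(_ plane (fiber P) (fun z => ball z (rad z)))[].
- by move=> z _; exact: ball_open.
- by move=> z Fz; exists z => //; apply: ballxx; have [] := Hrad z Fz.
move=> D' D'sub cov.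
have D'E z : z \in D' <-> fiber P z.
  split=> [/D'sub|Fz]; first by rewrite inE.
  have [c cD' zc] := cov z Fz.
  have Fc : fiber P c by have := D'sub c cD'; rewrite inE.
  have [r_gt0 [_ inj _]] := Hrad c Fc.
  suff -> : z = c by [].
  apply: inj; [exact: half|by apply: ballxx; lra|].
  by case: Fz => _ ->; case: Fc.
pose W : set plane := \bigcup_(z in [set` D']) ball z (rad z).
have oW : open W by apply: bigcup_open => z _; exact: ball_open.
have cK : compact (disc `&` ~` W) by apply: compact_closedI disc_compact _; exact: open_closedC.
have cfK : closed (f @` (disc `&` ~` W)).
  apply: compact_closed; first exact: norm_hausdorff.
  by apply: continuous_compact cK; apply: continuous_subspaceW f_continuous; exact: subIsetl.
have PK : ~ (f @` (disc `&` ~` W)) P.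
  move=> [z [dz Wz] fz]; apply: Wz; exists z; first by apply/D'E.
  by apply: ballxx; have [] := Hrad z (conj dz fz).
have NK : \forall Q \near P, ~ (f @` (disc `&` ~` W)) Q.
  by apply: open_nbhs_nbhs; split=> //; exact: closed_openC.
have No : \forall Q \near P, forall z, z \in D' -> sphere Q -> exists2 y, ball z (rad z) y & f y = Q.
  have : nbhs P (\bigcap_(z in [set` D']) [set Q | sphere Q -> exists2 y, ball z (rad z) y & f y = Q]).
    by apply: filter_bigI => z /D'E /Hrad[_ []].
  by apply: filterS => Q HQ z zD'; exact: HQ.
have N : \forall Q \near P, sphere Q -> (fiber Q #= [set` D'])%card.
  near=> Q => sQ.
  have HK : ~ (f @` (disc `&` ~` W)) Q by near: Q.
  have Ho : forall z, z \in D' -> sphere Q -> exists2 y, ball z (rad z) y & f y = Q by near: Q.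
  have /choice[beta Hb] z : exists y, z \in D' -> ball z (rad z) y /\ f y = Q.
    by have [/Ho/(_ sQ)[y yb fy]|nz] := pselect (z \in D'); [exists y|exists 0].
  rewrite card_eq_sym; apply/card_set_bijP; exists beta; split.
  - move=> z zD'; have [zb fz] := Hb z zD'; split => //.
    have Fz : fiber P z by apply/D'E.
    by apply: open_disc_sub; have [_ [s _ _]] := Hrad z Fz; apply: s; exact: half.
  - move=> z z' /set_mem zD' /set_mem z'D' E.
    have Fz : fiber P z by apply/D'E.
    have Fz' : fiber P z' by apply/D'E.
    have [r_gt0 [_ i _]] := Hrad z Fz; have [r'_gt0 [_ i' _]] := Hrad z' Fz'.
    have [b1 _] := Hb z zD'; have [b2 _] := Hb z' z'D'; rewrite -E in b2.
    have b12 : ball z (rad z + rad z') z' by exact: ball_triangle b1 (ball_sym b2).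
    have ff : f z = f z' by rewrite Fz.2 Fz'.2.
    have [rr|/ltW rr] := leP (rad z') (rad z).
      by apply: i => //; [apply: ballxx|apply: le_ball b12]; lra.
    by apply: i' => //; [apply: ball_sym; apply: le_ball b12|apply: ballxx]; lra.
  - move=> y [dy fy].
    have [z zD' zy] : W y by apply: contrapT => nW; apply: HK; exists y.
    have Fz : fiber P z by apply/D'E.
    have [r_gt0 [_ i _]] := Hrad z Fz; have [b1 fb] := Hb z zD'.
    by exists z => //; apply: i; rewrite ?fb //; exact: half.
have [n F] : finite_set [set` D'] by exact: finite_fset.
exists n.
have : (fiber P #= [set` D'])%card by exact: (nbhs_singleton N sP).
move=> E; split; first exact: card_eq_trans E F.
by near=> Q => sQ; apply: card_eq_trans F; move: sQ; near: Q.
Unshelve. all: by end_near. Qed.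

Lemma connected_locally_constant (T : topologicalType) (U : Type) (X : set T) (m : T -> U) :
  connected X -> (forall P, X P -> \forall Q \near P, X Q -> m Q = m P) ->
  forall P Q, X P -> X Q -> m P = m Q.
Proof.
move=> cX Hm P Q XP XQ.
pose C (b : bool) := \bigcup_(V in [set V : set T | open V /\
   forall Q, V Q -> X Q -> (m Q = m P) = b :> Prop]) V.
have oC b : open (C b) by apply: bigcup_open => V [].
have cov Q' : X Q' -> C `[< m Q' = m P >] Q'.
  move=> XQ'; have : nbhs Q' [set y | X y -> m y = m Q'] := Hm Q' XQ'; rewrite nbhsE => - [V [oV VQ'] HV].
  exists V => //; split=> // Q'' VQ'' XQ''; rewrite (HV Q'' VQ'' XQ'').
  by apply/propext; split=> [/asboolP|/asboolP].
have : X `&` C true = X.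
  apply: cX.
  - by exists P; split=> //; have := cov P XP; rewrite asboolT.
  - by exists (C true).
  - exists (~` C false); first exact: open_closedC.
    apply/seteqP; split=> y [Xy Cy]; split=> //.
      move=> [V [_ HV] Vy]; case: Cy => V' [_ HV'] V'y.
      have E : m y = m P by rewrite (HV' y V'y Xy).
      by have := HV y Vy Xy; rewrite propeqE => -[/(_ E)].
    by have := cov y Xy; case: (`[< _ >]) => // /Cy.
move=> /seteqP[_ /(_ Q XQ)[_ [V [_ HV] VQ]]].
by symmetry; rewrite (HV Q VQ XQ).
Qed.

Lemma multiplicity_constant (X : set space) : connected X ->
  (forall P, X P -> sphere P /\ ~ B P) -> forall P Q, X P -> X Q ->
  #|` fset_set (fiber P)| = #|` fset_set (fiber Q)|.
Proof.
move=> cX HX; apply: connected_locally_constant => // P /HX[sP BP].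
have [n [FP N]] := fiber_card_near sP BP.
near=> Q => /HX[sQ _]; rewrite (card_fset_set FP) (@card_fset_set _ _ n) //.
by move: sQ; near: Q.
Unshelve. all: by end_near. Qed.
End Multiplicity.

(** * The quadrants at the crossing *)

Definition opposite (Q : quadrant) : quadrant :=
  match Q with North => South | East => West | South => North | West => East end.

Lemma oppositeK : involutive opposite. Proof. by case. Qed.

(** Opposite quadrants have opposite bounding rays. *)
Lemma turn_opposite (R : realType) p (g : R -> R) x Q :
  turn p g x (opposite Q) = turn p g x Q.
Proof.
have rayN t b : ray p g t (~~ b) = - ray p g t b.
  by case: b; apply: injective_projections; rewrite /= ?expr0 ?expr1 ?mul1r ?mulN1r ?opprK.
have det2NN (a b : R * R) : det2 (- a) (- b) = det2 a b.
  by rewrite /det2 /= !mulrNN.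
have E : bounding_rays p g x (opposite Q) =
    (~~ (bounding_rays p g x Q).1, ~~ (bounding_rays p g x Q).2).
  by case: Q; rewrite /bounding_rays /= ?negbK.
by rewrite /turn E /= !rayN det2NN.
Qed.

Lemma label_pos_opposite (R : realType) p (g : R -> R) x Q :
  label_pos p g x (opposite Q) = label_pos p g x Q.
Proof. by rewrite /label_pos turn_opposite. Qed.

Lemma label_neg_opposite (R : realType) p (g : R -> R) x Q :
  label_neg p g x (opposite Q) = label_neg p g x Q.
Proof. by rewrite /label_neg turn_opposite. Qed.

Section Germs.
Context {R : realType} (p : nat) (g k : R -> R) (sg ps : R) (tau : R -> R).
Hypothesis OC : one_crossing p g k sg ps tau.
Local Notation space := (R * R * R)%type.
Local Notation az := (azimuth p g).
Local Notation top := (top k).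
Local Notation bot := (bot k).

Let Hk : profile k sg ps. Proof. exact: oc_profile OC. Qed.

Definition in_quadrant (Q : quadrant) (s y : R) : Prop :=
  match Q with
  | North => top y < s
  | East => ps < y /\ bot y < s < top y
  | South => s < bot y
  | West => y < ps /\ bot y < s < top y
  end.

(** All chords have their endpoints over the same crossing. *)
Definition crossing_germ (e : R) (Q : quadrant) : set space :=
  [set P | exists s y : R, [/\ `|y - ps| < e, `|s - k ps| < e, P = cyl s y
    & in_quadrant Q s y]].

Lemma lat_min (a b : R) : Num.min (lat a) (lat b) = lat (Num.max a b).
Proof. by rewrite minEle maxEle !leNgt !lat_lt; case: (ltgtP a b) => // ->. Qed.

Lemma lat_max (a b : R) : Num.max (lat a) (lat b) = lat (Num.min a b).
Proof. by rewrite minEle maxEle !leNgt !lat_lt; case: (ltgtP a b) => // ->. Qed.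

Lemma cyl_turns s y (n : int) : cyl s (y + 2 * pi * n%:~R) = cyl s y :> space.
Proof. by rewrite /cyl cosD2pi_int sinD2pi_int. Qed.

Lemma top_bot_turns y (n : int) : top (y + 2 * pi * n%:~R) = top y /\
  bot (y + 2 * pi * n%:~R) = bot y.
Proof. by split; apply: periodic_int; [exact: top_per OC|exact: bot_per OC]. Qed.

Lemma chord_latitudes x s1 s2 : chords p 1 g x ->
  az s1 - az x.1 = az s2 - az x.2 ->
  Num.min (r1sq g s1) (r1sq g s2) = lat (top (az s1)) /\
  Num.max (r1sq g s1) (r1sq g s2) = lat (bot (az s1)).
Proof.
move=> /(chordsP OC)[_ _ _ E2] E.
rewrite !(oc_r1sq OC) lat_min lat_max.
suff -> : k (az s2) = k (az s1 + 2 * pi) by [].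
case: E2 => E2; first by congr k; lra.
by rewrite -(profile_per Hk (az s2)); congr k; lra.
Qed.

Lemma crossing_height (n : int) : k (ps + 2 * pi * n%:~R) = k ps.
Proof.
have [t b] := top_bot_turns ps n.
by move: t; rewrite /top (crossing_azimuthE OC) (profile_cross Hk) !maxxx.
Qed.

Lemma lat_near (h e : R) : 0 < e -> exists2 d, 0 < d & forall u, `|u - lat h| < d ->
  exists2 s, u = lat s & `|s - h| < e.
Proof.
move=> e0; have l1 : lat (h + e) < lat h by rewrite lat_lt; lra.
have l2 : lat h < lat (h - e) by rewrite lat_lt; lra.
exists (Num.min (lat h - lat (h + e)) (lat (h - e) - lat h)).
  by rewrite lt_min !subr_gt0 l1 l2.
move=> u; rewrite lt_min !ltr_norml => /andP[/andP[u1 _] /andP[_ u2]].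
have /andP[a0 _] := lat01 (h + e); have /andP[_ a1] := lat01 (h - e).
have [|s us] := @lat_surj R u; first by apply/andP; split; lra.
exists s => //; have : lat (h + e) < lat s by rewrite -us; lra.
have : lat s < lat (h - e) by rewrite -us; lra.
by rewrite !lat_lt ltr_norml => ? ?; apply/andP; split; lra.
Qed.

Lemma continuous_near (h : R -> R) (a e : R) : {for a, continuous h} -> 0 < e ->
  exists2 d, 0 < d & forall t, `|t - a| < d -> `|h t - h a| < e.
Proof.
move=> ch e0; have : \forall t \near a, `|h t - h a| < e.
  by move: ch => /cvgr_distC_lt; apply.
move=> /nbhs_ballP[d /= d0 H]; exists d => // t td; apply: H.
by rewrite /ball /= distrC.
Qed.

(** In the cylinder coordinates the germs do not depend on the chord. *)
Lemma quadrant_germ_sub x Q (e : R) : chords p 1 g x -> 0 < e ->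
  exists2 d, 0 < d & quadrant_germ p g d x Q `<=` crossing_germ e Q.
Proof.
move=> cx e0; have [_ _ [n E1] _] := (chordsP OC x).1 cx.
have [d1 d10 H1] := lat_near (k ps) e0.
have caz : {for x.1, continuous az} by exact: (oc_az_cont OC).
have [d2 d20 H2] := continuous_near caz e0.
exists (Num.min d1 d2); first by rewrite lt_min d10.
move=> P [s1 [s2 [u [[D1 D2 Du u01] E -> C]]]].
have [Et Eb] := chord_latitudes cx E; rewrite Et Eb in C.
have Er : r1sq g x.1 = lat (k ps) by rewrite (oc_r1sq OC) E1 crossing_height.
move: Du; rewrite Er lt_min => /andP[/H1[s us se] _].
move: D1; rewrite lt_min => /andP[_ /H2 y1].
have yE : az s1 = az s1 - 2 * pi * n%:~R + 2 * pi * n%:~R by ring.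
have [Tt Tb] := top_bot_turns (az s1 - 2 * pi * n%:~R) n.
rewrite -yE in Tt Tb.
exists s, (az s1 - 2 * pi * n%:~R); split => //.
- by rewrite (_ : _ - ps = az s1 - az x.1) // E1; ring.
- by rewrite us sphere_pt_lat [in LHS]yE cyl_turns.
have lt1 : (x.1 < s1) = (ps < az s1 - 2 * pi * n%:~R).
  by rewrite -(oc_az_lt OC) E1 ltrBrDr.
have lt2 : (s1 < x.1) = (az s1 - 2 * pi * n%:~R < ps).
  by rewrite -(oc_az_lt OC) E1 ltrBlDr.
rewrite /in_quadrant -Tt -Tb -lt1 -lt2; move: C; rewrite us.
case: (Q); rewrite /in_quadrant /= !lat_lt //.
  by move=> [-> /andP[-> ->]].
by move=> [-> /andP[-> ->]].
Qed.

Lemma crossing_germ_sub x Q (d : R) : chords p 1 g x -> 0 < d ->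
  exists2 e, 0 < e & crossing_germ e Q `<=` quadrant_germ p g d x Q.
Proof.
move=> cx d0; have [_ _ [n E1] E2] := (chordsP OC x).1 cx.
have cl : {for k ps, continuous (@lat R)} by apply: smooth_at_continuous; exact: lat_smooth_at.
have [e1 e10 H1] := continuous_near cl d0.
have ct y : {for y, continuous tau} by exact: (oc_tau_cont OC).
have [e2 e20 H2] := continuous_near (ct (az x.1)) d0.
have [e3 e30 H3] := continuous_near (ct (az x.2)) d0.
rewrite !(oc_azK OC) in H2 H3.
exists (Num.min e1 (Num.min e2 e3)); first by rewrite !lt_min e10 e20.
move=> P [s [y [Dy Ds -> C]]]; rewrite !lt_min in Dy Ds.
case/and3P: Dy => [_ y2 y3]; case/and3P: Ds => [s1 _ _].
have Er : r1sq g x.1 = lat (k ps) by rewrite (oc_r1sq OC) E1 crossing_height.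
have Ey : y - ps + az x.1 = y + 2 * pi * n%:~R by rewrite E1; ring.
have E : az (tau (y - ps + az x.1)) - az x.1 = az (tau (y - ps + az x.2)) - az x.2.
  by rewrite !(oc_tauK OC); ring.
have [Et Eb] := chord_latitudes cx E.
exists (tau (y - ps + az x.1)), (tau (y - ps + az x.2)), (lat s); rewrite Er; split => //.
- split; last by have /andP[/ltW-> /ltW->] := lat01 s.
  + by apply: H2; rewrite addrK.
  + by apply: H3; rewrite addrK.
  + exact: H1.
- by rewrite sphere_pt_lat (oc_tauK OC) Ey cyl_turns.
have [Tt Tb] := top_bot_turns y n.
rewrite Et Eb (oc_tauK OC) Ey Tt Tb.
have lt1 : (x.1 < tau (y + 2 * pi * n%:~R)) = (ps < y).
  by rewrite -(oc_az_lt OC) (oc_tauK OC) E1 ltrD2r.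
have lt2 : (tau (y + 2 * pi * n%:~R) < x.1) = (y < ps).
  by rewrite -(oc_az_lt OC) (oc_tauK OC) E1 ltrD2r.
rewrite lt1 lt2; move: C; case: (Q); rewrite /in_quadrant /= !lat_lt //.
  by move=> [-> /andP[-> ->]].
by move=> [-> /andP[-> ->]].
Qed.

Lemma gamma_crossing x : chords p 1 g x -> gamma p g x.1 = cyl (k ps) ps.
Proof.
move=> /(chordsP OC)[_ _ [n E1] _].
by rewrite (oc_gamma OC) E1 crossing_height cyl_turns.
Qed.

Lemma has_cornerP C x Q : chords p 1 g x ->
  has_corner p g C x Q <-> exists2 e, 0 < e & crossing_germ e Q `<=` C.
Proof.
move=> cx; split=> [[d d0 H]|[e e0 H]].
  by have [e e0 H'] := crossing_germ_sub Q cx d0; exists e => //; exact: subset_trans H' H.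
by have [d d0 H'] := quadrant_germ_sub Q cx e0; exists d => //; exact: subset_trans H' H.
Qed.

Lemma fillsP f z x Q : chords p 1 g x -> fills p g f z x Q <->
  [/\ f z = cyl (k ps) ps,
      forall e, 0 < e -> \forall z' \near z, open_disc z' -> crossing_germ e Q (f z')
    & forall B : set (R * R), nbhs z B -> exists2 e, 0 < e
        & crossing_germ e Q `<=` f @` (B `&` open_disc)].
Proof.
move=> cx; rewrite /fills (gamma_crossing cx); split=> -[E H1 H2]; split=> //.
- move=> e e0; have [d d0 H'] := quadrant_germ_sub Q cx e0.
  by apply: filterS (H1 d d0) => z' H oz; exact/H'/H.
- move=> B /H2[d d0 H]; have [e e0 H'] := crossing_germ_sub Q cx d0.
  by exists e => //; exact: subset_trans H' H.
- move=> d d0; have [e e0 H'] := crossing_germ_sub Q cx d0.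
  by apply: filterS (H1 e e0) => z' H oz; exact/H'/H.
- move=> B /H2[e e0 H]; have [d d0 H'] := quadrant_germ_sub Q cx e0.
  by exists d => //; exact: subset_trans H' H.
Qed.

Context (A lam chi : R -> R) (N : R) (HF : flip k sg ps A lam chi N).
Local Notation flip_map := (flip_map ps A lam chi).
Local Notation F := (flip_height A lam chi).

Lemma flip_height_strand y : F (k y) y = - k (2 * ps - y).
Proof.
rewrite /flip_height (flipc1 HF) ?mul1r; last first.
  have := profile_bound Hk y; have := profile_gt0 Hk; rewrite ler_norml => ? ?; lra.
by rewrite -(flip_strand HF); ring.
Qed.

Lemma flip_height_strand2 y : F (k (y + 2 * pi)) y = - k (2 * ps - y + 2 * pi).
Proof.
have := flip_height_strand (y + 2 * pi); rewrite /flip_height (flipA_per HF) (flipl_per HF).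
by move=> ->; congr (- _); rewrite -(profile_per Hk (_ - _)); congr k; ring.
Qed.

Lemma flip_height_ltE (y s s' : R) : (F s y < F s' y) = (s < s').
Proof.
apply/idP/idP; last exact: (flip_height_lt HF).
by apply: contraTT; rewrite -!leNgt le_eqVlt => /predU1P[->//|/(flip_height_lt HF y)/ltW].
Qed.

(** The flip reverses the heights and exchanges the strands at [y] with those
    at [2 * ps - y]. *)
Lemma flip_strands (s y : R) :
  [/\ (- F s y < k (2 * ps - y)) = (k y < s),
      (k (2 * ps - y) < - F s y) = (s < k y),
      (- F s y < k (2 * ps - y + 2 * pi)) = (k (y + 2 * pi) < s)
    & (k (2 * ps - y + 2 * pi) < - F s y) = (s < k (y + 2 * pi))].
Proof.
split.
- by rewrite -(flip_height_ltE y (k y) s) flip_height_strand ltrNl.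
- by rewrite -(flip_height_ltE y s (k y)) flip_height_strand ltrNr.
- by rewrite -(flip_height_ltE y (k (y + 2 * pi)) s) flip_height_strand2 ltrNl.
- by rewrite -(flip_height_ltE y s (k (y + 2 * pi))) flip_height_strand2 ltrNr.
Qed.

Lemma flip_top (s y : R) : (top y < s) = (- F s y < bot (2 * ps - y)) /\
  (s < top y) = (bot (2 * ps - y) < - F s y).
Proof.
have [a b c d] := flip_strands s y.
by rewrite /top /bot gt_max lt_max lt_min gt_min a b c d.
Qed.

Lemma flip_bot (s y : R) : (bot y < s) = (- F s y < top (2 * ps - y)) /\
  (s < bot y) = (top (2 * ps - y) < - F s y).
Proof.
have [a b c d] := flip_strands s y.
by rewrite /top /bot gt_max lt_max lt_min gt_min a b c d.
Qed.

Lemma flip_north P : region_north k P -> region_south k (flip_map P).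
Proof.
move=> NP; have [/sphereP[[b E]|[s [y E]]] _] := NP; move: NP; rewrite E.
  case: b {E} => [_|/north_not_south_pole//]; rewrite flip_map_pole; exact: south_pole.
by rewrite (flip_map_cyl HF) => /(north_cyl OC) H; apply/(south_cyl OC); rewrite -(flip_top _ _).1.
Qed.

Lemma flip_south P : region_south k P -> region_north k (flip_map P).
Proof.
move=> NP; have [/sphereP[[b E]|[s [y E]]] _] := NP; move: NP; rewrite E.
  case: b {E} => [/south_not_north_pole//|_]; rewrite flip_map_pole; exact: north_pole.
by rewrite (flip_map_cyl HF) => /(south_cyl OC) H; apply/(north_cyl OC); rewrite -(flip_bot _ _).2.
Qed.

Lemma flip_mid P : region_mid k P -> region_mid k (flip_map P).
Proof.
move=> NP; have [/sphereP[[b E]|[s [y E]]] _ _] := NP; move: NP; rewrite E.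
  by move=> /mid_not_pole.
rewrite (flip_map_cyl HF) => /(mid_cyl OC) /andP[H1 H2]; apply/(mid_cyl OC).
by rewrite -(flip_bot _ _).1 -(flip_top _ _).2 H1 H2.
Qed.

Lemma flip_Gamma P : Gamma p g P -> Gamma p g (flip_map P).
Proof.
move=> /(GammaP OC)[y ->]; apply/(GammaP OC); exists (2 * ps - y).
by rewrite (flip_map_cyl HF) flip_height_strand opprK.
Qed.

Lemma flip_crossing : flip_map (cyl (k ps) ps) = cyl (k ps) ps.
Proof.
by rewrite (flip_map_cyl HF) flip_height_strand opprK (_ : 2 * ps - ps = ps) //; ring.
Qed.

Lemma flip_quadrant (s y : R) Q :
  in_quadrant Q s y <-> in_quadrant (opposite Q) (- F s y) (2 * ps - y).
Proof.
have [t1 t2] := flip_top s y; have [b1 b2] := flip_bot s y.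
case: Q; rewrite /in_quadrant /= -?t1 -?t2 -?b1 -?b2 //.
  have -> : (2 * ps - y < ps) = (ps < y) by apply/idP/idP; lra.
  by rewrite andbC.
have -> : (ps < 2 * ps - y) = (y < ps) by apply/idP/idP; lra.
by rewrite andbC.
Qed.

Lemma flip_germ_sub (e : R) Q : 0 < e -> exists2 d, 0 < d &
  forall P, crossing_germ d Q P -> crossing_germ e (opposite Q) (flip_map P).
Proof.
move=> e0.
have cA : continuous A by move=> y; exact/smooth_at_continuous/smooth_at_of/(flipA_smooth HF).
have cl : continuous lam by move=> y; exact/smooth_at_continuous/smooth_at_of/(flipl_smooth HF).
pose h (z : R * R) := lam z.2 * z.1 + A z.2.
have ch : {for (k ps, ps), continuous h}.
  have c1 : (z.1 @[z --> (k ps, ps)] --> k ps) by exact: (@continuous_fst_pair R R R (k ps, ps)).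
  have c2 : (z.2 @[z --> (k ps, ps)] --> ps) by exact: (@continuous_snd_pair R R R (k ps, ps)).
  apply: cvgD; last by apply: (cvg_comp _ _ c2); exact: cA.
  by apply: cvgM => //; apply: (cvg_comp _ _ c2); exact: cl.
have hE : h (k ps, ps) = - k ps.
  by rewrite /h /= (flip_strand HF) (_ : 2 * ps - ps = ps) //; ring.
have : \forall z \near (k ps, ps), `|h z - h (k ps, ps)| < e.
  by move: ch => /cvgr_distC_lt; apply.
move=> /nbhs_ballP[d0 /= d00 H].
exists (Num.min d0 (Num.min e 1)); first by rewrite !lt_min d00 e0 ltr01.
move=> P [s [y [Dy Ds -> C]]]; rewrite !lt_min in Dy Ds.
case/and3P: Dy => [y1 y2 _]; case/and3P: Ds => [s1 _ s3].
have FE : F s y = h (s, y).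
  rewrite /flip_height (flipc1 HF) ?mul1r /h /=; first by ring.
  have := profile_bound Hk ps; move: s3; rewrite ler_norml ltr_norml => /andP[? ?] /andP[? ?].
  by apply/andP; split; lra.
exists (- F s y), (2 * ps - y); split.
- have -> : 2 * ps - y - ps = ps - y by ring.
  by rewrite distrC.
- have -> : - F s y - k ps = - (h (s, y) - h (k ps, ps)) by rewrite FE hE; ring.
  by rewrite normrN; apply: H; split; rewrite /ball /= distrC.
- by rewrite (flip_map_cyl HF).
exact: (flip_quadrant s y Q).1 C.
Qed.

(** Near the knot the flip is affine in the height, with an explicit inverse. *)
Lemma flip_germ_sup (e : R) Q : 0 < e -> exists2 d, 0 < d &
  crossing_germ d (opposite Q) `<=` flip_map @` crossing_germ e Q.
Proof.
move=> e0.
have cA : continuous A by move=> y; exact/smooth_at_continuous/smooth_at_of/(flipA_smooth HF).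
have cl : continuous lam by move=> y; exact/smooth_at_continuous/smooth_at_of/(flipl_smooth HF).
pose h (z : R * R) := (- z.1 - A z.2) / lam z.2.
have ch : {for (k ps, ps), continuous h}.
  have c1 : (z.1 @[z --> (k ps, ps)] --> k ps) by exact: (@continuous_fst_pair R R R (k ps, ps)).
  have c2 : (z.2 @[z --> (k ps, ps)] --> ps) by exact: (@continuous_snd_pair R R R (k ps, ps)).
  apply: cvgM; first apply: cvgB; first exact: cvgN.
    by apply: (cvg_comp _ _ c2); exact: cA.
  apply: cvgV; first by rewrite gt_eqF // (flipl_gt0 HF).
  by apply: (cvg_comp _ _ c2); exact: cl.
have hE : h (k ps, ps) = k ps.
  have l0 : lam ps != 0 by rewrite gt_eqF // (flipl_gt0 HF).
  apply: (mulIf l0); rewrite /h /= divfK //.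
  by have := flip_strand HF ps; rewrite (_ : 2 * ps - ps = ps); [lra|ring].
pose e' := Num.min e 1.
have e'0 : 0 < e' by rewrite lt_min e0 ltr01.
have : \forall z \near (k ps, ps), `|h z - h (k ps, ps)| < e'.
  by move: ch => /cvgr_distC_lt; apply.
move=> /nbhs_ballP[d0 /= d00 H].
exists (Num.min d0 e); first by rewrite lt_min d00 e0.
move=> P [s' [y' [Dy Ds -> C]]]; rewrite !lt_min in Dy Ds.
case/andP: Dy => [y1 y2]; case/andP: Ds => [s1 _].
pose y : R := 2 * ps - y'; pose s := h (s', y).
have yE : y' = 2 * ps - y by rewrite /y; ring.
have yps : y - ps = ps - y' by rewrite /y; ring.
have yn : `|y' - ps| < d0 by [].
have : `|s - k ps| < e' by rewrite -[X in _ - X]hE; apply: H; split; rewrite /ball /= distrC // yps distrC.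
rewrite lt_min => /andP[se s3].
have l0 : lam y != 0 by rewrite gt_eqF // (flipl_gt0 HF).
have FE : F s y = - s'.
  have -> : F s y = lam y * s + A y.
    rewrite /flip_height (flipc1 HF) ?mul1r; first by ring.
    have := profile_bound Hk ps; move: s3; rewrite ler_norml ltr_norml => /andP[? ?] /andP[? ?].
    by apply/andP; split; lra.
  by rewrite /s /h /= mulrC divfK // addrNK.
exists (cyl s y); last by rewrite (flip_map_cyl HF) FE opprK yE.
exists s, y; split => //; first by rewrite yps distrC.
by apply: (flip_quadrant s y Q).2; rewrite FE opprK -yE.
Qed.

Lemma fills_flip f z x Q : chords p 1 g x -> fills p g f z x Q ->
  fills p g (fun z' => flip_map (f z')) z x (opposite Q).
Proof.
move=> cx /(fillsP _ _ _ cx)[E H1 H2]; apply/(fillsP _ _ _ cx); split.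
- by rewrite E flip_crossing.
- move=> e e0; have [d d0 H] := flip_germ_sub Q e0.
  by apply: filterS (H1 d d0) => z' H' oz; exact/H/H'.
- move=> B /H2[e e0 H]; have [d d0 H'] := flip_germ_sup Q e0.
  exists d => // P /H'[P' /H[z' Bz <-] <-]; by exists z'.
Qed.

Lemma has_corner_flip C C' x Q : chords p 1 g x ->
  (forall P, C P -> C' (flip_map P)) ->
  has_corner p g C x Q -> has_corner p g C' x (opposite Q).
Proof.
move=> cx CC' /(has_cornerP _ _ cx)[e e0 H]; apply/(has_cornerP _ _ cx).
have [d d0 H'] := flip_germ_sup Q e0.
by exists d => // P /H'[P' /H CP' <-]; exact: CC'.
Qed.

(** The areas agree, and the corners of one region at the opposite quadrants of
    those of the other, with the same labels. *)
Lemma region_defect_north_south q :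
  region_defect p q 1 g (region_north k) = region_defect p q 1 g (region_south k).
Proof.
rewrite /region_defect (area_north_south OC); congr (_ + _).
apply: eq_fsbigr => x /set_mem /= [cx _].
have E Q : `[< has_corner p g (region_south k) x (opposite Q) >] =
           `[< has_corner p g (region_north k) x Q >].
  apply/asboolP/asboolP => H.
    by rewrite -(oppositeK Q); apply: has_corner_flip cx flip_south H.
  exact: has_corner_flip cx flip_north H.
rewrite /quadrants !big_cons !big_nil -(E North) -(E East) -(E South) -(E West) /=.
have LS := label_pos_opposite p g x North; have LW := label_pos_opposite p g x East.
rewrite /= in LS LW; rewrite LS LW.
move: (if label_pos _ _ _ North then _ else _) (if label_pos _ _ _ East then _ else _) => a b.
by do 4![case: ifP => _]; ring.
Qed.

End Germs.

(** * Flipping a disc *)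

Section LinearPrecomposition.
Context {R : realType}.

Lemma derive_comp_lin (V V' W : normedModType R) (f : V' -> W) (L : {linear V -> V'}) z v :
  'D_v (fun y => f (L y)) z = 'D_(L v) f (L z).
Proof.
have E : (fun h : R => h^-1 *: (f (L (h *: v + z)) - f (L z))) =
         (fun h => h^-1 *: (f (h *: L v + L z) - f (L z))).
  by apply/funext => h; rewrite linearP.
by rewrite /derive E.
Qed.

Lemma Ck_comp_lin (V V' W : normedModType R) n (U : set V') (f : V' -> W)
    (L : {linear V -> V'}) : continuous L -> Ck n U f ->
  Ck n (L @^-1` U) (fun y => f (L y)).
Proof.
move=> cL; elim: n f => [|n IH] f /= Hf.
  by move=> z Uz; apply: continuous_comp; [exact: cL|exact: Hf].
case: Hf => Hf1 Hf2; split=> [z Uz|v].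
  apply: differentiable_comp; last exact: Hf1.
  exact: linear_differentiable.
have -> : 'D_v (fun y => f (L y)) = (fun y => 'D_(L v) f (L y)).
  by apply/funext => y; exact: derive_comp_lin.
exact: (IH ('D_(L v) f) (Hf2 (L v))).
Qed.

Lemma smooth_at_comp_lin (V V' W : normedModType R) (f : V' -> W)
    (L : {linear V -> V'}) z : continuous L -> smooth_at f (L z) ->
  smooth_at (fun y => f (L y)) z.
Proof.
move=> cL [U [oU Uz] Hf]; exists (L @^-1` U); last by move=> n; exact: Ck_comp_lin.
by split=> //; apply: open_comp => // y _; exact: cL.
Qed.

Lemma derive_plane (W : normedModType R) (f : R * R -> W) z (a b : R) :
  differentiable f z -> 'D_((a, b)) f z = a *: 'D_e1 f z + b *: 'D_e2 f z.
Proof.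
move=> df; rewrite !deriveE // -!linearZ -linearD; congr ('d f z _).
by apply: injective_projections; rewrite /= /GRing.scale /= ?mulr1 ?mulr0 ?addr0 ?add0r.
Qed.

End LinearPrecomposition.

Section Rotation.
Context {R : realType}.
Local Notation plane := (R * R)%type.

Definition rotation_map (c s : R) (z : plane) : plane :=
  (c * z.1 - s * z.2, s * z.1 + c * z.2).

Lemma rotation_map_linear c s : linear (rotation_map c s).
Proof.
move=> a x y; apply: injective_projections; rewrite /rotation_map /= /GRing.scale /=; ring.
Qed.

HB.instance Definition _ c s := GRing.isLinear.Build R plane plane *:%R
  (rotation_map c s) (rotation_map_linear c s).

Lemma rotation_map_continuous c s : continuous (rotation_map c s).
Proof.
move=> z; have s1 := smooth_at_fst (smooth_at_id z).
have s2 := smooth_at_snd (smooth_at_id z).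
apply: smooth_at_continuous; apply: smooth_at_pair.
  by apply: smooth_atB; apply: smooth_atM => //; exact: smooth_at_cst.
by apply: smooth_atD; apply: smooth_atM => //; exact: smooth_at_cst.
Qed.

Lemma coordinate_rotation (tau : plane -> plane) (c s : R) : c ^+ 2 + s ^+ 2 = 1 ->
  coordinate_at tau 0 -> coordinate_at (fun z => tau (rotation_map c s z)) 0.
Proof.
move=> cs [st t0 dt].
have r0 : rotation_map c s 0 = 0.
  by apply: injective_projections; rewrite /= !mulr0 ?subr0 ?addr0.
split.
- have st' : smooth_at tau (rotation_map c s 0) by rewrite r0.
  exact: smooth_at_comp_lin (@rotation_map_continuous c s) st'.
- by rewrite r0.
have D := smooth_at_diff st.
have Dv (v : plane) (a b : R) : rotation_map c s v = (a, b) ->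
    'D_v (fun z => tau (rotation_map c s z)) 0 = a *: 'D_e1 tau 0 + b *: 'D_e2 tau 0.
  have H : 'D_v (fun z => tau (rotation_map c s z)) 0 =
      'D_(rotation_map c s v) tau (rotation_map c s 0).
    exact: (derive_comp_lin tau (rotation_map c s)).
  by move=> E; rewrite H E r0; exact: derive_plane.
have R1 : rotation_map c s e1 = (c, s).
  by rewrite /rotation_map /e1 /= !mulr1 !mulr0 subr0 addr0.
have R2 : rotation_map c s e2 = (- s, c).
  by rewrite /rotation_map /e2 /= !mulr1 !mulr0 !add0r.
rewrite (Dv e1 c s R1) (Dv e2 (- s) c R2).
move: dt; move: ('D_e1 tau 0) ('D_e2 tau 0) => [a1 a2] [b1 b2].
rewrite /det2 /= /GRing.scale /= => dt.
have -> : (c * a1 + s * b1) * (- s * a2 + c * b2) - (c * a2 + s * b2) * (- s * a1 + c * b1)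
  = (c ^+ 2 + s ^+ 2) * (a1 * b2 - a2 * b1) by ring.
by rewrite cs mul1r.
Qed.

End Rotation.

Section FlippedDisc.
Context {R : realType} (p : nat) (g k : R -> R) (sg ps : R) (tau : R -> R).
Hypothesis OC : one_crossing p g k sg ps tau.
Context (A lam chi : R -> R) (N : R) (HF : flip k sg ps A lam chi N).
Local Notation flip_map := (flip_map ps A lam chi).
Local Notation plane := (R * R)%type.
Local Notation space := (R * R * R)%type.

Lemma flip_map_pole_inv P b : sphere P -> flip_map P = pole b -> P = pole (~~ b).
Proof.
move=> sP E; apply: (flip_map_inj HF) => //; first exact: sphere_pole.
by rewrite flip_map_pole negbK.
Qed.

(** Near a pole the flip is an isometry, whose effect on the coordinate of
    the pole is a rotation. *)
Lemma looks_like_power_flip n (f : plane -> space) b z : smooth_at f z ->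
  (\forall y \near z, sphere (f y)) -> f z = pole b ->
  looks_like_power n f b z -> looks_like_power n (fun y => flip_map (f y)) (~~ b) z.
Proof.
move=> Hf Hs fz [ch [ta [Hc Ht E]]].
pose sig : R := (-1) ^+ b; pose c := cos (2 * ps); pose s := sin (2 * ps).
have sig2 : sig * sig = 1 by rewrite /sig; case: (b); rewrite /= ?expr0 ?expr1 ?mulrNN mulr1.
exists ch, (fun y => ta (rotation_map c (- (sig * s)) y)); split; first exact: Hc.
  apply: coordinate_rotation Ht.
  by rewrite sqrrN exprMn [sig ^+ 2]expr2 sig2 mul1r /c /s cos2Dsin2.
have Hz := flip_z_near_pole HF Hf fz.
near=> y.
have Sy : sphere (f y) by near: y.
have zy : flip_z A lam chi (f y) = - (f y).2 by near: y.
have <- : ta (pole_coordinate b (f y)) = cpow n (ch y) by near: y.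
congr ta.
have cs1 : c ^+ 2 + s ^+ 2 = 1 by rewrite /c /s cos2Dsin2.
have -> : flip_map (f y) = flip_raw ps A lam chi (f y).
  rewrite [LHS]/(scale3 _ _) (_ : enorm _ = 1) ?invr1.
    by rewrite /scale3 !mul1r; case: (flip_raw _ _ _ _ _) => [[]].
  rewrite /enorm /flip_raw zy /= -/c -/s.
  rewrite (_ : _ + _ + _ = (c ^+ 2 + s ^+ 2) * ((f y).1.1 ^+ 2 + (f y).1.2 ^+ 2) + (f y).2 ^+ 2).
    by rewrite cs1 mul1r Sy sqrtr1.
  by ring.
have sb : (-1) ^+ (~~ b) = - sig :> R.
  by rewrite /sig; case: (b); rewrite /= ?expr0 ?expr1 ?opprK.
have sbb : (-1) ^+ (~~ ~~ b) = sig :> R by rewrite negbK.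
rewrite /pole_coordinate sb sbb /flip_raw /rotation_map /= -/c -/s.
apply: injective_projections => /=.
  transitivity ((c ^+ 2 + sig * sig * s ^+ 2) * (f y).1.1 + c * s * (1 - sig * sig) * (f y).1.2).
    by ring.
  by rewrite sig2 mul1r cs1; ring.
transitivity (- sig * (s ^+ 2 + c ^+ 2) * (f y).1.2); first by ring.
by rewrite [s ^+ 2 + _]addrC cs1 mulr1.
Unshelve. all: by end_near. Qed.

Lemma rho_not_pole (P : space) : sphere P -> (forall b, P <> pole b) -> rho P != 0.
Proof.
by move=> sP nP; have [s [y ->]] := sphere_not_pole sP nP; rewrite gt_eqF // rho_cyl_gt0.
Qed.

Lemma within_continuousP (W : topologicalType) (D : set plane) (f : plane -> W) :
  {within D, continuous f} <->
  forall z, D z -> forall B : set W, nbhs (f z) B -> \forall y \near z, D y -> B (f y).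
Proof.
rewrite continuous_subspace_in; split=> H z.
  move=> Dz B nB; have : within D (nbhs z) (f @^-1` B); last by [].
  by rewrite nbhs_subspace_in //; exact: (H z (mem_set Dz) B nB).
move=> /set_mem Dz B nB; have : within D (nbhs z) (f @^-1` B) := H z Dz B nB.
by rewrite nbhs_subspace_in.
Qed.

Lemma disc_circ t : disc (circ t : plane).
Proof. by rewrite /disc /= cos2Dsin2. Qed.

Lemma disc_boundary (z : plane) : disc z -> ~ open_disc z -> exists t, z = circ t.
Proof.
rewrite /disc /open_disc /= => dz oz.
have [|t [c s]] := @angle_exists R z.1 z.2.
  by apply/eqP; rewrite eq_le dz leNgt; apply/negP.
by exists t; rewrite /circ -c -s; case: (z).
Qed.

Lemma flip_map_continuous P : sphere P -> {for P, continuous flip_map}.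
Proof.
move=> sP; apply: smooth_at_continuous.
exact: (flip_map_smooth_at HF (smooth_at_id P) sP).
Qed.

Lemma open_disc_near (z : plane) : open_disc z -> \forall y \near z, open_disc y.
Proof.
by move=> oz; apply: (@open_nbhs_nbhs _ z open_disc); split => //; exact: open_disc_open.
Qed.

(** The flip is smooth and orientation-preserving, preserves the knot, and
    exchanges the poles. *)
Lemma smooth_immersed_disc_flip f marks : smooth_immersed_disc p g f marks ->
  smooth_immersed_disc p g (fun z => flip_map (f z)) marks.
Proof.
move=> [[f_sph f_cont f_bd] f_sm f_im f_pole f_ext].
have near_sph z : open_disc z -> \forall y \near z, sphere (f y).
  by move=> /open_disc_near; apply: filterS => y /open_disc_sub; exact: f_sph.
have od := @open_disc_sub R.
split.
- split=> [z /f_sph|| t]; first exact: (flip_map_sphere HF).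
    apply/within_continuousP => z dz B nB.
    have nB' : nbhs (f z) (flip_map @^-1` B) by exact: flip_map_continuous (f_sph z dz) B nB.
    exact: (within_continuousP _ _).1 f_cont z dz _ nB'.
  exact: (flip_Gamma OC HF).
- by move=> z oz; apply: (flip_map_smooth_at HF (f_sm z oz)); exact/f_sph/od.
- move=> z oz np; have sz := f_sph z (od z oz).
  have np' b : f z <> pole b.
    by move=> E; apply: (np (~~ b)); rewrite E flip_map_pole.
  exact: (flip_map_immersed HF (f_sm z oz) sz (rho_not_pole sz np') (f_im z oz np')).
- move=> z b oz E; have sz := f_sph z (od z oz).
  have E' := flip_map_pole_inv sz E.
  have := looks_like_power_flip (f_sm z oz) (near_sph z oz) E' (f_pole z _ oz E').
  by rewrite negbK.
move=> t Ht; have [e [se ie Ee]] := f_ext t Ht.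
have ee : e (circ t) = f (circ t) by exact: nbhs_singleton Ee (disc_circ t).
have sz : sphere (e (circ t)) by rewrite ee; exact/f_sph/disc_circ.
exists (fun z => flip_map (e z)); split.
- exact: (flip_map_smooth_at HF se sz).
- apply: (flip_map_immersed HF se sz) ie; apply: rho_not_pole => // b E.
  by have := f_bd t; rewrite -ee E => /(Gamma_not_pole OC).
- by apply: filterS Ee => z H /H ->.
Qed.

Definition flip_disc (D : @labelled_disc R p 1 g) : labelled_disc p 1 g :=
  LabelledDisc (fun z => flip_map (dmap D z)) (corner0 D) (corners D) (word D).

Lemma admissible_disc_flip x D : admissible_disc x D -> admissible_disc x (flip_disc D).
Proof.
move=> [H1 H2 H3 [Q LQ FQ] [H4 H5]]; have cx := set_valP x.
split=> //=.
- exact: smooth_immersed_disc_flip.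
- exists (opposite Q); first by rewrite label_pos_opposite.
  exact: (fills_flip OC HF).
split=> // i y t E1 E2; have [Q' L' F'] := H5 i y t E1 E2.
exists (opposite Q'); first by rewrite label_neg_opposite.
by apply: (fills_flip OC HF) => //; exact: set_valP.
Qed.

(** Away from the knot and the poles, the disc is an immersion without
    boundary. *)
Lemma disc_multiplicity_constant x (D : @labelled_disc R p 1 g) (X : set space) :
  admissible_disc x D -> connected X ->
  (forall P, X P -> [/\ sphere P, ~ Gamma p g P & forall b, P <> pole b]) ->
  forall P Q, X P -> X Q ->
  #|` fset_set [set z : plane | disc z /\ dmap D z = P]| =
  #|` fset_set [set z : plane | disc z /\ dmap D z = Q]|.
Proof.
move=> [_ _ [[f_sph f_cont f_bd] f_sm f_im _ _] _ _] cX HX.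
pose B : set space := [set P | Gamma p g P \/ exists b, P = pole b].
apply: (@multiplicity_constant R (dmap D) B) => //.
- by move=> z dz oz; have [t ->] := disc_boundary dz oz; left.
- by move=> z oz NB; apply: f_im => // b E; apply: NB; right; exists b.
- by move=> P /HX[sP GP nP]; split=> // -[//|[b]]; exact: nP.
Qed.

Lemma fset_fiber_flip (D : @labelled_disc R p 1 g) P :
  (forall z, disc z -> sphere (dmap D z)) -> sphere P ->
  [set z : plane | disc z /\ dmap (flip_disc D) z = flip_map P] =
  [set z : plane | disc z /\ dmap D z = P].
Proof.
move=> sD sP; apply/seteqP; split=> z /= [dz E]; split=> //; last by rewrite E.
exact: (flip_map_inj HF) (sD z dz) sP E.
Qed.

Let NS : region_north k <> region_south k.
Proof. by move=> E; have := north_pole k; rewrite E => /south_not_north_pole. Qed.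

Let mid_neq (C : set space) b : C (pole b) -> region_mid k <> C.
Proof. by move=> H E; move: H; rewrite -E => /mid_not_pole. Qed.

Lemma chain_defect_regions q (m : space -> R) :
  let pt C := xget 0 (C `\ pole true `\ pole false) in
  chain_defect p q 1 g m =
    m (pt (region_north k)) * region_defect p q 1 g (region_north k) +
    m (pt (region_south k)) * region_defect p q 1 g (region_south k) +
    m (pt (region_mid k)) * region_defect p q 1 g (region_mid k).
Proof.
move=> pt; rewrite /chain_defect (regionsE OC).
have MN := mid_neq (north_pole k); have MS := mid_neq (south_pole k).
rewrite fsbigU0 ?fsbig_set1; first last.
- by move=> C /= [[->|->]] E; [case: MN|case: MS].
- exact: finite_set1.
- by rewrite finite_setU; split; exact: finite_set1.
by rewrite fsbigU0 ?fsbig_set1 // => C /= [-> /NS].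
Qed.

Lemma xget_punctured (C : set space) P : C P -> (forall b, P <> pole b) ->
  let Q := xget 0 (C `\ pole true `\ pole false) in C Q /\ forall b, Q <> pole b.
Proof.
move=> CP nP Q; have [[CQ Q1] Q2] : (C `\ pole true `\ pole false) Q.
  by apply: (xgetPex 0); exists P; split; [split=> //|]; exact: nP.
by split=> // -[].
Qed.

(** The multiplicities of the polar regions are exchanged, but these regions
    have equal defects. *)
Lemma disc_defect_flip q x D : admissible_disc x D ->
  disc_defect q (flip_disc D) = disc_defect q D.
Proof.
move=> aD; have aF := admissible_disc_flip aD.
have sD z : disc z -> sphere (dmap D z) by case: aD => [_ _ [[H _ _] _ _ _ _] _ _]; exact: H.
rewrite /disc_defect !chain_defect_regions -(region_defect_north_south OC HF).
pose pt (C : set space) := xget 0 (C `\ pole true `\ pole false).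
rewrite -!/(pt _).
have pN : region_north k (pt (region_north k)) /\ forall b, pt (region_north k) <> pole b.
  apply: (@xget_punctured _ (cyl (top k 0 + 1) 0)) => [|b]; last exact: cyl_not_pole.
  by apply/(north_cyl OC); lra.
have pS : region_south k (pt (region_south k)) /\ forall b, pt (region_south k) <> pole b.
  apply: (@xget_punctured _ (cyl (bot k 0 - 1) 0)) => [|b]; last exact: cyl_not_pole.
  by apply/(south_cyl OC); lra.
have pM : region_mid k (pt (region_mid k)) /\ forall b, pt (region_mid k) <> pole b.
  have [P HP] := mid_nonempty OC.
  by apply: (xget_punctured HP) => b E; move: HP; rewrite E => /mid_not_pole.
have sph C P : [\/ C = region_north k, C = region_south k | C = region_mid k] -> C P ->
    sphere P /\ ~ Gamma p g P.
  by move=> [] -> H; apply: (regions_off OC); [constructor 1|constructor 2|constructor 3].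
have npF P : sphere P -> (forall b, P <> pole b) -> forall b, flip_map P <> pole b.
  by move=> sP nP b /(flip_map_pole_inv sP); exact: nP.
have mN : #|` fset_set [set z : plane | disc z /\ dmap (flip_disc D) z = pt (region_north k)]| =
          #|` fset_set [set z : plane | disc z /\ dmap D z = pt (region_south k)]|.
  have [sS _] := sph _ _ (Or32 _ _ erefl) pS.1.
  rewrite -(fset_fiber_flip sD sS).
  apply: (disc_multiplicity_constant aF (north_punctured_connected OC)).
  - move=> P [NP nP]; have [sP GP] := sph _ _ (Or31 _ _ erefl) NP.
    by split=> // -[//|] E; move: NP; rewrite E => /north_not_south_pole.
  - by split; [exact: pN.1|exact: pN.2].
  - by split; [exact: (flip_south OC HF) pS.1|exact: npF sS pS.2 true].
have mS : #|` fset_set [set z : plane | disc z /\ dmap (flip_disc D) z = pt (region_south k)]| =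
          #|` fset_set [set z : plane | disc z /\ dmap D z = pt (region_north k)]|.
  have [sN _] := sph _ _ (Or31 _ _ erefl) pN.1.
  rewrite -(fset_fiber_flip sD sN).
  apply: (disc_multiplicity_constant aF (south_punctured_connected OC)).
  - move=> P [NP nP]; have [sP GP] := sph _ _ (Or32 _ _ erefl) NP.
    by split=> // -[|//] E; move: NP; rewrite E => /south_not_north_pole.
  - by split; [exact: pS.1|exact: pS.2].
  - by split; [exact: (flip_north OC HF) pN.1|exact: npF sN pN.2 false].
have mM : #|` fset_set [set z : plane | disc z /\ dmap (flip_disc D) z = pt (region_mid k)]| =
          #|` fset_set [set z : plane | disc z /\ dmap D z = pt (region_mid k)]|.
  have [sM _] := sph _ _ (Or33 _ _ erefl) pM.1.
  rewrite -(fset_fiber_flip sD sM).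
  apply: (disc_multiplicity_constant aF (mid_connected OC)).
  - move=> P MP; have [sP GP] := sph _ _ (Or33 _ _ erefl) MP.
    by split=> // b E; move: MP; rewrite E => /mid_not_pole.
  - exact: pM.1.
  - exact: (flip_mid OC HF) pM.1.
by rewrite mN mS mM; congr (_ + _); rewrite addrC.
Qed.

Lemma x_defect_flip q x D : admissible_disc x D ->
  x_defect q x (flip_disc D) = x_defect q x D.
Proof. by move=> aD; rewrite /x_defect (disc_defect_flip q aD). Qed.

End FlippedDisc.

(** * The discs cancel in pairs *)

Section SameDisc.
Context {R : realType} (p : nat) (g : R -> R).
Local Notation plane := (R * R)%type.
Local Notation ldisc := (labelled_disc p 1 g).

Lemma within_comp (D : set plane) (f h : plane -> plane) :
  {within D, continuous f} -> {within D, continuous h} ->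
  (forall z, D z -> D (f z)) -> {within D, continuous (fun z => h (f z))}.
Proof.
move=> /within_continuousP cf /within_continuousP ch fD; apply/within_continuousP => z Dz B nB.
have := cf z Dz _ (ch (f z) (fD z Dz) B nB).
by apply: filterS => y H Dy; apply: (H Dy); exact: fD.
Qed.

Lemma same_disc_refl (D : ldisc) : same_disc D D.
Proof.
exists id, id; split=> //.
by split=> // z; apply: continuous_subspaceT => y; exact: cvg_id.
Qed.

Lemma same_disc_sym (D D' : ldisc) : same_disc D D' -> same_disc D' D.
Proof.
move=> [psi [psi' [[c c' K K'] E E0 Es Ew]]]; exists psi', psi; split=> //.
- by move=> z dz; have [dz' e] := K' z dz; rewrite -[in RHS]e E.
- by rewrite -E0; apply: (K _ (disc_circ _)).2.
transitivity (map psi' [seq circ t | t <- corners D']); first by rewrite -map_comp.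
rewrite -Es -map_comp.
by apply: eq_map => t /=; exact: (K _ (disc_circ _)).2.
Qed.

Lemma same_disc_trans (D1 D2 D3 : ldisc) : same_disc D1 D2 -> same_disc D2 D3 ->
  same_disc D1 D3.
Proof.
move=> [f [f' [[cf cf' K K'] E E0 Es Ew]]] [h [h' [[ch ch' L L'] G G0 Gs Gw]]].
exists (fun z => h (f z)), (fun z => f' (h' z)); split.
- split.
  + by apply: within_comp => // z /K[].
  + by apply: within_comp => // z /L'[].
  + by move=> z dz; have [d1 e1] := K z dz; have [d2 e2] := L _ d1; rewrite e2 e1.
  + by move=> z dz; have [d1 e1] := L' z dz; have [d2 e2] := K' _ d1; rewrite e2 e1.
- by move=> z dz; have [d1 _] := K z dz; rewrite G // E.
- by rewrite E0.
- rewrite -Gs; transitivity (map h [seq circ t | t <- corners D2]).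
    by rewrite -Es -map_comp.
  by rewrite -map_comp.
- by rewrite Ew.
Qed.

End SameDisc.

Section Types.
Context {R : realType} (p : nat) (g k : R -> R) (sg ps : R) (tau : R -> R).
Hypothesis OC : one_crossing p g k sg ps tau.
Local Notation plane := (R * R)%type.
Local Notation ldisc := (labelled_disc p 1 g).

(** One quadrant of each opposite pair. *)
Definition upper (Q : quadrant) : bool :=
  match Q with North | East => true | South | West => false end.

Lemma upper_opposite Q : upper (opposite Q) = ~~ upper Q.
Proof. by case: Q. Qed.

Lemma crossing_germ_region e Q P : crossing_germ k ps e Q P ->
  match Q with
  | North => region_north k P
  | South => region_south k P
  | _ => region_mid k P
  end.
Proof.
move=> [s [y [_ _ -> ]]]; case: Q => /=.
- by move=> H; apply/(north_cyl OC).
- by move=> [_ H]; apply/(mid_cyl OC).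
- by move=> H; apply/(south_cyl OC).
- by move=> [_ H]; apply/(mid_cyl OC).
Qed.

Lemma crossing_germ_off e Q P : crossing_germ k ps e Q P -> ~ Gamma p g P.
Proof.
move=> H; suff [] : (sphere `\` Gamma p g) P by [].
apply: (regions_off OC); have := crossing_germ_region H; case: Q {H} => H.
- by constructor 1.
- by constructor 3.
- by constructor 2.
- by constructor 3.
Qed.

Lemma crossing_germ_upper Q Q' P : crossing_germ k ps 1 Q P ->
  crossing_germ k ps 1 Q' P -> upper Q = upper Q'.
Proof.
have EW P' : crossing_germ k ps 1 East P' -> crossing_germ k ps 1 West P' -> False.
  move=> [s [y [Dy _ -> [y1 _]]]] [s' [y' [Dy' _ /cyl_inj[_ Ec Es] [y2 _]]]].
  have p2 := pi_gt0 R; have pi1 := pi_ge2 R.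
  have [n E] := angle_eq Ec Es; move: Dy Dy'; rewrite !ltr_norml => /andP[D1 D2] /andP[D3 D4].
  have n0 : n = 0.
    have : (-1 < n < 1)%R.
      rewrite -(ltr_int R) -(ltr_int R) /= rmorphN /=.
      have -> : n%:~R = (y - y') / (2 * pi) :> R by rewrite E; field; lra.
      by rewrite ltr_pdivlMr ?ltr_pdivrMr; try lra; apply/andP; split; lra.
    by case: (n) => [[|]|[|]].
  by move: E; rewrite n0 mulr0 addr0 => E; move: y1 y2; rewrite E; lra.
move=> H H'; have := crossing_germ_region H'; have := crossing_germ_region H.
case: Q H => H; case: Q' H' => H' //= r1 r2.
- by case: (region_disjoint_NS OC r1 r2).
- by case: (region_disjoint_NM r1 r2).
- by case: (region_disjoint_SM r2 r1).
- by case: (EW _ H H').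
- by case: (region_disjoint_NS OC r2 r1).
- by case: (region_disjoint_SM r1 r2).
- by case: (region_disjoint_NM r2 r1).
- by case: (EW _ H' H).
Qed.

Lemma open_disc_near_circ t (B : set plane) : nbhs (circ t) B ->
  exists2 z, B z & open_disc z.
Proof.
move=> /nbhs_ballP[e /= e0 H]; pose d := Num.min e 1 / 2.
have [d0 d1 de] : [/\ 0 < d, d < 1 & d < e].
  have m0 : 0 < Num.min e 1 by rewrite lt_min e0 ltr01.
  have m1 : Num.min e 1 <= 1 by rewrite ge_min lexx orbT.
  have m2 : Num.min e 1 <= e by rewrite ge_min lexx.
  by rewrite /d; split; lra.
have near c : `|c| <= 1 -> `|c - (1 - d) * c| < e.
  move=> c1; rewrite (_ : c - _ = d * c); last by ring.
  rewrite normrM (gtr0_norm d0); apply: le_lt_trans de.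
  by rewrite -[leRHS]mulr1 ler_wpM2l // ltW.
exists ((1 - d) * cos t, (1 - d) * sin t).
  apply: H; split; rewrite /ball /=; apply: near.
    by rewrite ler_norml cos_geN1 cos_le1.
  by rewrite ler_norml sin_geN1 sin_le1.
rewrite /open_disc /= !exprMn -mulrDr cos2Dsin2 mulr1.
by rewrite expr_lt1 //; lra.
Qed.

(** The parametrization does not change which side of the crossing is filled:
    close to the corner the interiors correspond, since the quadrant is disjoint
    from the knot. *)
Lemma same_disc_upper (x : generator p 1 g) (D D' : ldisc) Q Q' :
  admissible_disc x D' -> same_disc D D' ->
  fills p g (dmap D) (circ (corner0 D)) (val x) Q ->
  fills p g (dmap D') (circ (corner0 D')) (val x) Q' -> upper Q = upper Q'.
Proof.
move=> [_ _ [[_ _ f_bd] _ _ _ _] _ _] [psi [psi' [[c _ K _] E E0 _ _]]].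
have cx := set_valP x.
move=> /(fillsP OC _ _ _ cx)[_ H _] /(fillsP OC _ _ _ cx)[_ H' _].
have Q1 := H 1 ltr01; have Q1' := H' 1 ltr01.
rewrite -E0 in Q1'; have Q2 := (within_continuousP _ _).1 c _ (disc_circ _) _ Q1'.
have [z [z1 z2] oz] := open_disc_near_circ (filterI Q1 Q2).
have dz := open_disc_sub oz; have G := z1 oz; have [dz' _] := K z dz.
have oz' : open_disc (psi z).
  apply: contrapT => nz; have [t Et] := disc_boundary dz' nz.
  by apply: (crossing_germ_off G); rewrite -(E z dz) Et; exact: f_bd.
have G' := z2 dz oz'; rewrite (E z dz) in G'.
exact: crossing_germ_upper G G'.
Qed.

Context (A lam chi : R -> R) (N : R) (HF : flip k sg ps A lam chi N).
Local Notation flip_disc := (flip_disc ps A lam chi).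

Lemma same_disc_flip (x : generator p 1 g) (D D' : ldisc) :
  admissible_disc x D -> admissible_disc x D' ->
  same_disc (flip_disc D) (flip_disc D') -> same_disc D D'.
Proof.
move=> [_ _ [[sD _ _] _ _ _ _] _ _] [_ _ [[sD' _ _] _ _ _ _] _ _].
move=> [psi [psi' [[c c' K K'] E E0 Es Ew]]]; exists psi, psi'; split=> //.
move=> z dz; have [dz' _] := K z dz.
by apply: (flip_map_inj HF); [exact: sD'|exact: sD|exact: E].
Qed.

Definition disc_class (x : generator p 1 g) (D : ldisc) :
    seq (generator p 1 g) * set ldisc :=
  (word D, [set D' | admissible_disc x D' /\ same_disc D D']).

Lemma disc_class_eq x (D D' : ldisc) : same_disc D D' -> disc_class x D = disc_class x D'.
Proof.
move=> H; have [_ [_ [_ _ _ _ Ew]]] := H; rewrite /disc_class Ew; congr (_, _).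
apply/seteqP; split=> D'' [aD H']; split=> //.
  exact: same_disc_trans (same_disc_sym H) H'.
exact: same_disc_trans H H'.
Qed.

Lemma disc_class_same x (D D' : ldisc) : admissible_disc x D' ->
  disc_class x D = disc_class x D' -> same_disc D D'.
Proof.
by move=> aD' [_ /seteqP[_ H]]; have [] := H D' (conj aD' (same_disc_refl D')).
Qed.

Definition upper_class (x : generator p 1 g) (c : seq (generator p 1 g) * set ldisc) : Prop :=
  exists D Q, [/\ c.2 D, admissible_disc x D, upper Q, label_pos p g (val x) Q
    & fills p g (dmap D) (circ (corner0 D)) (val x) Q].

(** The injection flips a chosen representative of each class.  It has no reason
    to be an involution, as the square of the flip is not the identity; but
    [upper_class] tells a class from its image. *)
Lemma disc_classes_flip q (x : generator p 1 g) :
  exists Phi : seq (generator p 1 g) * set ldisc -> seq (generator p 1 g) * set ldisc,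
  [/\ forall c, disc_classes q x c -> disc_classes q x (Phi c),
      forall c, disc_classes q x c -> upper_class x (Phi c) <-> ~ upper_class x c,
      forall c, disc_classes q x c -> (Phi c).1 = c.1
    & forall c c', disc_classes q x c -> disc_classes q x c' -> Phi c = Phi c' -> c = c'].
Proof.
have /choice[rep Hrep] c : exists D, disc_classes q x c ->
    [/\ admissible_disc x D, x_defect q x D = 0 & c = disc_class x D].
  have [[D H]|nH] := pselect (disc_classes q x c); first by exists D.
  by exists (LabelledDisc (fun=> 0) 0 [::] [::]) => /nH.
exists (fun c => disc_class x (flip_disc (rep c))); split.
- move=> c /Hrep[aD d0 _]; exists (flip_disc (rep c)); split => //.
    exact: (admissible_disc_flip OC HF).
  by rewrite (x_defect_flip OC HF q aD).
- move=> c /Hrep[aD d0 Ec]; have aF := admissible_disc_flip OC HF aD.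
  have -> : upper_class x c = upper_class x (disc_class x (rep c)).
    by congr (upper_class x _); exact: Ec.
  have aD' := aD; case: aD' => _ _ _ [Q LQ FQ] _.
  have FF : fills p g (dmap (flip_disc (rep c))) (circ (corner0 (flip_disc (rep c)))) (val x) (opposite Q).
    exact: (fills_flip OC HF (set_valP x) FQ).
  split.
    move=> [D1 [Q1 [[_ s1] a1 u1 _ F1]]] [D2 [Q2 [[_ s2] a2 u2 _ F2]]].
    have := @same_disc_upper x _ _ _ _ a1 s1 FF F1; rewrite upper_opposite u1.
    by have := @same_disc_upper x _ _ _ _ a2 s2 FQ F2; rewrite u2 => ->.
  move=> nU; exists (flip_disc (rep c)), (opposite Q); split=> //.
  + by split=> //; exact: same_disc_refl.
  + rewrite upper_opposite; apply/negP => uQ; apply: nU; exists (rep c), Q; split=> //.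
    by split=> //; exact: same_disc_refl.
  + by rewrite label_pos_opposite.
- by move=> c /Hrep[_ _ {2}->].
- move=> c c' /Hrep[aD _ E] /Hrep[aD' _ E'] EP; rewrite E E'; apply: disc_class_eq.
  apply: (@same_disc_flip x _ _ aD aD'); apply: (@disc_class_same x) EP.
  exact: (admissible_disc_flip OC HF aD').
Qed.

End Types.

Section Pairing.

Lemma finite_injection_surj (T : choiceType) (X : set T) (f : T -> T) :
  finite_set X -> (forall c, X c -> X (f c)) ->
  (forall c c', X c -> X c' -> f c = f c' -> c = c') ->
  forall c, X c -> exists2 c', X c' & f c' = c.
Proof.
move=> fX fXX inj c Xc.
have fE : f @` X = X.
  suff : (fset_set (f @` X) = fset_set X)%fset.
    by move=> E; rewrite -[LHS]fset_setK ?E ?fset_setK //; exact: finite_image.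
  apply/eqP; rewrite eqEfcard; apply/andP; split.
    apply/fsubsetP => y; rewrite !in_fset_set //; last exact: finite_image.
    by rewrite !inE => -[z Xz <-]; exact: fXX.
  rewrite fset_set_image // card_in_imfset //= => a b; rewrite !in_fset_set // !inE.
  exact: inj.
by have : (f @` X) c by rewrite fE.
Qed.

(** If [X] is finite, then the injection is onto and matches the terms of the
    two parts; if not, the sum has infinite support and is 0 by convention. *)
Lemma fsbig_exchange (T : choiceType) (V : zmodType) (X U : set T) (F : T -> V) (f : T -> T) :
  (forall v : V, v + v = 0) -> (forall c, F c <> 0) ->
  (forall c, X c -> X (f c)) -> (forall c, X c -> U (f c) <-> ~ U c) ->
  (forall c, X c -> F (f c) = F c) ->
  (forall c c', X c -> X c' -> f c = f c' -> c = c') ->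
  \sum_(c \in X) F c = 0.
Proof.
move=> V2 F0 fX fU fF inj.
have [finX|infX] := pselect (finite_set X); last first.
  rewrite no_finite_support ?big_nil // => H; apply: infX; apply: sub_finite_set H.
  by move=> c Xc; split=> //; exact: F0.
have -> : X = (X `&` U) `|` (X `&` ~` U) by rewrite -setIUr setUv setIT.
rewrite fsbigU0; first last.
- by move=> c /= [[_ ?] [_ ?]].
- exact: sub_finite_set finX.
- exact: sub_finite_set finX.
rewrite (reindex_fsbig f (X `&` ~` U) (X `&` U)).
  rewrite -[RHS](V2 (\sum_(c \in X `&` ~` U) F c)); congr (_ + _).
  by apply: eq_fsbigr => c /set_mem[Xc _]; exact: fF.
split.
- by move=> c [Xc nU]; split; [exact: fX|exact/fU].
- by move=> c c' /set_mem[Xc _] /set_mem[Xc' _]; exact: inj.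
move=> c [Xc Uc]; have [c' Xc' fc'] := finite_injection_surj finX fX inj Xc.
by exists c' => //; split=> //; apply/(fU _ Xc'); rewrite fc'.
Qed.

End Pairing.

Section Differential.
Context {R : realType} (p : nat) (g k : R -> R) (sg ps : R) (tau : R -> R).
Hypothesis OC : one_crossing p g k sg ps tau.

Lemma tensor_algebra2 (G : choiceType) (a : tensor_algebra G) : a + a = 0.
Proof.
have F2 : 1 + 1 = 0 :> 'F_2 by apply/val_inj.
by rewrite -[a]scale1r -scalerDl F2 scale0r.
Qed.

Lemma monomial_neq0 (G : choiceType) (w : seq G) : monomial w <> 0.
Proof.
move=> /(congr1 (mcoeff (FMonom w))); rewrite mcoeffUU mcoeff0.
by move/eqP; rewrite oner_eq0.
Qed.

(** The discs with a given word cancel in pairs. *)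
Lemma differential0 q a : differential p q 1 g a = 0.
Proof.
have [A [lam [chi [N HF]]]] := flip_exists (oc_profile OC).
have D0 x : \sum_(c \in disc_classes q x) monomial c.1 = 0 :> tensor_algebra (generator p 1 g).
  have [Phi [P1 P2 P3 P4]] := disc_classes_flip OC HF q x.
  apply: (@fsbig_exchange _ (tensor_algebra (generator p 1 g)) (disc_classes q x)
    [set c | upper_class x c] (fun c => monomial c.1) Phi) => //.
  - exact: tensor_algebra2.
  - by move=> c; exact: monomial_neq0.
  - by move=> c /P3 ->.
rewrite /differential /leibniz big1_seq // => w _.
by rewrite big1 ?scaler0 // => i _; rewrite D0 mulr0 mul0r.
Qed.

End Differential.

(** * Tensor algebras *)

Section Relabelling.
Context {G G' : choiceType} (b : G -> G').

Lemma monomialM (H : choiceType) (v w : seq H) :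
  monomial (v ++ w) = monomial v * monomial w.
Proof.
rewrite malgME /monomial !msuppU1 !big_seq_fset1 !mcoeffUU mulr1.
by congr (mkmalgU _ _); apply: val_inj; rewrite /= fmM.
Qed.

Definition relabel_monomial (w : fmonom G) : tensor_algebra G' :=
  monomial (map b (fmonom_val w)).

Lemma relabel_monomial_morphism : mmorphism relabel_monomial.
Proof.
split=> [v w|]; first by rewrite /relabel_monomial fmM map_cat monomialM.
by rewrite /relabel_monomial fm1 /monomial; congr (mkmalgU _ _); apply: val_inj; rewrite /= fm1.
Qed.

HB.instance Definition _ := monalg.isMultiplicative.Build (fmonom G)
  (tensor_algebra G') relabel_monomial relabel_monomial_morphism.

Definition relabel (a : tensor_algebra G) : tensor_algebra G' :=
  mmap (mkmalgU (@monalg.one (fmonom G'))) relabel_monomial a.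

Lemma relabelU (c : 'F_2) (w : seq G) :
  relabel (mkmalgU (FMonom w) c) = mkmalgU (FMonom (map b w)) c.
Proof.
rewrite /relabel mmapU mul_malgC /relabel_monomial /=; apply/malgP => k.
by rewrite mcoeffZ !mcoeffU mulrnAr mulr1.
Qed.

Lemma relabel1 : relabel 1 = 1.
Proof. exact: mmap1. Qed.

Lemma relabelD x y : relabel (x + y) = relabel x + relabel y.
Proof. exact: mmapD. Qed.

Lemma relabel0 : relabel 0 = 0.
Proof. exact: mmap0. Qed.

Lemma relabelM x y : relabel (x * y) = relabel x * relabel y.
Proof.
apply: (commr_mmap_is_multiplicative _).1 => h m m'.
have U c1 c2 k1 k2 : mkmalgU k1 c1 * mkmalgU k2 c2 =
    mkmalgU (monalg.mul k1 k2) (c1 * c2) :> tensor_algebra G' by exact: fgmulUU.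
by rewrite /GRing.comm /relabel_monomial /monomial !U mul1m mulm1 mulrC.
Qed.

Lemma relabel_sum I (r : seq I) (F : I -> tensor_algebra G) :
  relabel (\sum_(i <- r) F i) = \sum_(i <- r) relabel (F i).
Proof. exact: (big_morph relabel relabelD relabel0). Qed.

End Relabelling.

Lemma relabelK (G G' : choiceType) (b : G -> G') (b' : G' -> G) :
  cancel b b' -> cancel (relabel b) (relabel b').
Proof.
move=> K a.
have E : a = \sum_(w <- msupp a) (mkmalgU w (mcoeff w a) : tensor_algebra G).
  exact: monalgE.
rewrite [in LHS]E [in RHS]E !relabel_sum; apply: eq_bigr => w _.
have -> : w = FMonom (fmonom_val w) by apply: val_inj.
by rewrite !relabelU (mapK K).
Qed.

(** All of the algebra is its own homology. *)
Lemma homology_isomorphic0 (G G' : choiceType) (D : tensor_algebra G -> tensor_algebra G)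
    (b : G -> G') (b' : G' -> G) : (forall a, D a = 0) -> cancel b b' -> cancel b' b ->
  homology_isomorphic D (tensor_algebra G').
Proof.
move=> D0 K K'; split=> [a|]; first by rewrite !D0.
exists (relabel b); split.
- by rewrite D0 relabel1.
- by move=> x y _ _; rewrite !D0 relabelD relabelM.
- by move=> c; exists (relabel b' c); rewrite ?D0 ?(relabelK K').
- move=> a _; split=> [E|[c ->]]; last by rewrite D0 relabel0.
  by exists 0; rewrite D0 -(relabelK K a) E relabel0.
Qed.

Section Augmentation.
Context (G : choiceType).

Definition zero_character (w : fmonom G) : 'F_2 := \prod_(x <- fmonom_val w) 0.

Lemma zero_character_morphism : mmorphism zero_character.
Proof.
split=> [v w|]; first by rewrite /zero_character fmM big_cat.
by rewrite /zero_character fm1 big_nil.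
Qed.

HB.instance Definition _ := monalg.isMultiplicative.Build (fmonom G)
  'F_2 zero_character zero_character_morphism.

(** All words but the empty one go to 0. *)
Lemma zero_augmentation (D : tensor_algebra G -> tensor_algebra G) (deg0 : seq G -> Prop) :
  (forall a, D a = 0) -> deg0 [::] -> is_augmentation D deg0 (algebra_extension (fun=> 0)).
Proof.
move=> D0 d0; have E : algebra_extension (fun _ : G => 0) = mmap idfun zero_character by [].
rewrite E; split.
- exact: mmap1.
- exact: mmapD.
- by move=> a b; rewrite (@mmap_is_multiplicative _ _ _ idfun zero_character).1.
- by move=> a; rewrite D0; exact: mmap0.
- by case=> [/(_ d0)//|x w] _; rewrite /monomial mmapU /zero_character /= big_cons mul0r mulr0.
Qed.

End Augmentation.

Lemma card2_bijection (T : pointedType) (X : set T) : (X #= `I_2)%card ->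
  exists (b : set_type X -> 'I_2) (b' : 'I_2 -> set_type X), cancel b b' /\ cancel b' b.
Proof.
rewrite card_eq_sym => /card_set_bijP[f [fX finj fsur]].
have Hf (i : 'I_2) : f i \in X by apply: mem_set; apply: fX; exact: ltn_ord.
pose b' (i : 'I_2) : set_type X := SigSub (Hf i).
have /choice[b Hb] (x : set_type X) : exists i, b' i = x.
  have [i i2 fi] := fsur _ (set_valP x).
  by exists (Ordinal i2); apply: val_inj.
exists b, b'; split=> // i; apply: val_inj; apply: finj; rewrite ?inE /=; try exact: ltn_ord.
by have := congr1 val (Hb (b' i)).
Qed.

Theorem theorem1 (R : realType) (p : nat) (p_ge3 : (3 <= p)%N)
    (cop : coprime (p - 2)%N p) :
  sufficiently_small_fronts p (p - 1)%N 1 (fun g : R -> R =>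
    [/\ (chords p 1 g #= `I_2)%card,
        homology_isomorphic (differential p (p - 1)%N 1 g)
          (tensor_algebra 'I_2)
      & is_augmentation (differential p (p - 1)%N 1 g)
          (zero_degree p (p - 1)%N 1 g)
          (algebra_extension (fun _ : generator p 1 g => 0))]).
Proof.
have [eps eps0 H] := special_front_one_crossing R p_ge3.
exists eps => // d /H [delta delta0 {}H]; exists delta => // g.
move=> /H [k [sg [ps [tau OC]]]].
have D0 := differential0 OC (p - 1)%N.
have card2 := chords_card OC; split; first exact: card2.
  have [b [b' [K K']]] := card2_bijection card2.
  exact: homology_isomorphic0 D0 K K'.
apply: zero_augmentation; first exact: D0.
by rewrite /zero_degree big_nil dvdz0.
Qed.
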